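(* Let $\nu\ge1$ be an integer and $C_\nu=\frac1{\nu+1}\binom{2\nu}{\nu}$ the $\nu$-th Catalan number. For each $g\in\{0,\dots,5\}$ and $j\in\{1,2,3\}$, $\mathscr N_g(2\nu,j)=C_\nu^{\,j}S_{g,j}(\nu)$, where $S_{0,1}=1$, $S_{0,2}=\frac12(\nu+1)^2\nu$, $S_{0,3}=(\nu+1)^3\nu^3$, $S_{1,1}=\frac1{12}(\nu+1)\nu(\nu-1)$, $S_{1,2}=\frac1{12}(\nu+1)^2\nu^2(3\nu-1)(\nu-1)$, $S_{1,3}=\frac1{12}(17\nu^2-13\nu+2)(\nu+1)^3\nu^3(\nu-1)$, $S_{2,1}=\frac1{1440}(5\nu-2)\prod_{i=-1}^3(\nu-i)$, $S_{2,2}=\frac1{1440}(\nu+1)^2\nu^2(2\nu-3)(49\nu^2-43\nu+6)\prod_{i=1}^2(\nu-i)$, $S_{2,3}=\frac1{480}(\nu+1)^3\nu^3(\nu-1)(539\nu^5-2356\nu^4+3677\nu^3-2460\nu^2+660\nu-48)$, $S_{3,1}=\frac1{362880}(35\nu^2-77\nu+12)\prod_{i=-1}^5(\nu-i)$, $S_{3,2}=\frac1{181440}(\nu+1)^2\nu^2(2\nu-5)(1181\nu^4-4282\nu^3+4969\nu^2-1868\nu+120)\prod_{i=1}^3(\nu-i)$, $S_{3,3}=\frac1{13440}(8621\nu^7-67098\nu^6+207750\nu^5-326324\nu^4+273029\nu^3-115578\nu^2+20560\nu-800)(\nu+1)^3\nu^3\prod_{i=1}^2(\nu-i)$, $S_{4,1}=\frac1{87091200}(175\nu^3-945\nu^2+1094\nu-72)\prod_{i=-1}^7(\nu-i)$,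 $S_{4,2}=\frac1{43545600}(2\nu-5)(2\nu-7)(21015\nu^5-117163\nu^4+228063\nu^3-182453\nu^2+50034\nu-1512)(\nu+1)^2\nu^2\prod_{i=1}^4(\nu-i)$, $S_{4,3}=\frac1{9676800}(2805887\nu^9-33646824\nu^8+170341574\nu^7-473605544\nu^6+786759767\nu^5-794026448\nu^4+471186660\nu^3-149071904\nu^2+19693632\nu-376320)(\nu+1)^3\nu^3\prod_{i=1}^3(\nu-i)$, $S_{5,1}=\frac1{11496038400}(385\nu^4-3850\nu^3+11099\nu^2-8954\nu+240)\prod_{i=-1}^9(\nu-i)$, $S_{5,2}=\frac1{2874009600}(2\nu-7)(2\nu-9)(168155\nu^7-1803472\nu^6+7641252\nu^5-16263590\nu^4+18157345\nu^3-9913818\nu^2+2014128\nu-25920)(\nu+1)^2\nu^2\prod_{i=1}^5(\nu-i)$, $S_{5,3}=\frac1{425779200}(46360603\nu^{12}-973391694\nu^{11}+9018453443\nu^{10}-48560689270\nu^9+168394080893\nu^8-393534106562\nu^7+629719954801\nu^6-686021525378\nu^5+494760354900\nu^4-222565585336\nu^3+55430820000\nu^2-5767948800\nu+48384000)(\nu+1)^3\nu^3\prod_{i=1}^3(\nu-i)$.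
   Context: Labelled graphs: take $j$ vertices labelled $1,\dots,j$, each carrying $2\nu$ half-edges labelled $1,\dots,2\nu$ in counterclockwise cyclic order. A labelled $2\nu$-valent graph is a perfect matching of all $2\nu j$ half-edges (matched pairs form edges). With the prescribed cyclic orders it is a ribbon graph, i.e. a graph embedded in a compact oriented surface whose complement is a disjoint union of open cells; its genus is the minimal genus of a compact Riemann surface on which it embeds in this way. $\mathscr N_g(2\nu,j)$ is the number of such labelled graphs that are connected and have minimal genus exactly $g$. *)

(* Defs.v *)
From Stdlib Require Import BinNat.
From HB Require Import structures.
From mathcomp Require Import all_boot all_order all_algebra.

Set Implicit Arguments.
Unset Strict Implicit.
Unset Printing Implicit Defensive.

Import GRing.Theory Num.Theory.

Local Open Scope nat_scope.

Section LabelledGraphs.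

(* d is the valence, j the number of vertices; the half-edge (v, i) is the
   i-th one at v. *)
Variables d j : nat.

Definition halfedge : finType := ('I_j * 'I_d)%type.

(* The counterclockwise successor of a half-edge around its vertex. *)
Definition rotate (h : halfedge) : halfedge := (h.1, ordS h.2).

Definition perfect_matching (M : {set {set halfedge}}) : bool :=
  partition M [set: halfedge] && [forall e in M, #|e| == 2].

(* The default value h is never used when M is a perfect matching. *)
Definition mate (M : {set {set halfedge}}) (h : halfedge) : halfedge :=
  odflt h [pick h' in pblock M h | h' != h].

Definition adjacent (M : {set {set halfedge}}) : rel 'I_j :=
  fun v w => [exists h, (h.1 == v) && ((mate M h).1 == w)].

Definition connected_graph (M : {set {set halfedge}}) : bool :=
  [forall v, forall w, connect (adjacent M) v w].

(* The boundary of a face is traced by crossing an edge and then turning to the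
   next half-edge around the vertex reached. *)
Definition face_step (M : {set {set halfedge}}) (h : halfedge) : halfedge :=
  rotate (mate M h).

Definition nb_faces (M : {set {set halfedge}}) : nat :=
  fcard (face_step M) predT.

(* The rotation system determines, up to homeomorphism, the closed oriented
   surface obtained by gluing one disc along each face boundary; for a connected
   graph its genus g is given by V - E + F = 2 - 2g. *)
Definition has_genus (M : {set {set halfedge}}) (g : nat) : bool :=
  (j%:Z - #|M|%:Z + (nb_faces M)%:Z == 2 - 2 * g%:Z :> int)%R.

End LabelledGraphs.

Definition nb_graphs (g d j : nat) : nat :=
  #|[set M : {set {set halfedge d j}} |
      [&& perfect_matching M, connected_graph M & has_genus M g]]|.

Local Open Scope ring_scope.

Definition catalan (n : nat) : rat := 'C(2 * n, n)%:R / (n.+1)%:R.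

(* falling m n x is the product of x - i for m <= i <= n, i an integer. *)
Definition falling (m : int) (n : nat) (x : rat) : rat :=
  \prod_(0 <= k < `|(n%:Z + 1 - m)%R|%N) (x - (m + k%:Z)%:~R).

(* lit n is the natural number n as a rational. Plain ring literals are unary,
   so the larger constants are kept in binary, and locked so that conversion
   does not expand them. *)
HB.lock Definition lit (n : N) : rat := (nat_of_bin n)%:R.
Canonical lit_unlockable := Unlockable lit.unlock.
Arguments lit n%_num.

Definition Spoly (g j : nat) (x : rat) : rat :=
  match g, j with
  | 0%N, 1%N => 1
  | 0%N, 2%N => 1 / 2 * (x + 1) ^+ 2 * x
  | 0%N, 3%N => (x + 1) ^+ 3 * x ^+ 3
  | 1%N, 1%N => 1 / 12 * (x + 1) * x * (x - 1)
  | 1%N, 2%N => 1 / 12 * (x + 1) ^+ 2 * x ^+ 2 * (3 * x - 1) * (x - 1)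
  | 1%N, 3%N =>
      1 / 12 * (17 * x ^+ 2 - 13 * x + 2) * (x + 1) ^+ 3 * x ^+ 3 * (x - 1)
  | 2%N, 1%N => 1 / lit 1440 * (5 * x - 2) * falling (-1) 3 x
  | 2%N, 2%N =>
      1 / lit 1440 * (x + 1) ^+ 2 * x ^+ 2 * (2 * x - 3)
      * (49 * x ^+ 2 - 43 * x + 6) * falling 1 2 x
  | 2%N, 3%N =>
      1 / 480 * (x + 1) ^+ 3 * x ^+ 3 * (x - 1)
      * (539 * x ^+ 5 - lit 2356 * x ^+ 4 + lit 3677 * x ^+ 3 - lit 2460 * x ^+ 2
         + 660 * x - 48)
  | 3%N, 1%N =>
      1 / lit 362880 * (35 * x ^+ 2 - 77 * x + 12) * falling (-1) 5 x
  | 3%N, 2%N =>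
      1 / lit 181440 * (x + 1) ^+ 2 * x ^+ 2 * (2 * x - 5)
      * (lit 1181 * x ^+ 4 - lit 4282 * x ^+ 3 + lit 4969 * x ^+ 2
         - lit 1868 * x + 120)
      * falling 1 3 x
  | 3%N, 3%N =>
      1 / lit 13440
      * (lit 8621 * x ^+ 7 - lit 67098 * x ^+ 6 + lit 207750 * x ^+ 5
         - lit 326324 * x ^+ 4 + lit 273029 * x ^+ 3 - lit 115578 * x ^+ 2
         + lit 20560 * x - 800)
      * (x + 1) ^+ 3 * x ^+ 3 * falling 1 2 x
  | 4%N, 1%N =>
      1 / lit 87091200 * (175 * x ^+ 3 - 945 * x ^+ 2 + lit 1094 * x - 72)
      * falling (-1) 7 x
  | 4%N, 2%N =>
      1 / lit 43545600 * (2 * x - 5) * (2 * x - 7)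
      * (lit 21015 * x ^+ 5 - lit 117163 * x ^+ 4 + lit 228063 * x ^+ 3
         - lit 182453 * x ^+ 2 + lit 50034 * x - lit 1512)
      * (x + 1) ^+ 2 * x ^+ 2 * falling 1 4 x
  | 4%N, 3%N =>
      1 / lit 9676800
      * (lit 2805887 * x ^+ 9 - lit 33646824 * x ^+ 8 + lit 170341574 * x ^+ 7
         - lit 473605544 * x ^+ 6 + lit 786759767 * x ^+ 5
         - lit 794026448 * x ^+ 4 + lit 471186660 * x ^+ 3 - lit 149071904 * x ^+ 2
         + lit 19693632 * x - lit 376320)
      * (x + 1) ^+ 3 * x ^+ 3 * falling 1 3 x
  | 5%N, 1%N =>
      1 / lit 11496038400
      * (385 * x ^+ 4 - lit 3850 * x ^+ 3 + lit 11099 * x ^+ 2 - lit 8954 * x + 240)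
      * falling (-1) 9 x
  | 5%N, 2%N =>
      1 / lit 2874009600 * (2 * x - 7) * (2 * x - 9)
      * (lit 168155 * x ^+ 7 - lit 1803472 * x ^+ 6 + lit 7641252 * x ^+ 5
         - lit 16263590 * x ^+ 4 + lit 18157345 * x ^+ 3 - lit 9913818 * x ^+ 2
         + lit 2014128 * x - lit 25920)
      * (x + 1) ^+ 2 * x ^+ 2 * falling 1 5 x
  | 5%N, 3%N =>
      1 / lit 425779200
      * (lit 46360603 * x ^+ 12 - lit 973391694 * x ^+ 11
         + lit 9018453443 * x ^+ 10 - lit 48560689270 * x ^+ 9
         + lit 168394080893 * x ^+ 8 - lit 393534106562 * x ^+ 7
         + lit 629719954801 * x ^+ 6 - lit 686021525378 * x ^+ 5
         + lit 494760354900 * x ^+ 4 - lit 222565585336 * x ^+ 3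
         + lit 55430820000 * x ^+ 2 - lit 5767948800 * x + lit 48384000)
      * (x + 1) ^+ 3 * x ^+ 3 * falling 1 3 x
  | _, _ => 0
  end.

(* Main.v *)
Require Import Defs.
From Stdlib Require BinInt Znat QArith_base Qreduction.
From Corelib Require Import BinNums.
Import QArith_base(Q(..), Qnum, Qden, Qeq, Qplus, Qmult, Qopp, Qinv, Qeq_bool,
  Qeq_bool_iff, inject_Z).
Import Qreduction(Qred, Qred_correct).
From HB Require Import structures.
From mathcomp Require Import all_boot all_order all_algebra all_fingroup.
From mathcomp Require Import fraction generic_quotient ssrZ ring.
From mathcomp.multinomials Require Import mpoly.
From mathcomp Require Import zify lra.

(* The sum of N^(number of faces) over the matchings of the half-edges at
   vertices of given degrees is, by the Wick formula, a moment of traces of a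
   Gaussian Hermitian N x N matrix. Its loop equations are also satisfied by the
   moments of power sums against the squared Vandermonde determinant, and they
   have only one solution. The eigenvalue model, perturbed by t x^(2nu), is a
   Hankel determinant; its orthogonal polynomials, with norms h_n and recurrence
   coefficients R_n = h_n / h_(n-1), satisfy
   2 nu t d/dt (log h_n) = R_(n+1) + R_n - (2n+1),
   which becomes a difference equation in N for the generating polynomials of
   connected graphs by number of faces (the cumulants).
   Expanding at N = infinity turns this equation into a recursion that is
   triangular in the genus and in the number of vertices. The functions
   C_nu^j S_{g,j}(nu) satisfy the same recursion, which is an identity between
   explicit polynomials in nu. The recursion determines every value except the
   planar one-vertex count, which the Harer-Zagier formula gives, and those for
   which its leading factor, the number j(nu-1) + 2 - 2g of faces, vanishes;
   there both sides are 0, since every graph has a face. *)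

Set Implicit Arguments.
Unset Strict Implicit.
Unset Printing Implicit Defensive.

Import Order.TTheory GRing.Theory Num.Theory.
Local Open Scope ring_scope.

(** * Gaussian functionals and the Wick formula *)

(** Everything is kept algebraic. A Gaussian expectation is the exponential of a Laplacian evaluated
    at 0, so no integral occurs, and comparing loop equations replaces the integration over the
    unitary group. The perturbation exp(t x^(2nu)) is cut off after t^3, which suffices for three
    vertices. The moments of the cut-off weight still satisfy, coefficient by coefficient, the
    relation that integration by parts gives for the full weight. Hence the orthogonal polynomials,
    taken over the fraction field of Q[t], obey the flow equation exactly; the cut-off matters only
    when coefficients are compared with Gaussian moments. After normalisation the flow involves the
    ratios Z_(N+1) Z_(N-1) / Z_N^2, whose logarithms are second differences in N; expanding their
    exponentials produces the products of lower cumulants. Centring the difference equation at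
    half-integers gives each side a definite parity, so the expansion at infinity runs over powers
    of x^(-2), that is, over the genus. *)

Lemma mderivU n (i j : 'I_n) : ('X_i : {mpoly rat[n]})^`M(j) = (i == j)%:R.
Proof.
rewrite mderivX mnm1E; case: eqP => [->|_]; last by rewrite scale0r.
by rewrite (_ : (U_(j) - U_(j) = 0)%MM) ?mpolyX0 ?scale1r //; apply/mnmP => k; rewrite mnmBE mnm0E subnn.
Qed.

Section Gauss.
Variables (n : nat) (iota : 'I_n -> 'I_n).
Hypothesis iotaK : involutive iota.
Implicit Types p q : {mpoly rat[n]}.

Definition lap p : {mpoly rat[n]} := 2^-1 *: \sum_i (p^`M(i))^`M(iota i).

Fact lap_is_linear : linear lap.
Proof.
move=> a p q; rewrite /lap scalerA mulrC -scalerA -scalerDr; congr (_ *: _).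
rewrite scaler_sumr -big_split /=; apply: eq_bigr => i _.
by rewrite !linearP.
Qed.
HB.instance Definition _ := GRing.isLinear.Build rat {mpoly rat[n]} {mpoly rat[n]} _ lap lap_is_linear.

Lemma lap_mulX a p : lap ('X_a * p) = 'X_a * lap p + p^`M(iota a).
Proof.
rewrite /lap.
under eq_bigr => i _ do rewrite mderivM mderivU mderivD !mderivM mderivU -mpolyC_nat mderivC mul0r add0r addrA.
rewrite !big_split /= (bigD1 a) //= eqxx mul1r big1 ?addr0; last first.
  by move=> i /negbTE; rewrite eq_sym => ->; rewrite mul0r.
rewrite (bigD1 (iota a)) //= iotaK eqxx mul1r big1 ?addr0; last first.
  move=> i hi; case: eqP => [e|_]; last by rewrite mul0r.
  by rewrite e iotaK eqxx in hi.
rewrite -mulr_sumr -mulr2n -scaler_nat scalerDr scalerA mulVf //.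
by rewrite scale1r addrC scalerAr.
Qed.

(** The commutator of [lap] with multiplication by X_a is a derivative, and this derivative commutes
    with [lap]; so commuting X_a through k+1 Laplacians produces k+1 equal terms. *)
Lemma iter_lap_mulX k a p :
  iter k.+1 lap ('X_a * p) =
  'X_a * iter k.+1 lap p + k.+1%:R *: iter k lap (p^`M(iota a)).
Proof.
elim: k => [|k IH]; first by rewrite /= lap_mulX scale1r.
rewrite iterS IH linearD /= lap_mulX linearZ /= -addrA; congr (_ + _).
have -> : lap (iter k lap p) = iter k.+1 lap p by [].
have lapC q : (lap q)^`M(iota a) = lap (q^`M(iota a)).
  rewrite /lap mderivZ (raddf_sum (mderiv (iota a))) /=; congr (_ *: _); apply: eq_bigr => i _.
  by rewrite !(mderiv_comm (iota a)) .
have -> : (iter k.+1 lap p)^`M(iota a) = iter k.+1 lap (p^`M(iota a)).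
  by elim: k.+1 => [|m IHm] //; rewrite !iterS lapC IHm.
by rewrite iterS linearZ /= -[k.+2%:R]natr1 addrC scalerDl scale1r.
Qed.

(** This makes the exponential of [lap] a finite sum on every polynomial. *)
Lemma msize_lap p : (msize (lap p) <= (msize p).-1)%N.
Proof.
have msd i q : (msize (q^`M(i)) <= (msize q).-1)%N.
  rewrite [X in (X <= _)%N]msizeE; apply/bigmax_leqP_seq => m hm _.
  move: hm; rewrite mcoeff_msupp mcoeff_mderiv => h.
  have : q@_(m + U_(i)) != 0 by apply: contraNneq h => ->; rewrite mul0rn.
  rewrite -mcoeff_msupp => /msize_mdeg_lt; rewrite mdegD mdeg1 addn1.
  by case: (msize q).
rewrite (leq_trans (msizeZ_le _ _)) // (leq_trans (msize_sum _ _ _)) //.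
apply/bigmax_leqP => i _; rewrite (leq_trans (msd _ _)) //.
by rewrite (leq_trans (leq_pred _)).
Qed.

Lemma iter_lap_eq0 k p : (msize p <= k)%N -> iter k lap p = 0.
Proof.
elim: k p => [|k IH] p; first by rewrite leqn0 msize_poly_eq0 => /eqP.
move=> h; rewrite iterSr IH //.
by rewrite (leq_trans (msize_lap p)) //; case: (msize p) h.
Qed.

(** The cut-off is a parameter so that polynomials of different sizes can be compared at a common
    one. *)
Definition gauss_upto K p : rat := \sum_(k < K) (k`!%:R)^-1 * (iter k lap p)@_0.

(* The expectation of p in Gaussian variables whose only nonzero covariances
   are E[X_i X_(iota i)] = 1, as the value at 0 of exp (lap) p. *)
Definition gauss p : rat := gauss_upto (msize p) p.

Lemma gauss_uptoE K p : (msize p <= K)%N -> gauss_upto K p = gauss p.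
Proof.
move=> h; rewrite /gauss /gauss_upto -[K](subnKC h) big_split_ord /=.
rewrite [X in _ + X]big1 ?addr0 // => i _.
by rewrite iter_lap_eq0 ?leq_addr // mcoeff0 mulr0.
Qed.

Fact gauss_is_linear : linear_for *%R gauss.
Proof.
move=> a p q; set K := maxn (msize p) (maxn (msize q) (msize (a *: p + q))).
rewrite -!(@gauss_uptoE K) /K ?leq_max ?leqnn ?orbT //.
rewrite /gauss_upto mulr_sumr -big_split /=; apply: eq_bigr => k _.
have -> : iter k lap (a *: p + q) = a *: iter k lap p + iter k lap q.
  by elim: (k : nat) => //= m ->; rewrite linearP.
by rewrite mcoeffD mcoeffZ mulrDr mulrCA.
Qed.
HB.instance Definition _ := GRing.isLinear.Build rat {mpoly rat[n]} rat _ gauss gauss_is_linear.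

Lemma gauss1 : gauss 1 = 1.
Proof. by rewrite /gauss msize1 /gauss_upto big_ord1 /= mcoeff1 eqxx invr1 mulr1. Qed.

(** Gaussian integration by parts: at the origin every term keeping the factor X_a vanishes, and
    only the commutator of [iter_lap_mulX] survives. *)
Lemma gaussX a p : gauss ('X_a * p) = gauss (p^`M(iota a)).
Proof.
set q := p^`M(iota a); set K := maxn (msize ('X_a * p)) (msize q).
rewrite -(@gauss_uptoE K.+1 ('X_a * p)); last by rewrite leqW // leq_maxl.
rewrite -(@gauss_uptoE K q); last by rewrite leq_maxr.
have X0 r : ('X_a * r)@_0 = 0 :> rat.
  by rewrite rmorphM /= mcoeffX mnm1_eq0 mul0r.
rewrite /gauss_upto big_ord_recl X0 mulr0 add0r; apply: eq_bigr => k _.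
rewrite lift0 iter_lap_mulX mcoeffD X0 add0r mcoeffZ factS natrM.
by rewrite invfM mulrACA mulVf ?mul1r // pnatr_eq0.
Qed.

End Gauss.

(** * Perfect matchings compatible with a relation *)

Section Pairings.
Variable T : finType.
Implicit Types (r : rel T) (A B : {set T}) (M : {set {set T}}).

Definition pair_edge r (e : {set T}) :=
  [exists x, exists y, [&& x != y, r x y & e == [set x; y]]].

Definition pairings r A : {set {set {set T}}} :=
  [set M : {set {set T}} | partition M A && [forall e in M, pair_edge r e]].

Lemma mem_pairings r A M :
  (M \in pairings r A) = partition M A && [forall e in M, pair_edge r e].
Proof. by rewrite inE. Qed.

Lemma pair_edgeP r x y : ssrbool.symmetric r -> x != y -> pair_edge r [set x; y] = r x y.
Proof.
move=> sr nxy; apply/existsP/idP => [[a /existsP[b /and3P[nab rab /eqP e]]]|rxy].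
  have: x \in [set a; b] by rewrite -e !inE eqxx.
  have: y \in [set a; b] by rewrite -e !inE eqxx orbT.
  rewrite !inE => /orP[]/eqP ey /orP[]/eqP ex; subst => //; first by rewrite eqxx in nxy.
    by rewrite sr.
  by rewrite eqxx in nxy.
by exists x; apply/existsP; exists y; rewrite nxy rxy eqxx.
Qed.

Lemma pairings_set0 r : pairings r set0 = [set set0].
Proof.
apply/setP => M; rewrite !inE partition_set0.
case: eqP => [->|//] /=; apply/forall_inP => e; by rewrite inE.
Qed.

Lemma card_pairingsD2 r A x y : ssrbool.symmetric r -> x \in A -> y \in A :\ x -> r x y ->
  #|[set M in pairings r A | [set x; y] \in M]| = #|pairings r (A :\ x :\ y)|.
Proof.
move=> sr xA; rewrite !inE => /andP[nyx yA] rxy.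
have nxy : x != y by rewrite eq_sym.
set e := [set x; y].
have De : A :\: e = A :\ x :\ y.
  by apply/setP => z; rewrite !inE negb_or andbA [(z != y) && _]andbC.
have notin M : partition M (A :\ x :\ y) -> e \notin M.
  move=> pM; apply/negP => /(partitionS pM) /subsetP /(_ x).
  by rewrite !inE eqxx /= andbF => /(_ isT).
(* Adding the edge e is a bijection from the pairings of the remaining points. *)
rewrite -(@card_in_imset _ _ (fun M => e |: M) (pairings r (A :\ x :\ y))); last first.
  move=> M1 M2; rewrite !inE => /andP[p1 _] /andP[p2 _] eM.
  by rewrite -(setU1K (notin _ p1)) eM setU1K // notin.
apply: eq_card => M; rewrite !inE; apply/idP/imsetP => [|[M']].
  case/andP=> /andP[pM /forall_inP hM] eM; exists (M :\ e); last by rewrite setD1K.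
  rewrite inE -De partitionD1 //=; apply/forall_inP => f; rewrite inE => /andP[_].
  exact: hM.
rewrite inE => /andP[pM /forall_inP hM] ->; rewrite setU11 andbT.
have Ae : e :|: A :\ x :\ y = A.
  apply/setP => z; rewrite !inE.
  by case: eqP => [->|] //; case: eqP => [->|].
rewrite -{1}Ae partitionU1 //=; last first.
- rewrite disjoints_subset; apply/subsetP => z; rewrite !inE.
  by case/orP => /eqP ->; rewrite eqxx ?andbF.
- by apply/set0Pn; exists x; rewrite !inE eqxx.
apply/forall_inP => f; rewrite in_setU1 => /orP[/eqP->|]; last exact: hM.
by rewrite pair_edgeP.
Qed.

Lemma pairings_rec r A x : ssrbool.symmetric r -> x \in A ->
  #|pairings r A| = (\sum_(y in A :\ x | r x y) #|pairings r (A :\ x :\ y)|)%N.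
Proof.
move=> sr xA.
under eq_bigr => y /andP[yA rxy] do
  rewrite -card_pairingsD2 // -sum1_card big_mkcond.
rewrite exchange_big /= -sum1_card big_mkcond /=; apply: eq_bigr => M _.
case: ifPn => [MA|MA]; last first.
  by rewrite big1 // => y _; rewrite inE (negbTE MA).
move: (MA); rewrite inE => /andP[pM /forall_inP hM].
have xc : x \in cover M by rewrite (cover_partition pM).
have := hM _ (pblock_mem xc) => /existsP[a /existsP[b /and3P[nab rab /eqP eb]]].
have : exists y, [/\ x != y, r x y & pblock M x = [set x; y]].
  have : x \in pblock M x by rewrite mem_pblock.
  rewrite eb !inE => /orP[]/eqP->; first by exists b.
  by exists a; rewrite eq_sym sr nab rab setUC.
case=> y [nxy rxy ey].
have yM : [set x; y] \in M by rewrite -ey pblock_mem.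
have yA : y \in A by have /subsetP/(_ y) := partitionS pM yM; rewrite !inE eqxx orbT; apply.
rewrite (bigD1 y) /=; last by rewrite !inE eq_sym nxy yA.
rewrite inE MA yM big1 // => z /andP[/andP[]]; rewrite !inE => /andP[nzx _] _ nzy.
case: ifP => // /andP[_ zM]; case/negP: nzy.
have := def_pblock (partition_trivIset pM) zM (setU11 _ _); rewrite ey => e.
have : z \in [set x; y] by rewrite e !inE eqxx orbT.
by rewrite !inE (negbTE nzx).
Qed.

Lemma pairings_disjointU r A B : ssrbool.symmetric r -> [disjoint A & B] ->
  (forall x y, x \in A -> y \in B -> ~~ r x y) ->
  #|pairings r (A :|: B)| = (#|pairings r A| * #|pairings r B|)%N.
Proof.
move=> sr; elim: {A}#|A| {-2}A (leqnn #|A|) => [|n IH] A.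
  rewrite leqn0 cards_eq0 => /eqP -> _ _.
  by rewrite set0U pairings_set0 cards1 mul1n.
move=> cA dAB nr; have [->|/set0Pn[x xA]] := eqVneq A set0.
  by rewrite set0U pairings_set0 cards1 mul1n.
have xB : x \notin B by rewrite (disjointFr dAB).
rewrite (pairings_rec sr xA) (pairings_rec (x := x) sr) ?inE ?xA //.
rewrite big_distrl /= [LHS](bigID (mem A)) /= [X in (_ + X)%N]big1 ?addn0; last first.
  move=> y /andP[/andP[]]; rewrite !inE => /andP[_] /orP[->//|yB] rxy.
  by have := nr _ _ xA yB; rewrite rxy.
apply: eq_big => [y|y].
  by rewrite !inE; case: (y \in A); rewrite ?andbT ?andbF ?orbT.
case/andP=> _ yA.
have yB : y \notin B by rewrite (disjointFr dAB).
have -> : (A :|: B) :\ x :\ y = (A :\ x :\ y) :|: B.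
  apply/setP => z; rewrite !inE; case: (z =P y) => [->|_] /=; first by rewrite (negbTE yB).
  by case: (z =P x) => [->|_] /=; first by rewrite (negbTE xB).
have sA : A :\ x :\ y \subset A by apply/subsetP => z; rewrite !inE => /and3P[].
apply: IH.
- rewrite -ltnS (leq_trans _ cA) // (leq_trans _ (proper_card (properD1 xA))) // ltnS.
  by rewrite subset_leq_card // subD1set.
- by rewrite (disjointWl sA).
- by move=> a b /(subsetP sA); apply: nr.
Qed.

End Pairings.

(** Integration by parts in the variable of x differentiates the other factors in turn; the factor y
    that is hit is the partner of x. This is the recursion [pairings_rec]. *)
Lemma wick n (iota : 'I_n -> 'I_n) (iotaK : involutive iota) (T : finType)
    (f : T -> 'I_n) (A : {set T}) :
  gauss iota (\prod_(h in A) 'X_(f h)) =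
  #|pairings (fun x y => f y == iota (f x)) A|%:R.
Proof.
have sr : ssrbool.symmetric (fun x y => f y == iota (f x)).
  by move=> x y /=; rewrite eq_sym (can2_eq iotaK iotaK).
elim: {A}#|A| {-2}A (leqnn #|A|) => [|m IH] A.
  rewrite leqn0 cards_eq0 => /eqP ->.
  by rewrite big_set0 gauss1 pairings_set0 cards1.
move=> cA; have [->|/set0Pn[x xA]] := eqVneq A set0.
  by rewrite big_set0 gauss1 pairings_set0 cards1.
rewrite (big_setD1 x) //= gaussX // (pairings_rec sr xA) natr_sum.
have cAx : (#|A :\ x| <= m)%N by rewrite -ltnS (leq_trans _ cA) // proper_card // properD1.
have dprod (s : seq T) (i : 'I_n) : uniq s ->
    (\prod_(h <- s) ('X_(f h) : {mpoly rat[n]}))^`M(i) =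
    \sum_(y <- s | f y == i) \prod_(h <- s | h != y) 'X_(f h).
  elim: s => [|a s IHs] /=; first by rewrite !big_nil -mpolyC1 mderivC.
  case/andP=> na us; rewrite big_cons mderivM {}IHs // big_cons.
  rewrite mderivU.
  have neqa y : y \in s -> (a != y) by move=> ys; apply: contraNneq na => ->.
  have E : 'X_(f a) * \sum_(y <- s | f y == i) \prod_(h <- s | h != y) 'X_(f h) =
     \sum_(y <- s | f y == i) \prod_(h <- a :: s | h != y) 'X_(f h) :> {mpoly rat[n]}.
    rewrite mulr_sumr [LHS]big_seq_cond [RHS]big_seq_cond; apply: eq_bigr => y /andP[ys _].
    by rewrite big_cons neqa.
  rewrite E; case: ifP => _; last by rewrite mul0r add0r.
  rewrite mul1r big_cons eqxx; congr (_ + _); rewrite [LHS]big_seq_cond [RHS]big_seq_cond.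
  by apply: eq_bigl => y; case ys: (y \in s); rewrite //= eq_sym neqa.
have -> : \prod_(h in A :\ x) 'X_(f h) = \prod_(h <- enum (A :\ x)) ('X_(f h) : {mpoly rat[n]}).
  by rewrite big_enum.
rewrite dprod ?enum_uniq // big_enum_cond raddf_sum /=; apply: eq_bigr => y /andP[yA _].
rewrite big_enum_cond /= -IH; last first.
  by rewrite (leq_trans _ cAx) // subset_leq_card // subD1set.
congr gauss; apply: eq_bigl => z; rewrite !inE andbC.
by case: (z == y); rewrite ?andbF.
Qed.

(** * Loop equations for the matrix and the eigenvalue models *)

Definition rem_nth (T : Type) i (s : seq T) := take i s ++ drop i.+1 s.

(** Right side of the loop (Schwinger-Dyson) equation for a first trace of degree k+1: the first sum
    splits that trace in two, the second merges it with another trace. *)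
Definition loop_rhs (Phi : seq nat -> rat) k (ds : seq nat) : rat :=
  \sum_(a < k) Phi [:: val a, (k.-1 - a)%N & ds] +
  \sum_(i < size ds) (nth 0%N ds i)%:R * Phi ((k + nth 0%N ds i).-1 :: rem_nth i ds).

(** Splitting and merging both lower the total degree by 2 while adding at most one trace, so the
    equations determine all moments from the empty one. *)
Lemma loop_unique (Phi Psi : seq nat -> rat) (N c : rat) :
  (forall ds, Phi (0%N :: ds) = N * Phi ds) ->
  (forall ds, Psi (0%N :: ds) = N * Psi ds) ->
  (forall k ds, Phi (k.+1 :: ds) = loop_rhs Phi k ds) ->
  (forall k ds, Psi (k.+1 :: ds) = loop_rhs Psi k ds) ->
  Psi [::] = c * Phi [::] -> forall ds, Psi ds = c * Phi ds.
Proof.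
move=> F0 P0 FS PS Pn ds.
have [m] := ubnP (2 * sumn ds + size ds)%N.
elim: m ds => // m IH [|[|k] ds] //.
  by move=> h; rewrite P0 F0 IH 1?mulrCA //; move: h => /=; lia.
move=> h; rewrite FS PS /loop_rhs mulrDr !mulr_sumr; congr (_ + _).
  by apply: eq_bigr => a _; rewrite IH //; move: (ltn_ord a) h => /=; lia.
apply: eq_bigr => i _; have [->|nz] := eqVneq (nth 0%N ds i) 0%N.
  by rewrite !mul0r mulr0.
rewrite mulrCA IH //; move: h => /=.
have e := cat_take_drop i ds; rewrite (drop_nth 0%N (ltn_ord i)) in e.
have := congr1 sumn e; have := congr1 size e.
by rewrite /rem_nth !sumn_cat !size_cat /=; move: nz; lia.
Qed.

Section Derivation.
Variables (R : comNzRingType) (D : R -> R).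
Hypotheses (D1 : D 1 = 0) (DM : forall x y, D (x * y) = D x * y + x * D y).

Lemma deriv_prod_rem_nth (t : nat -> R) ds :
  D (\prod_(d <- ds) t d) =
  \sum_(i < size ds) D (t (nth 0%N ds i)) * \prod_(d <- rem_nth i ds) t d.
Proof.
elim: ds => [|d ds IH]; first by rewrite big_nil big_ord0.
rewrite big_cons DM {}IH big_ord_recl /= /rem_nth /= drop0; congr (_ + _).
rewrite mulr_sumr; apply: eq_bigr => i _.
by rewrite big_cons mulrCA.
Qed.

Lemma deriv_prod_log (I : Type) (r : seq I) (P : pred I) (f g : I -> R) :
  (forall i, P i -> D (f i) = f i * g i) ->
  D (\prod_(i <- r | P i) f i) = \prod_(i <- r | P i) f i * \sum_(i <- r | P i) g i.
Proof.
move=> h; elim: r => [|a r IH]; first by rewrite !big_nil D1 mul1r.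
rewrite !big_cons; case: ifP => // Pa.
by rewrite DM h // IH; ring.
Qed.

Lemma leibnizX x k : D (x ^+ k) = D x * x ^+ k.-1 *+ k.
Proof.
elim: k => [|k IH]; first by rewrite expr0 D1 mulr0n.
rewrite exprS DM IH; case: k {IH} => [|k]; first by rewrite mulr0n mulr0 addr0 mulr1n.
by rewrite [RHS]mulrS mulrnAr mulrCA -exprS.
Qed.
End Derivation.

(** * The Gaussian Hermitian matrix model *)

Section MatrixModel.
Variable n : nat.
Notation N := n.+1.
Notation P := {mpoly rat[(N * N)%N]}.

Definition Xmx : 'M[P]_N := \matrix_(i, j) 'X_(mxvec_index i j).

(** As the involution of [gauss], it makes E[X_ij X_ji] = 1 the only nonzero covariances. This
    encodes a Hermitian matrix with independent formal entries, without complex numbers. *)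
Definition transp (k : 'I_(N * N)) : 'I_(N * N) :=
  let ij := enum_val (cast_ord (esym (mxvec_cast N N)) k) in mxvec_index ij.2 ij.1.

Lemma mxvec_index_inj i j i' j' :
  (mxvec_index i j == mxvec_index i' j' :> 'I_(N * N)) = (i == i') && (j == j').
Proof.
by rewrite (inj_eq (@cast_ord_inj _ _ _)) (inj_eq enum_rank_inj) -pair_eqE.
Qed.

Lemma transpE i j : transp (mxvec_index i j) = mxvec_index j i.
Proof. by rewrite /transp cast_ordK enum_rankK. Qed.

Lemma transpK : involutive transp.
Proof. by move=> k; case/mxvec_indexP: k => i j; rewrite !transpE. Qed.

Lemma mderiv_Xmx j i p q : (Xmx p q)^`M(mxvec_index j i) = ((p == j) && (q == i))%:R.
Proof. by rewrite mxE mderivU mxvec_index_inj. Qed.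

Lemma mderiv_Xmx_exp j i k p q :
  ((Xmx ^+ k) p q)^`M(mxvec_index j i) =
  \sum_(a < k) (Xmx ^+ a) p j * (Xmx ^+ (k.-1 - a)) i q.
Proof.
elim: k p q => [|k IH] p q.
  by rewrite big_ord0 expr0 mxE -mpolyC_nat mderivC.
rewrite exprS mxE raddf_sum [RHS]big_ord_recl /= expr0 subn0.
under eq_bigr => r _ do rewrite mderivM mderiv_Xmx IH.
rewrite big_split /=; congr (_ + _).
  rewrite (bigD1 i) //= eqxx andbT big1 ?addr0; last first.
    by move=> r /negbTE ->; rewrite andbF mul0r.
  by rewrite mxE.
under eq_bigr => r _ do rewrite mulr_sumr.
rewrite exchange_big /=; apply: eq_bigr => a _.
under eq_bigr => r _ do rewrite mulrA.
rewrite -mulr_suml; congr (_ * _); last first.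
  by congr ((Xmx ^+ _) _ _); rewrite /bump /=; lia.
by rewrite /bump /= add1n exprS mxE.
Qed.

Lemma mderiv_trXmx_exp j i d :
  (\tr (Xmx ^+ d))^`M(mxvec_index j i) = (Xmx ^+ d.-1) i j *+ d.
Proof.
rewrite /mxtrace raddf_sum /=.
under eq_bigr => p _ do rewrite mderiv_Xmx_exp.
rewrite exchange_big /=.
transitivity (\sum_(a < d) (Xmx ^+ d.-1) i j); last by rewrite sumr_const card_ord.
apply: eq_bigr => a _.
under eq_bigr => p _ do rewrite mulrC.
have /subnK e : (a <= d.-1)%N by case: d a => [[]|d []].
by rewrite -[in RHS]e exprD mxE.
Qed.

Definition gue_moment ds : rat := gauss transp (\prod_(d <- ds) \tr (Xmx ^+ d)).

Lemma gue_moment0 ds : gue_moment (0%N :: ds) = N%:R * gue_moment ds.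
Proof.
rewrite /gue_moment big_cons expr0 mxtrace1 -[N%:R]mpolyC_nat mul_mpolyC.
by rewrite linearZ.
Qed.

Lemma gue_loop k ds : gue_moment (k.+1 :: ds) = loop_rhs gue_moment k ds.
Proof.
rewrite /gue_moment big_cons; set g := \prod_(d <- ds) _.
have -> : \tr (Xmx ^+ k.+1) * g = \sum_i \sum_j 'X_(mxvec_index i j) * ((Xmx ^+ k) j i * g).
  rewrite /mxtrace mulr_suml; apply: eq_bigr => i _; rewrite exprS mxE mulr_suml.
  by apply: eq_bigr => j _; rewrite mxE mulrA.
transitivity (gauss transp (\sum_i \sum_j ((Xmx ^+ k) j i * g)^`M(mxvec_index j i))).
  rewrite !raddf_sum /=; apply: eq_bigr => i _; rewrite !raddf_sum /=; apply: eq_bigr => j _.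
  by rewrite gaussX ?transpE //; exact: transpK.
under eq_bigr => i _ do under eq_bigr => j _ do rewrite mderivM mderiv_Xmx_exp.
under eq_bigr => i _ do rewrite big_split /=.
(* A derivative falling on the power from the same trace splits that trace; falling on g, it merges
   the trace with another one. *)
rewrite big_split /= raddfD /=; congr (_ + _).
  under eq_bigr => i _ do under eq_bigr => j _ do rewrite mulr_suml.
  under eq_bigr => i _ do rewrite exchange_big /=.
  rewrite exchange_big raddf_sum /=; apply: eq_bigr => a _; congr gauss.
  rewrite !big_cons mulrA; under eq_bigr => i _ do rewrite -mulr_suml.
  rewrite -mulr_suml; congr (_ * _); rewrite mulrC /mxtrace mulr_suml.
  by under eq_bigr => i _ do rewrite -mulr_suml mulrC.
have dg i j : g^`M(mxvec_index j i) = \sum_(l < size ds)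
   ((Xmx ^+ (nth 0%N ds l).-1) i j *+ nth 0%N ds l) * \prod_(d <- rem_nth l ds) \tr (Xmx ^+ d).
  rewrite /g (@deriv_prod_rem_nth _ (mderiv (mxvec_index j i)) _ _ (fun d => \tr (Xmx ^+ d))).
  - by apply: eq_bigr => l _; rewrite mderiv_trXmx_exp.
  - by rewrite -mpolyC1 mderivC.
  - exact: mderivM.
under eq_bigr => i _ do under eq_bigr => j _ do rewrite dg mulr_sumr.
under eq_bigr => i _ do rewrite exchange_big /=.
rewrite exchange_big raddf_sum /=; apply: eq_bigr => l _.
set d := nth _ _ _; rewrite big_cons mulr_natl -raddfMn /=; congr gauss.
have [->|nz] := eqVneq d 0%N.
  rewrite mulr0n big1 // => i _; rewrite big1 // => j _.
  by rewrite mulr0n mul0r mulr0.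
have -> : (k + d).-1 = (d.-1 + k)%N by lia.
rewrite exprD /mxtrace mulr_suml -sumrMnl; apply: eq_bigr => i _.
rewrite mxE mulr_suml -sumrMnl; apply: eq_bigr => j _.
by rewrite mulrA mulrnAr mulrnAl [_ * (Xmx ^+ d.-1) i j]mulrC.
Qed.
End MatrixModel.

(** * The eigenvalue model with squared Vandermonde weight *)

Section EigenvalueModel.
Variable N : nat.
Notation P := {mpoly rat[N]}.

Definition psum k : P := \sum_(i < N) 'X_i ^+ k.
Definition vandermonde : P := \prod_(i < N) \prod_(j < N | (i < j)%N) ('X_j - 'X_i).
Definition coulomb_moment ds : rat := gauss id (vandermonde ^+ 2 * \prod_(d <- ds) psum d).

(** The vector field x^k d/dx acting on all variables at once, a generator of the Witt algebra; the
    loop equations are its Ward identities. *)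
Definition witt k (p : P) : P := \sum_(i < N) 'X_i ^+ k * p^`M(i).

Lemma wittM k p q : witt k (p * q) = witt k p * q + p * witt k q.
Proof.
rewrite /witt mulr_suml mulr_sumr -big_split /=; apply: eq_bigr => i _.
by rewrite mderivM; ring.
Qed.

Lemma witt1 k : witt k 1 = 0.
Proof. by rewrite /witt big1 // => i _; rewrite -mpolyC1 mderivC mulr0. Qed.

Lemma wittB k p q : witt k (p - q) = witt k p - witt k q.
Proof.
rewrite /witt -sumrB; apply: eq_bigr => i _.
by rewrite mderivB mulrBr.
Qed.

Lemma wittX k i : witt k 'X_i = 'X_i ^+ k.
Proof.
rewrite /witt (bigD1 i) //= mderivU eqxx mulr1 big1 ?addr0 // => j.
by rewrite mderivU eq_sym => /negbTE ->; rewrite mulr0.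
Qed.

Lemma witt_psum k d : witt k (psum d) = psum (k + d).-1 *+ d.
Proof.
have ->: witt k (psum d) = \sum_(i < N) witt k ('X_i ^+ d).
  rewrite /witt exchange_big /=; apply: eq_bigr => i _.
  by rewrite /psum (raddf_sum (mderiv i)) mulr_sumr.
rewrite /psum -sumrMnl; apply: eq_bigr => i _.
rewrite (leibnizX (witt1 k) (wittM k)) wittX -exprD.
by case: d => [|d]; rewrite ?mulr0n // addnS.
Qed.

Lemma witt_vandermonde k :
  witt k vandermonde = vandermonde *
    \sum_(i < N) \sum_(j < N | (i < j)%N) \sum_(a < k) 'X_i ^+ a * 'X_j ^+ (k.-1 - a).
Proof.
apply: (deriv_prod_log (witt1 k) (wittM k)) => i _.
apply: (deriv_prod_log (witt1 k) (wittM k)) => j _.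
rewrite wittB !wittX subrXX; congr (_ * _); apply: eq_bigr => a _.
by rewrite mulrC.
Qed.

(** In the double sum over i and j on the right, each factor [vandermonde] yields the terms with i <
    j, once as they stand and once with i and j exchanged. The diagonal terms come from the
    divergence k x_i^(k-1) of the vector field. *)
Lemma witt_vandermonde2 k :
  psum k.-1 *+ k * vandermonde ^+ 2 + witt k (vandermonde ^+ 2) =
  vandermonde ^+ 2 * \sum_(a < k) psum a * psum (k.-1 - a).
Proof.
rewrite expr2 wittM witt_vandermonde -expr2.
set S := \sum_(i < N) _.
have -> : \sum_(a < k) psum a * psum (k.-1 - a) = psum k.-1 *+ k + S + S; last by ring.
have e : \sum_(a < k) psum a * psum (k.-1 - a) =
  \sum_(i < N) \sum_(j < N) \sum_(a < k) 'X_i ^+ a * 'X_j ^+ (k.-1 - a).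
  under eq_bigr => a _ do rewrite /psum mulr_suml.
  rewrite exchange_big /=; apply: eq_bigr => i _.
  by under eq_bigr => a _ do rewrite mulr_sumr; rewrite exchange_big.
have rev i j : \sum_(a < k) 'X_i ^+ a * 'X_j ^+ (k.-1 - a) =
   \sum_(a < k) 'X_j ^+ a * 'X_i ^+ (k.-1 - a) :> P.
  rewrite (reindex_inj rev_ord_inj) /=; apply: eq_bigr => a _.
  have ha := ltn_ord a; rewrite mulrC.
  by congr ('X_j ^+ _ * 'X_i ^+ _); lia.
rewrite e.
have split3 (f : 'I_N -> 'I_N -> P) : \sum_i \sum_j f i j =
   \sum_i f i i + \sum_(i < N) \sum_(j < N | (i < j)%N) f i j + \sum_(i < N) \sum_(j < N | (i < j)%N) f j i.
  have -> : \sum_(i < N) \sum_(j < N | (i < j)%N) f j i = \sum_(i < N) \sum_(j < N | (j < i)%N) f i j.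
    by rewrite (exchange_big_dep predT).
  rewrite -!big_split /=; apply: eq_bigr => i _.
  rewrite (bigD1 i) //= -addrA; congr (_ + _).
  rewrite (bigID (fun j : 'I_N => (i < j)%N)) /=; congr (_ + _); apply: eq_bigl => j.
    by rewrite -val_eqE /=; lia.
  by rewrite -val_eqE /=; lia.
rewrite split3; congr (_ + _ + _); last first.
  by apply: eq_bigr => i _; apply: eq_bigr => j _; rewrite rev.
rewrite /psum -sumrMnl; apply: eq_bigr => i _.
transitivity (\sum_(a < k) ('X_i ^+ k.-1 : P)); last by rewrite sumr_const card_ord.
apply: eq_bigr => a _; rewrite -exprD; congr (_ ^+ _); have := ltn_ord a; lia.
Qed.

Lemma coulomb_moment0 ds : coulomb_moment (0%N :: ds) = N%:R * coulomb_moment ds.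
Proof.
rewrite /coulomb_moment big_cons.
have -> : psum 0 = N%:R%:MP.
  transitivity (\sum_(i < N) (1 : P)); last by rewrite sumr_const card_ord mpolyC_nat.
  by apply: eq_bigr => i _; rewrite expr0.
rewrite mul_mpolyC -scalerAr.
by rewrite linearZ.
Qed.

Lemma coulomb_loop k ds : coulomb_moment (k.+1 :: ds) = loop_rhs coulomb_moment k ds.
Proof.
rewrite /coulomb_moment big_cons; set g := \prod_(d <- ds) _.
set V2 := vandermonde ^+ 2.
have -> : V2 * (psum k.+1 * g) = \sum_i 'X_i * ('X_i ^+ k * (V2 * g)).
  rewrite mulrCA /psum mulr_suml; apply: eq_bigr => i _.
  by rewrite exprS -mulrA.
rewrite raddf_sum /=.
have idK : involutive (@id 'I_N) by [].
under eq_bigr => i _ do rewrite (gaussX idK).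
rewrite -(raddf_sum (gauss id)) /=.
have -> : \sum_(i < N) ('X_i ^+ k * (V2 * g))^`M(i) =
   (psum k.-1 *+ k * V2 + witt k V2) * g + V2 * witt k g.
  have -> : \sum_(i < N) ('X_i ^+ k * (V2 * g))^`M(i) = psum k.-1 *+ k * (V2 * g) + witt k (V2 * g).
    rewrite /psum /witt -sumrMnl mulr_suml -big_split /=; apply: eq_bigr => i _.
    rewrite mderivM (@leibnizX _ (mderiv i)) ?mderivU ?eqxx ?mul1r //.
    - by rewrite -mpolyC1 mderivC.
    - exact: mderivM.
  by rewrite wittM; ring.
rewrite witt_vandermonde2 raddfD /=; congr (_ + _).
  rewrite mulr_sumr mulr_suml raddf_sum /=; apply: eq_bigr => a _; congr gauss.
  by rewrite !big_cons !mulrA.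
rewrite /g (deriv_prod_rem_nth (witt1 k) (wittM k)) mulr_sumr raddf_sum /=.
apply: eq_bigr => l _; rewrite witt_psum big_cons mulr_natl -raddfMn /=; congr gauss.
by rewrite mulrnAl mulrnAr.
Qed.
End EigenvalueModel.

(** Both models solve the same loop equations, so they differ only by the normalisation of the
    eigenvalue weight. *)
Lemma gue_coulomb n ds :
  coulomb_moment n.+1 ds = coulomb_moment n.+1 [::] * gue_moment n ds.
Proof.
apply: (@loop_unique _ _ n.+1%:R).
- exact: gue_moment0.
- exact: coulomb_moment0.
- exact: gue_loop.
- exact: coulomb_loop.
- by rewrite /gue_moment big_nil gauss1 mulr1.
Qed.

(** * Partition function and Hankel determinants *)

Fixpoint gauss_mom (k : nat) : rat :=
  match k with 0%N => 1 | 1%N => 0 | k'.+2 => k'.+1%:R * gauss_mom k' end.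

Lemma gauss_momS k : gauss_mom k.+1 = k%:R * gauss_mom k.-1.
Proof. by case: k => [|k] //=; rewrite mul0r. Qed.

Lemma gauss_mom_odd k : odd k -> gauss_mom k = 0.
Proof.
have [m] := ubnP k; elim: m k => // m IH [|[|k]] //= km; rewrite negbK => ok.
by rewrite IH ?mulr0 //; lia.
Qed.

Section Andreief.
Variable N : nat.
Notation P := {mpoly rat[N]}.

(** Independence of the variables, by integrating by parts in one variable with positive
    exponent. *)
Lemma gauss_prodX (k : 'I_N -> nat) :
  gauss id (\prod_(i < N) ('X_i ^+ k i : P)) = \prod_(i < N) gauss_mom (k i).
Proof.
have [m] := ubnP (\sum_(i < N) k i)%N; elim: m k => // m IH k hm.
have [/existsP[a ka]|/existsPn k0] := boolP [exists a, (0 < k a)%N]; last first.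
  rewrite !big1 ?gauss1 // => i _; have := k0 i; case: (k i) => // _; by rewrite ?expr0.
pose D := mderiv a : P -> P.
have D1 : D 1 = 0 by rewrite /D -mpolyC1 mderivC.
have DM x y : D (x * y) = D x * y + x * D y by exact: mderivM.
have DX i j : i != a -> D ('X_i ^+ j) = 0.
  by move=> /negbTE ia; rewrite (leibnizX D1 DM) /D mderivU ia mul0r mul0rn.
have D0 (kk : 'I_N -> nat) : D (\prod_(i < N | i != a) 'X_i ^+ kk i) = 0.
  rewrite (@deriv_prod_log _ D D1 DM _ _ _ _ (fun=> 0)) ?[X in _ * X]big1 ?mulr0 // => i ia.
  by rewrite DX // mulr0.
case E : (k a) ka => [//|c] _.
rewrite (bigD1 a) //= E exprS -mulrA gaussX // -[_^`M(_)]/(D _) DM D0 mulr0 addr0.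
rewrite (leibnizX D1 DM) /D mderivU eqxx mul1r mulrnAl raddfMn /=.
rewrite [RHS](bigD1 a) //= E gauss_momS.
case: c E => [|c] E; first by rewrite !mul0r mulr0n.
pose k' i := if i == a then c else k i.
have kk' i : i != a -> k' i = k i by rewrite /k' => /negbTE ->.
have -> : gauss id ('X_a ^+ c * \prod_(i < N | i != a) 'X_i ^+ k i) =
    gauss_mom c * \prod_(i < N | i != a) gauss_mom (k i).
  transitivity (gauss id (\prod_(i < N) ('X_i ^+ k' i : P))).
    congr gauss; rewrite [RHS](bigD1 a) //= {1}/k' eqxx; congr (_ * _).
    by apply: eq_bigr => i /kk' ->.
  rewrite IH; last first.
    move: hm; rewrite ltnS; apply: leq_trans.
    rewrite (bigD1 a) //= [X in (_ < X)%N](bigD1 a) //= {1}/k' eqxx E.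
    by rewrite (eq_bigr k) ?addSn 1?ltnS ?leqnSn // => i; exact: kk'.
  rewrite (bigD1 a) //= {1}/k' eqxx; congr (_ * _).
  by apply: eq_bigr => i /kk' ->.
by rewrite -mulrnAl mulr_natl.
Qed.

Variable d : nat.

Definition exp_trunc T (R : comAlgType rat) (x : R) : {poly R} := \poly_(b < T) (b`!%:R^-1 *: x ^+ b).

(** Below the cut-off, a product of exponentials is the exponential of the sum; beyond it the
    coefficients are different, whence the hypothesis on b. *)
Lemma coef_prod_exp_trunc T (R : comAlgType rat) I (r : seq I) (x : I -> R) b : (b < T)%N ->
  (\prod_(i <- r) exp_trunc T (x i))`_b = b`!%:R^-1 *: (\sum_(i <- r) x i) ^+ b.
Proof.
elim: r b => [|i r IH] b bT.
  rewrite !big_nil coef1; case: b bT => [|b] _; first by rewrite expr0 invr1 scale1r.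
  by rewrite expr0n scaler0.
rewrite !big_cons coefM addrC exprDn scaler_sumr; apply: eq_bigr => -[s /=]; rewrite ltnS => sb _.
rewrite coef_poly (leq_ltn_trans sb bT) IH ?(leq_ltn_trans (leq_subr _ _)) //.
rewrite -scalerAl -scalerAr scalerA mulrC -scaler_nat scalerA; congr (_ *: _); last by rewrite mulrC.
rewrite -(bin_fact sb) 2!natrM !invfM; field.
by rewrite !pnatr_eq0 -!lt0n !fact_gt0 bin_gt0 sb.
Qed.

(** The k-th moment of the Gaussian weight times exp(t x^d), to order t^3; each power of t stands
    for one vertex. *)
Definition umoment k : {poly rat} := \poly_(b < 4) (b`!%:R^-1 * gauss_mom (k + d * b)).

Definition partition_poly : {poly rat} :=
  map_poly (gauss id) ((vandermonde N ^+ 2)%:P * \prod_(i < N) exp_trunc 4 ('X_i ^+ d)).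

Lemma coef_partition_poly b : (b < 4)%N ->
  partition_poly`_b = b`!%:R^-1 * coulomb_moment N (nseq b d).
Proof.
move=> b4; rewrite coef_map_id0 ?raddf0 // coefCM coef_prod_exp_trunc //.
rewrite -scalerAr linearZ /=; congr (_ * gauss _ (_ * _)).
by rewrite big_nseq iter_mulr_1.
Qed.

Lemma gauss_prod_exp_trunc (k : 'I_N -> nat) :
  map_poly (gauss id) ((\prod_(i < N) 'X_i ^+ k i)%:P * \prod_(i < N) exp_trunc 4 ('X_i ^+ d)) =
  \prod_(i < N) umoment (k i).
Proof.
have -> : (\prod_(i < N) 'X_i ^+ k i : P)%:P * \prod_(i < N) exp_trunc 4 ('X_i ^+ d) =
   \prod_(i < N) \sum_(b < 4) (b`!%:R^-1 *: 'X_i ^+ (k i + d * b) : P)%:P * 'X^b.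
  rewrite rmorph_prod -big_split; apply: eq_bigr => i _ /=.
  rewrite /exp_trunc poly_def mulr_sumr; apply: eq_bigr => b _.
  by rewrite -mul_polyC mulrA -polyCM -exprM -scalerAr -exprD.
have -> : \prod_(i < N) umoment (k i) =
   \prod_(i < N) \sum_(b < 4) (b`!%:R^-1 * gauss_mom (k i + d * b))%:P * 'X^b.
  apply: eq_bigr => i _; rewrite /umoment poly_def; apply: eq_bigr => b _.
  by rewrite mul_polyC.
rewrite !bigA_distr_bigA raddf_sum /=; apply: eq_bigr => f _.
rewrite !big_split /= -!rmorph_prod /= -!expr_sum.
set s := (\sum_(i < N) _)%N.
have -> (p : P) : map_poly (gauss id) (p%:P * 'X^s) = (gauss id p)%:P * 'X^s.
  apply/polyP => l; rewrite coef_map_id0 ?raddf0 // !coefMXn; case: ifP; rewrite ?raddf0 // => _.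
  by rewrite !coefC; case: ifP; rewrite ?raddf0.
rewrite scaler_prod linearZ /= gauss_prodX [X in _ = X%:P * _]big_split.
by [].
Qed.

(** Andreief's identity: both Vandermonde determinants are expanded over permutations, and each
    permutation s of the first leaves a row permutation of the Hankel determinant. Its sign is
    cancelled by that of s, so N! equal terms remain. *)
Lemma partition_poly_hankel :
  partition_poly = N`!%:R * \det (\matrix_(i < N, j < N) umoment (i + j)).
Proof.
have vE : vandermonde N = \sum_(s : 'S_N) (-1) ^+ s * \prod_(i < N) 'X_i ^+ s i.
  transitivity (\det (Vandermonde N (\row_(i < N) ('X_i : P)))).
    rewrite det_Vandermonde; apply: eq_bigr => i _; apply: eq_bigr => j _.
    by rewrite !mxE.
  rewrite -det_tr; apply: eq_bigr => s _; congr (_ * _); apply: eq_bigr => i _.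
  by rewrite !mxE.
have e : (vandermonde N ^+ 2)%:P * \prod_(i < N) exp_trunc 4 ('X_i ^+ d) =
  \sum_(s : 'S_N) \sum_(t : 'S_N) ((-1) ^+ s * (-1) ^+ t) *:
   ((\prod_(i < N) 'X_i ^+ (s i + t i) : P)%:P * \prod_(i < N) exp_trunc 4 ('X_i ^+ d)) :> {poly P}.
  rewrite expr2 {1}vE mulr_suml rmorph_sum mulr_suml; apply: eq_bigr => s _.
  rewrite vE mulr_sumr rmorph_sum mulr_suml; apply: eq_bigr => t _.
  rewrite -mul_polyC [RHS]mulrA -polyCM; congr (_%:P * _).
  rewrite mulrACA -big_split; congr (_ * _); apply: eq_bigr => i _.
  by rewrite exprD.
rewrite /partition_poly e raddf_sum /=.
have sgnZ (s : bool) (p : {poly P}) : map_poly (gauss id) ((-1) ^+ s *: p) = (-1) ^+ s * map_poly (gauss id) p.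
  by case: s; rewrite ?expr1 ?expr0 ?scale1r ?mul1r // scaleN1r raddfN mulN1r.
transitivity (\sum_(s : 'S_N) \det (\matrix_(i < N, j < N) umoment (i + j))); last first.
  by rewrite sumr_const card_Sn mulr_natl.
apply: eq_bigr => s _; rewrite raddf_sum /=.
under eq_bigr => t _ do rewrite -scalerA !sgnZ gauss_prod_exp_trunc.
rewrite -mulr_sumr.
have -> : \sum_(t : 'S_N) (-1) ^+ t * \prod_(i < N) umoment (s i + t i) =
   \det (row_perm s (\matrix_(i < N, j < N) umoment (i + j))).
  by apply: eq_bigr => t _; congr (_ * _); apply: eq_bigr => i _; rewrite !mxE.
by rewrite row_permE det_mulmx det_perm mulrA -expr2 sqrr_sign mul1r.
Qed.
End Andreief.

(** * Orthogonal polynomials *)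

Section OrthogonalPolynomials.
Variables (K : fieldType) (delta : K -> K) (m : nat -> K).
Hypothesis deltaD : forall x y, delta (x + y) = delta x + delta y.
Hypothesis deltaM : forall x y, delta (x * y) = delta x * y + x * delta y.
Hypothesis m_odd : forall k, odd k -> m k = 0.
Hypothesis m_rec : forall k, m k.+2 = k.+1%:R * m k + delta (m k).
Implicit Types p q : {poly K}.

Lemma delta0 : delta 0 = 0.
Proof. by apply: (addrI (delta 0)); rewrite -deltaD !addr0. Qed.

Lemma delta1 : delta 1 = 0.
Proof. by apply: (addrI (delta 1)); rewrite addr0 -{3}[1]mulr1 deltaM mulr1 mul1r. Qed.

Lemma delta_sum I (r : seq I) (P : pred I) F :
  delta (\sum_(i <- r | P i) F i) = \sum_(i <- r | P i) delta (F i).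
Proof. exact: (big_morph delta deltaD delta0). Qed.

Definition ell p : K := \sum_(i < size p) p`_i * m i.

Lemma ellE n p : (size p <= n)%N -> ell p = \sum_(i < n) p`_i * m i.
Proof.
move=> h; rewrite /ell -(subnKC h) big_split_ord /= [X in _ = _ + X]big1 ?addr0 // => i _.
by rewrite nth_default ?mul0r // leq_addr.
Qed.

Fact ell_is_linear : linear_for *%R ell.
Proof.
move=> a p q; set n := maxn (size p) (maxn (size q) (size (a *: p + q))).
rewrite !(@ellE n) /n ?leq_max ?leqnn ?orbT // mulr_sumr -big_split /=.
by apply: eq_bigr => i _; rewrite coefD coefZ mulrDl mulrA.
Qed.
HB.instance Definition _ := GRing.isLinear.Build K {poly K} K _ ell ell_is_linear.

Lemma ellM a b p q : (size p <= a)%N -> (size q <= b)%N ->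
  ell (p * q) = \sum_(i < a) \sum_(j < b) p`_i * q`_j * m (i + j).
Proof.
move=> ha hb.
have ellX c k : ell (c *: 'X^k) = c * m k.
  rewrite (@ellE k.+1) ?(leq_trans (size_scale_leq _ _)) ?size_polyXn //.
  rewrite big_ord_recr /= coefZ coefXn eqxx mulr1 big1 ?add0r // => i _.
  by rewrite coefZ coefXn ltn_eqF ?mulr0 ?mul0r.
have poly_wide n (r : {poly K}) : (size r <= n)%N -> r = \sum_(i < n) r`_i *: 'X^i.
  move=> h; rewrite -poly_def; apply/polyP => i; rewrite coef_poly.
  by case: ltnP => // ni; rewrite nth_default // (leq_trans h).
rewrite {1}(poly_wide a p) // {1}(poly_wide b q) // mulr_suml raddf_sum /=.
apply: eq_bigr => i _; rewrite mulr_sumr raddf_sum /=; apply: eq_bigr => j _.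
by rewrite -scalerAl -scalerAr scalerA -exprD ellX.
Qed.

(** Monic orthogonal polynomials of degrees n and n+1. As the odd moments vanish, the three-term
    recursion has no diagonal coefficient. *)
Fixpoint op_pair n : {poly K} * {poly K} :=
  if n is n'.+1 then
    let: (p, q) := op_pair n' in (q, 'X * q - (ell (q * q) / ell (p * p)) *: p)
  else (1, 'X).

Definition op n := (op_pair n).1.
Definition op_norm n := ell (op n * op n).
(** The value 0 at n = 0 keeps [op_mulX] true there, where [op n.-1] is a dummy. *)
Definition op_rec n := if n is n'.+1 then op_norm n / op_norm n' else 0.

Lemma op0 : op 0 = 1. Proof. by []. Qed.
Lemma op1 : op 1 = 'X. Proof. by []. Qed.
Lemma opSS n : op n.+2 = 'X * op n.+1 - op_rec n.+1 *: op n.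
Proof.
have e k : (op_pair k).2 = op k.+1 by rewrite /op /=; case: (op_pair k).
by rewrite /op_rec /op_norm -!e /op /=; case: (op_pair n).
Qed.

Lemma op_mulX n : 'X * op n = op n.+1 + op_rec n *: op n.-1.
Proof. by case: n => [|n]; rewrite ?scale0r ?mulr1 ?addr0 // opSS subrK. Qed.

Lemma size_op_monic n : (size (op n) = n.+1) /\ (op n)`_n = 1.
Proof.
have [k] := ubnP n; elim: k n => // k IH [|[|n]] nk.
- by rewrite op0 size_poly1 coef1.
- by rewrite op1 size_polyX coefX.
have [s1 c1] := IH n.+1 nk; have [s0 _] := IH n (ltnW nk).
have nz : op n.+1 != 0 by rewrite -size_poly_eq0 s1.
have sX : size ('X * op n.+1) = n.+3 by rewrite mulrC size_mulX // s1.
have lt : (size (- (op_rec n.+1 *: op n)) < size ('X * op n.+1)%R)%N.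
  by rewrite sX size_polyN (leq_ltn_trans (size_scale_leq _ _)) // s0.
rewrite opSS size_polyDl // sX; split=> //.
by rewrite coefB coefXM /= c1 coefZ [(op n)`__]nth_default ?s0 // mulr0 subr0.
Qed.

Lemma size_op n : size (op n) = n.+1. Proof. by case: (size_op_monic n). Qed.
Lemma coef_op n : (op n)`_n = 1. Proof. by case: (size_op_monic n). Qed.

Definition parity (b : bool) p := forall i, odd i != b -> p`_i = 0.

Lemma parityM a b p q : parity a p -> parity b q -> parity (a (+) b) (p * q).
Proof.
move=> pa qb i hi; rewrite coefM big1 // => -[j /=]; rewrite ltnS => ji _.
have [ja|ja] := eqVneq (odd j) a; last by rewrite pa ?mul0r.
rewrite qb ?mulr0 // oddB // ja; apply: contra hi => /eqP <-.
by rewrite addbCA addbb addbF.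
Qed.

Lemma parityX : parity true 'X.
Proof. by move=> i hi; rewrite coefX; case: (i =P 1%N) hi => [->|]. Qed.

Lemma parity_op n : parity (odd n) (op n).
Proof.
have [k] := ubnP n; elim: k n => // k IH [|[|n]] nk.
- by move=> i hi; rewrite op0 coef1; case: (i =P 0%N) hi => [->|].
- exact: parityX.
move=> i; rewrite /= negbK => hi; rewrite opSS coefB coefZ (IH n (ltnW nk) i hi) mulr0 subr0.
by apply: (parityM parityX (IH n.+1 nk)); rewrite /= negbK.
Qed.

Lemma ell_parity p : parity true p -> ell p = 0.
Proof.
move=> h; rewrite /ell big1 // => i _; have [e|o] := boolP (odd i).
  by rewrite m_odd ?mulr0.
by rewrite h ?mul0r // (negbTE o).
Qed.

(** Against the newest polynomial, the preceding one vanishes by parity, the one before it by the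
    choice of the recursion coefficient, and the earlier ones after X is moved to the other
    factor. *)
Lemma op_ortho n : (forall i, (i < n)%N -> op_norm i != 0) ->
  forall i j, (i < j <= n)%N -> ell (op i * op j) = 0.
Proof.
elim: n => [|n IH] hn i j; first by case: j => [|j]; rewrite ?ltn0 ?andbF.
have {}IH : forall i j, (i < j <= n)%N -> ell (op i * op j) = 0.
  by apply: IH => k kn; apply: hn; rewrite ltnW.
case/andP=> ij; rewrite leq_eqVlt => /orP[/eqP ej|]; last first.
  by rewrite ltnS => jn; apply: IH; rewrite ij.
subst j; case: n IH hn ij => [|n] IH hn.
  rewrite ltnS leqn0 => /eqP ->; rewrite op0 mul1r op1 ell_parity //; exact: parityX.
rewrite ltnS leq_eqVlt => /orP[/eqP ->|].
  rewrite opSS mulrBr raddfB /= -scalerAr linearZ /= [op n.+1 * op n]mulrC IH ?leqnn //.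
  rewrite mulr0 subr0 ell_parity //.
  have -> : true = odd n.+1 (+) (true (+) odd n.+1) by case: (odd n.+1).
  by apply: parityM; [exact: parity_op | apply: parityM; [exact: parityX | exact: parity_op]].
rewrite ltnS leq_eqVlt => ltin.
have e : ell (op i * op n.+2) = ell (op i.+1 * op n.+1) + op_rec i * ell (op i.-1 * op n.+1)
    - op_rec n.+1 * ell (op i * op n).
  rewrite opSS mulrBr raddfB /= -scalerAr linearZ /= mulrCA mulrA op_mulX mulrDl raddfD /=.
  by rewrite -scalerAl linearZ.
have rec0 : op_rec i * ell (op i.-1 * op n.+1) = 0.
  case: i ltin e => [|i] ltin e; first by rewrite mul0r.
  rewrite IH ?mulr0 // leqnn andbT; move: ltin => /orP[/eqP <-|] /=; lia.
rewrite e rec0 addr0; case/orP: ltin => [/eqP ->|lt].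
  by rewrite -[ell (op n * op n)]/(op_norm n) /= divfK ?subrr // hn.
by rewrite !IH ?mulr0 ?subrr //; lia.
Qed.

Lemma ell_op_lower n q : (forall i, (i < n)%N -> op_norm i != 0) -> (size q <= n.+1)%N ->
  ell (q * op n) = q`_n * op_norm n.
Proof.
move=> hn; suff low : forall k q, (k <= n)%N -> (size q <= k)%N -> ell (q * op n) = 0.
  move=> sq; have -> : q = q`_n *: op n + (q - q`_n *: op n) by rewrite addrC subrK.
  rewrite mulrDl raddfD /= -scalerAl linearZ /= (low n) // ?addr0.
    by rewrite coefD coefB coefZ coef_op mulr1 subrr addr0.
  apply/leq_sizeP => j; rewrite leq_eqVlt => /orP[/eqP <-|nj].
    by rewrite coefB coefZ coef_op mulr1 subrr.
  by rewrite coefB coefZ [q`_j]nth_default ?(leq_trans sq) // [(op n)`_j]nth_default ?size_op // mulr0 subr0.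
elim=> [|k IH] {}q kn; first by rewrite leqn0 size_poly_eq0 => /eqP ->; rewrite mul0r raddf0.
move=> sq; have -> : q = q`_k *: op k + (q - q`_k *: op k) by rewrite addrC subrK.
rewrite mulrDl raddfD /= -scalerAl linearZ /= (op_ortho hn) ?kn ?leqnn // mulr0 add0r.
apply: IH (ltnW kn) _; apply/leq_sizeP => j; rewrite leq_eqVlt => /orP[/eqP <-|kj].
  by rewrite coefB coefZ coef_op mulr1 subrr.
by rewrite coefB coefZ [q`_j]nth_default ?(leq_trans sq) // [(op k)`_j]nth_default ?size_op // mulr0 subr0.
Qed.

Definition dpoly p : {poly K} := \poly_(i < size p) delta p`_i.

Lemma coef_dpoly p i : (dpoly p)`_i = delta p`_i.
Proof. by rewrite coef_poly; case: ltnP => // h; rewrite nth_default // delta0. Qed.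

Lemma dpolyM p q : dpoly (p * q) = dpoly p * q + p * dpoly q.
Proof.
apply/polyP => i; rewrite coef_dpoly coefD !coefM delta_sum -big_split /=.
by apply: eq_bigr => j _; rewrite deltaM !coef_dpoly.
Qed.

(** The moment relation [m_rec], extended by linearity: integration by parts against the perturbed
    Gaussian weight. *)
Lemma delta_ell p : delta (ell p) = ell (dpoly p + 'X^2 * p - ('X * p)^`()).
Proof.
have s3 : (size ('X * p)^`() <= size p)%N.
  rewrite (leq_trans (size_poly _ _)) // -subn1 leq_subLR.
  by rewrite (leq_trans (size_polyMleq _ _)) // size_polyX.
have s2 : (size ('X^2 * p)%R <= (size p).+2)%N.
  by rewrite (leq_trans (size_polyMleq _ _)) // size_polyXn.
rewrite raddfB raddfD /= (ellE (size_poly _ _)) (ellE s2) (ellE s3).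
rewrite 2!big_ord_recl !coefXnM /= !mul0r !add0r.
rewrite /ell delta_sum -sumrN -!big_split /=; apply: eq_bigr => i _.
rewrite coef_dpoly coefXnM coef_deriv coefXM /= deltaM m_rec.
have -> : (bump 0 (bump 0 i) - 2 = i)%N by rewrite /bump; lia.
by rewrite -[_ *+ i.+1]mulr_natl; ring.
Qed.

Theorem op_flow n : (forall i, (i <= n)%N -> op_norm i != 0) ->
  delta (op_norm n) = op_norm n.+1 + (op_rec n - (2 * n + 1)%:R) * op_norm n.
Proof.
move=> hn; have hn' i : (i < n)%N -> op_norm i != 0 by move=> /ltnW; apply: hn.
rewrite /op_norm delta_ell dpolyM.
(* Since [op n] is monic, [delta] kills its leading coefficient, so [dpoly (op n)] has lower
   degree. *)
have e1 : ell (op n * dpoly (op n)) = 0.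
  rewrite mulrC ell_op_lower // ?coef_dpoly ?coef_op ?delta1 ?mul0r //.
  by rewrite (leq_trans (size_poly _ _)) // size_op.
have e2 : ell (op n * ('X * (op n)^`())) = n%:R * op_norm n.
  rewrite mulrC ell_op_lower //; last first.
    rewrite (leq_trans (size_polyMleq _ _)) // size_polyX /=.
    by rewrite ltnS (leq_trans (size_poly _ _)) // size_op.
  congr (_ * _); rewrite coefXM; case: (n) => // k /=.
  by rewrite coef_deriv coef_op.
(* One X goes to each factor, and the square of the three-term recursion is expanded. *)
have e3 : ell ('X^2 * (op n * op n)) = op_norm n.+1 + op_rec n * op_norm n.
  rewrite (_ : 'X^2 * _ = ('X * op n) * ('X * op n)); last by ring.
  rewrite !op_mulX.
  have -> : (op n.+1 + op_rec n *: op n.-1) * (op n.+1 + op_rec n *: op n.-1) =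
    op n.+1 * op n.+1 + (2 * op_rec n) *: (op n.-1 * op n.+1) + (op_rec n ^+ 2) *: (op n.-1 * op n.-1).
    by rewrite -!mul_polyC !polyCM ?rmorphXn /=; ring.
  have o : ell (op n.-1 * op n.+1) = 0.
    by apply: (@op_ortho n.+1) => [i|]; [rewrite ltnS; apply: hn | lia].
  rewrite !raddfD /= !linearZ /= o mulr0 addr0.
  congr (_ + _); case: (n) hn' => [|k] hk; first by rewrite /= expr0n !mul0r.
  by rewrite -[ell _]/(op_norm k) expr2 -mulrA; congr (_ * _); rewrite /op_rec divfK ?hk.
have e4 : ('X * (op n * op n))^`() = op n * op n + op n * ('X * (op n)^`()) *+ 2.
  by rewrite !derivM derivX mul1r; ring.
rewrite e4 raddfB raddfD /= e3 raddfD /= raddfD raddfMn /= mulrC e1 e2.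
rewrite -[ell (op n * op n)]/(op_norm n) -[ell (op n.+1 * op n.+1)]/(op_norm n.+1).
by rewrite natrD natrM; ring.
Qed.

(** The unitriangular change of basis to the orthogonal polynomials diagonalises the Hankel matrix.
    The last norm may vanish here, which lets [op_norm_um_neq0] deduce that it is nonzero from the
    determinant. *)
Lemma det_hankel n : (forall i, (i < n)%N -> op_norm i != 0) ->
  \det (\matrix_(i < n.+1, j < n.+1) m (i + j)) = \prod_(i < n.+1) op_norm i.
Proof.
move=> hn; set H := \matrix_(i, j) _.
pose C := \matrix_(i < n.+1, j < n.+1) (op i)`_j.
have dC : \det C = 1.
  rewrite det_trig; first by rewrite big1 // => i _; rewrite mxE coef_op.
  by apply/is_trig_mxP => i j ij; rewrite mxE nth_default // size_op.
have e : C *m H *m C^T = diag_mx (\row_(i < n.+1) op_norm i).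
  apply/matrixP => i k.
  have -> : (C *m H *m C^T) i k = ell (op i * op k).
    rewrite (@ellM n.+1 n.+1) ?size_op ?ltn_ord // exchange_big /= mxE.
    apply: eq_bigr => l _; rewrite mxE mulr_suml; apply: eq_bigr => j _.
    by rewrite !mxE mulrAC.
  rewrite !mxE; case: eqP => [->|/eqP nik]; first by rewrite mulr1n.
  rewrite mulr0n; case: (ltngtP i k) => [ik|ki|/val_inj eik]; last by rewrite eik eqxx in nik.
    by rewrite (op_ortho hn) // ik -ltnS ltn_ord.
  by rewrite mulrC (op_ortho hn) // ki -ltnS ltn_ord.
have := congr1 determinant e; rewrite !det_mulmx det_tr dC mul1r mulr1 det_diag => ->.
by apply: eq_bigr => i _; rewrite mxE.
Qed.
End OrthogonalPolynomials.

(** * Derivations of fraction fields *)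

Section QuotientRule.
Variable K : fieldType.
Implicit Types a b c d : K.

Lemma quotient_rule_unique a b c d a' b' c' d' : b != 0 -> d != 0 -> a * d = c * b ->
  a' * d + a * d' = c' * b + c * b' ->
  (a' * b - a * b') / b ^+ 2 = (c' * d - c * d') / d ^+ 2.
Proof.
move=> b0 d0 e e'.
have -> : a' = (c' * b + c * b' - a * d') / d.
  by apply: (mulIf d0); rewrite divfK // -e' addrK.
have -> : a = c * b / d by rewrite -e mulfK.
by field; rewrite b0 d0.
Qed.

Lemma quotient_add a b c d : b != 0 -> d != 0 -> a / b + c / d = (a * d + c * b) / (b * d).
Proof. by move=> b0 d0; field; rewrite b0 d0. Qed.

Lemma quotient_mul a b c d : b != 0 -> d != 0 -> a / b * (c / d) = (a * c) / (b * d).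
Proof. by move=> b0 d0; field; rewrite b0 d0. Qed.

Lemma quotient_rule_add a b c d a' b' c' d' : b != 0 -> d != 0 ->
  ((a' * d + a * d' + (c' * b + c * b')) * (b * d) - (a * d + c * b) * (b' * d + b * d')) / (b * d) ^+ 2
  = (a' * b - a * b') / b ^+ 2 + (c' * d - c * d') / d ^+ 2.
Proof. by move=> b0 d0; field; rewrite b0 d0. Qed.

Lemma quotient_rule_mul a b c d a' b' c' d' : b != 0 -> d != 0 ->
  ((a' * c + a * c') * (b * d) - a * c * (b' * d + b * d')) / (b * d) ^+ 2
  = (a' * b - a * b') / b ^+ 2 * (c / d) + a / b * ((c' * d - c * d') / d ^+ 2).
Proof. by move=> b0 d0; field; rewrite b0 d0. Qed.
End QuotientRule.

Section FractionDerivation.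
Variables (R : idomainType) (D : R -> R).
Hypothesis DD : forall x y, D (x + y) = D x + D y.
Hypothesis DM : forall x y, D (x * y) = D x * y + x * D y.
Local Notation F := (@FracField.tofrac R).


Lemma fraction_div (x : {fraction R}) : x = F \n_(repr x) / F \d_(repr x).
Proof.
rewrite -[LHS]reprK; set r := repr x; have dr := denom_ratioP r.
unlock FracField.tofrac; rewrite -[_^-1]FracField.pi_inv -[RHS]FracField.pi_mul.
rewrite /FracField.mulf /FracField.invf !numden_Ratio ?oner_neq0 // mul1r mulr1.
by rewrite Ratio_numden.
Qed.

Definition fraction_deriv (x : {fraction R}) : {fraction R} :=
  let n := \n_(repr x) in let d := \d_(repr x) in
  (F (D n) * F d - F n * F (D d)) / F d ^+ 2.

(** [fraction_deriv] uses a chosen representative; this shows that any numerator and denominator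
    give the same value. *)
Lemma fraction_derivE n d : d != 0 ->
  fraction_deriv (F n / F d) = (F (D n) * F d - F n * F (D d)) / F d ^+ 2.
Proof.
move=> d0; set x := F n / F d; rewrite /fraction_deriv.
have := fraction_div x; set n' := \n_(repr x); set d' := \d_(repr x) => e.
have d'0 : d' != 0 by exact: denom_ratioP.
have Fd : F d != 0 by rewrite tofrac_eq0.
have Fd' : F d' != 0 by rewrite tofrac_eq0.
have e1 : F n' * F d = F n * F d'.
  by apply: (mulIf (invr_neq0 Fd)); rewrite mulfK // mulrAC -/x e divfK.
have /eqP : F (n' * d) = F (n * d') by rewrite !tofracM.
rewrite tofrac_eq => /eqP /(congr1 D); rewrite !DM => /(congr1 F).
rewrite !tofracD !tofracM => e2.
exact: quotient_rule_unique.
Qed.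

Lemma fraction_deriv_tofrac a : fraction_deriv (F a) = F (D a).
Proof.
have D1 : D 1 = 0 by apply: (addrI (D 1)); rewrite addr0 -{3}[1]mulr1 DM mulr1 mul1r.
have D0 : D 0 = 0 by apply: (addrI (D 0)); rewrite -DD !addr0.
have := @fraction_derivE a 1 (oner_neq0 R).
by rewrite D1 tofrac0 tofrac1 mulr0 subr0 expr1n !divr1 mulr1.
Qed.

Lemma fraction_derivD x y : fraction_deriv (x + y) = fraction_deriv x + fraction_deriv y.
Proof.
rewrite [x]fraction_div [y]fraction_div.
have := denom_ratioP (repr x); have := denom_ratioP (repr y).
move: \n_(repr x) \d_(repr x) \n_(repr y) \d_(repr y) => a b c d d0 b0.
have Fb : F b != 0 by rewrite tofrac_eq0.
have Fd : F d != 0 by rewrite tofrac_eq0.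
have -> : F a / F b + F c / F d = F (a * d + c * b) / F (b * d).
  by rewrite quotient_add // -!tofracM -tofracD.
rewrite !fraction_derivE ?mulf_neq0 // !(DD, DM) !(tofracD, tofracM, DM).
exact: quotient_rule_add.
Qed.

Lemma fraction_derivM x y :
  fraction_deriv (x * y) = fraction_deriv x * y + x * fraction_deriv y.
Proof.
rewrite [x]fraction_div [y]fraction_div.
have := denom_ratioP (repr x); have := denom_ratioP (repr y).
move: \n_(repr x) \d_(repr x) \n_(repr y) \d_(repr y) => a b c d d0 b0.
have Fb : F b != 0 by rewrite tofrac_eq0.
have Fd : F d != 0 by rewrite tofrac_eq0.
have -> : F a / F b * (F c / F d) = F (a * c) / F (b * d).
  by rewrite quotient_mul // -!tofracM.
rewrite !fraction_derivE ?mulf_neq0 // !(DD, DM) !(tofracD, tofracM, DM).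
exact: quotient_rule_mul.
Qed.
End FractionDerivation.

(** * Flow of the ratios of partition functions *)

Lemma op_norm_gauss_mom n : op_norm gauss_mom n = n`!%:R.
Proof.
have [k] := ubnP n; elim: k n => // k IH [|n] nk.
  by rewrite /op_norm op0 mulr1 /ell size_poly1 big_ord1 coef1 mulr1.
have D0 : forall x y : rat, (fun=> 0) (x + y) = (fun=> 0) x + (fun=> 0 : rat) y.
  by move=> x y; rewrite addr0.
have DM : forall x y : rat, (fun=> 0) (x * y) = (fun=> 0) x * y + x * (fun=> 0 : rat) y.
  by move=> x y; rewrite mul0r mulr0 addr0.
have rec l : gauss_mom l.+2 = l.+1%:R * gauss_mom l + (fun=> 0) (gauss_mom l).
  by rewrite addr0.
have hn i : (i <= n)%N -> op_norm gauss_mom i = i`!%:R.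
  by move=> hi; apply: IH; rewrite (leq_ltn_trans hi).
have fn i : i`!%:R != 0 :> rat by rewrite pnatr_eq0 -lt0n fact_gt0.
have nz i : (i <= n)%N -> op_norm gauss_mom i != 0 by move=> /hn ->.
have := op_flow D0 DM gauss_mom_odd rec nz.
(* For the unperturbed weight the derivation is 0 and the flow reads h_(n+1) = (2n + 1 - R_n) h_n,
   with R_n = n by induction: the Hermite norms. *)
have er : op_rec gauss_mom n = n%:R.
  case: (n) hn => [|l] hl //=; rewrite !hl // factS natrM mulfK //.
rewrite er (hn n) // => /esym/eqP; rewrite addr_eq0 => /eqP ->.
rewrite factS natrM -natr1 natrD natrM; ring.
Qed.

Lemma det_gauss_mom N : \det (\matrix_(i < N, j < N) gauss_mom (i + j)) = \prod_(i < N) i`!%:R.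
Proof.
case: N => [|n]; first by rewrite det_mx00 big_ord0.
rewrite (det_hankel gauss_mom_odd) => [|i _].
  by apply: eq_bigr => i _; rewrite op_norm_gauss_mom.
by rewrite op_norm_gauss_mom pnatr_eq0 -lt0n fact_gt0.
Qed.

(** Elimination of the norms: a, b, c, e stand for normalised partition functions of consecutive
    sizes, h0, h1, h2 for the norms relating them, f for n! and N for n+1. *)
Lemma ratio_flow_field (K : fieldType) (a b c e f h0 h1 h2 N db dc dh : K) :
  f != 0 -> h0 != 0 -> N != 0 -> N + 1 != 0 ->
  b * f = a * h0 -> c * (N * f) = b * h1 -> e * ((N + 1) * (N * f)) = c * h2 ->
  dc * (N * f) = db * h1 + b * dh -> dh = h2 + (h1 / h0 - (2 * N + 1)) * h1 ->
  b * c * (dc * b - c * db) =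
  (N + 1) * e * b ^+ 3 + N * c ^+ 3 * a - (2 * N + 1) * c ^+ 2 * b ^+ 2.
Proof.
move=> f0 h00 N0 N1 ea ec ee edc edh; have Nf : N * f != 0 by rewrite mulf_neq0.
have -> : a = b * f / h0 by rewrite ea mulfK.
have -> : e = c * h2 / ((N + 1) * (N * f)) by rewrite -ee mulfK // mulf_neq0.
have -> : dc = (db * h1 + b * dh) / (N * f) by rewrite -edc mulfK.
have -> : c = b * h1 / (N * f) by rewrite -ec mulfK.
by rewrite edh; field; rewrite h00 N0 N1 f0.
Qed.

Section Flow.
Variable d : nat.
Hypothesis d_even : ~~ odd d.
Notation R := {poly rat}.
Local Notation F := (@FracField.tofrac R).

Lemma partition_poly0 N :
  (partition_poly N d)`_0 = N`!%:R * \prod_(i < N) i`!%:R.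
Proof.
rewrite partition_poly_hankel mulr_natl coefMn -[LHS]mulr_natl; congr (_ * _).
rewrite -horner_coef0 -/(horner_eval 0 _) -det_map_mx -det_gauss_mom.
congr (\det _); apply/matrixP => i j.
by rewrite !mxE /= /horner_eval horner_coef0 coef_poly /= muln0 addn0 invr1 mul1r.
Qed.

Lemma partition_poly0_neq0 N : (partition_poly N d)`_0 != 0.
Proof.
rewrite partition_poly0 mulf_neq0 ?pnatr_eq0 -?lt0n ?fact_gt0 //.
by apply/prodf_neq0 => i _; rewrite pnatr_eq0 -lt0n fact_gt0.
Qed.

Definition euler_deriv (p : R) : R := d%:R *: ('X * p^`()).

Lemma euler_derivD p q : euler_deriv (p + q) = euler_deriv p + euler_deriv q.
Proof. by rewrite /euler_deriv derivD mulrDr scalerDr. Qed.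

Lemma euler_derivM p q : euler_deriv (p * q) = euler_deriv p * q + p * euler_deriv q.
Proof. by rewrite /euler_deriv derivM -!mul_polyC; ring. Qed.

Lemma coef_euler_deriv p i : (euler_deriv p)`_i = d%:R * i%:R * p`_i.
Proof.
rewrite coefZ coefXM coef_deriv; case: i => [|i] /=; first by rewrite !mulr0 mul0r.
by rewrite -[p`_i.+1 *+ _]mulr_natl mulrA.
Qed.

Local Notation dl := (fraction_deriv euler_deriv).
Definition um (k : nat) : {fraction R} := F (umoment d k).

Lemma um_odd k : odd k -> um k = 0.
Proof.
move=> ok; rewrite /um; apply/eqP; rewrite tofrac_eq0; apply/eqP/polyP => i.
rewrite coef0 coef_poly; case: ifP => // _.
by rewrite gauss_mom_odd ?mulr0 // oddD oddM ok (negbTE d_even).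
Qed.

(** Exact despite the cut-off: at t^b the Gaussian recursion has the factor k + 1 + d b, and
    [euler_deriv] contributes the part d b. *)
Lemma um_rec k : um k.+2 = k.+1%:R * um k + dl (um k).
Proof.
rewrite /um (fraction_deriv_tofrac euler_derivD euler_derivM) -(rmorph_nat F) -tofracM -tofracD.
congr F; apply/polyP => i; rewrite coefD coef_euler_deriv -[k.+1%:R]polyC_natr coefCM.
rewrite !coef_poly; case: ifP => _; last by rewrite !mulr0 addr0.
by rewrite !addSn /= -[(_ + _).+1]addSn natrD natrM; ring.
Qed.

Lemma det_umoment N : F (\det (\matrix_(i < N, j < N) umoment d (i + j))) =
  \det (\matrix_(i < N, j < N) um (i + j)).
Proof.
by rewrite -det_map_mx; congr (\det _); apply/matrixP => i j; rewrite !mxE.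
Qed.

Let dlD := fraction_derivD euler_derivD euler_derivM.
Let dlM := fraction_derivM euler_derivM.

(** At t = 0 the Hankel determinant is the nonzero Gaussian one, so it is a nonzero polynomial; its
    last factor is the new norm. *)
Lemma op_norm_um_neq0 n : op_norm um n != 0.
Proof.
have [k] := ubnP n; elim: k n => // k IH n nk.
have : F (partition_poly n.+1 d) != 0.
  by rewrite tofrac_eq0; apply: contraNneq (partition_poly0_neq0 n.+1) => ->; rewrite coef0.
rewrite partition_poly_hankel tofracM mulf_eq0 negb_or => /andP[_].
rewrite det_umoment (det_hankel um_odd); last first.
  by move=> i hi; apply: IH; rewrite (leq_trans hi).
by rewrite big_ord_recr /= mulf_eq0 negb_or => /andP[].
Qed.

Definition partition_ratio N : R := ((partition_poly N d)`_0)^-1 *: partition_poly N d.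

Lemma partition_ratio0 N : (partition_ratio N)`_0 = 1.
Proof. by rewrite coefZ mulVf ?partition_poly0_neq0. Qed.

Lemma partition_ratioE N :
  F (partition_ratio N) = \prod_(i < N) (op_norm um i / i`!%:R).
Proof.
rewrite /partition_ratio -mul_polyC tofracM partition_poly_hankel tofracM det_umoment.
have -> : \det (\matrix_(i < N, j < N) um (i + j)) = \prod_(i < N) op_norm um i.
  case: N => [|n]; first by rewrite det_mx00 big_ord0.
  by rewrite (det_hankel um_odd) // => i _; exact: op_norm_um_neq0.
rewrite big_split /= mulrA mulrC; congr (_ * _).
rewrite -tofracM -partition_poly_hankel partition_poly0 -(rmorph_nat polyC) -polyCM.
have fn i : i`!%:R != 0 :> rat by rewrite pnatr_eq0 -lt0n fact_gt0.
rewrite invfM mulrAC mulVf // mul1r.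
rewrite -prodfV rmorph_prod rmorph_prod; apply: eq_bigr => i _.
apply: (@mulfI _ (i`!%:R)).
  by rewrite -(rmorph_nat F) tofrac_eq0 -(rmorph_nat polyC) polyC_eq0.
rewrite mulfV; last by rewrite -(rmorph_nat F) tofrac_eq0 -(rmorph_nat polyC) polyC_eq0.
by rewrite -(rmorph_nat F) -tofracM -(rmorph_nat polyC) -polyCM mulfV.
Qed.

Lemma tofrac_natr_neq0 n : n.+1%:R != 0 :> {fraction R}.
Proof. by rewrite -(rmorph_nat F) tofrac_eq0 -(rmorph_nat polyC) polyC_eq0 pnatr_eq0. Qed.

(** Divided by b^2 c^2, this is the flow of log(c/b), with e b / c^2 and c a / b^2 in the role of
    the recurrence coefficients divided by their Gaussian values. *)
Lemma partition_ratio_flow n :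
  let a := partition_ratio n in let b := partition_ratio n.+1 in
  let c := partition_ratio n.+2 in let e := partition_ratio n.+3 in
  b * c * (euler_deriv c * b - c * euler_deriv b) =
  (n.+1%:R + 1) * e * b ^+ 3 + n.+1%:R * c ^+ 3 * a - (2 * n.+1%:R + 1) * c ^+ 2 * b ^+ 2.
Proof.
move=> a b c e; apply/eqP; rewrite -tofrac_eq; apply/eqP.
have step N : F (partition_ratio N.+1) * N`!%:R = F (partition_ratio N) * op_norm um N.
  rewrite !partition_ratioE big_ord_recr /= -mulrA divfK //.
  by rewrite -[N`!]prednK ?fact_gt0 // tofrac_natr_neq0.
rewrite !(tofracM, tofracB, tofracD, tofracXn, tofrac1, rmorph_nat).
have dlF x : F (euler_deriv x) = dl (F x).
  by rewrite (fraction_deriv_tofrac euler_derivD euler_derivM).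
have dlMn x k : dl (x * k%:R) = dl x * k%:R.
  rewrite !mulr_natr; elim: k => [|k IH]; last by rewrite !mulrS dlD IH.
  by rewrite !mulr0n -(tofrac0 R) -dlF /euler_deriv deriv0 mulr0 scaler0.
apply: (@ratio_flow_field _ _ _ _ _ n`!%:R (op_norm um n) (op_norm um n.+1)
          (op_norm um n.+2) _ _ _ (dl (op_norm um n.+1))).
- by rewrite -[n`!]prednK ?fact_gt0 // tofrac_natr_neq0.
- exact: op_norm_um_neq0.
- exact: tofrac_natr_neq0.
- by rewrite natr1 tofrac_natr_neq0.
- exact: step.
- by rewrite -natrM -factS step.
- by rewrite natr1 -!natrM -!factS step.
- by rewrite !dlF -natrM -factS -dlMn step dlM.
- rewrite (op_flow dlD dlM um_odd um_rec); last by move=> i _; exact: op_norm_um_neq0.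
  by rewrite natrD natrM.
Qed.

Definition gue_raw N b : rat := coulomb_moment N (nseq b d) / coulomb_moment N [::].

Lemma coef_partition_ratio N b : (b < 4)%N ->
  (partition_ratio N)`_b = b`!%:R^-1 * gue_raw N b.
Proof.
move=> b4; rewrite coefZ !coef_partition_poly // fact0 invr1 mul1r.
by rewrite /gue_raw mulrCA; congr (_ * _); rewrite mulrC.
Qed.
End Flow.

(** * Taylor coefficients to third order and the flow of the cumulants *)

Section JetAlgebra.
Notation R := {poly rat}.

Definition jet3 (p : R) (x0 x1 x2 x3 : rat) :=
  [/\ p`_0 = x0, p`_1 = x1, p`_2 = x2 & p`_3 = x3].

Lemma jet3M p q x0 x1 x2 x3 y0 y1 y2 y3 : jet3 p x0 x1 x2 x3 -> jet3 q y0 y1 y2 y3 ->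
  jet3 (p * q) (x0 * y0) (x0 * y1 + x1 * y0) (x0 * y2 + x1 * y1 + x2 * y0)
    (x0 * y3 + x1 * y2 + x2 * y1 + x3 * y0).
Proof.
case=> <- <- <- <- [<- <- <- <-].
by split; rewrite coefM !big_ord_recl big_ord0 /= addr0 ?addrA.
Qed.

Lemma jet3D p q x0 x1 x2 x3 y0 y1 y2 y3 : jet3 p x0 x1 x2 x3 -> jet3 q y0 y1 y2 y3 ->
  jet3 (p + q) (x0 + y0) (x1 + y1) (x2 + y2) (x3 + y3).
Proof. by case=> <- <- <- <- [<- <- <- <-]; split; rewrite coefD. Qed.

Lemma jet3B p q x0 x1 x2 x3 y0 y1 y2 y3 : jet3 p x0 x1 x2 x3 -> jet3 q y0 y1 y2 y3 ->
  jet3 (p - q) (x0 - y0) (x1 - y1) (x2 - y2) (x3 - y3).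
Proof. by case=> <- <- <- <- [<- <- <- <-]; split; rewrite coefB. Qed.

Lemma jet3n k p x0 x1 x2 x3 : jet3 p x0 x1 x2 x3 ->
  jet3 (k%:R * p) (k%:R * x0) (k%:R * x1) (k%:R * x2) (k%:R * x3).
Proof. by case=> <- <- <- <-; split; rewrite !mulr_natl coefMn. Qed.

Lemma jet3_euler d p x0 x1 x2 x3 : jet3 p x0 x1 x2 x3 ->
  jet3 (euler_deriv d p) 0 (d%:R * x1) (2 * d%:R * x2) (3 * d%:R * x3).
Proof.
case=> _ <- <- <-; split; rewrite coef_euler_deriv ?mulr0 ?mul0r ?mulr1 //.
  by rewrite [2 * _]mulrC.
by rewrite [3 * _]mulrC.
Qed.
End JetAlgebra.

Definition gue_cumulant d j N : rat :=
  match j with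
  | 1%N => gue_raw d N 1
  | 2%N => gue_raw d N 2 - gue_raw d N 1 ^+ 2
  | 3%N => gue_raw d N 3 - 3 * gue_raw d N 1 * gue_raw d N 2 + 2 * gue_raw d N 1 ^+ 3
  | _ => 0
  end.

Definition cdiff2 (f : nat -> rat) n := f n.+2 - 2 * f n.+1 + f n.

(** The logarithm of e b / c^2 is a second difference of log Z, with Taylor coefficients the second
    differences of the cumulants over j!. The brackets are the complete Bell polynomials that
    exponentiate it; at order 0 the flow reads 0 = (N + 1) + N - (2N + 1). *)
Theorem gue_cumulant_flow d n : ~~ odd d ->
  let N : rat := n.+1%:R in let f j := gue_cumulant d j in
  let g j := cdiff2 (f j) n.+1 in let g' j := cdiff2 (f j) n in
  [/\ d%:R * (f 1%N n.+2 - f 1%N n.+1) = (N + 1) * g 1%N + N * g' 1%N,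
      2 * d%:R * (f 2%N n.+2 - f 2%N n.+1) =
        (N + 1) * (g 2%N + g 1%N ^+ 2) + N * (g' 2%N + g' 1%N ^+ 2) &
      3 * d%:R * (f 3%N n.+2 - f 3%N n.+1) =
        (N + 1) * (g 3%N + 3 * g 1%N * g 2%N + g 1%N ^+ 3) +
        N * (g' 3%N + 3 * g' 1%N * g' 2%N + g' 1%N ^+ 3)].
Proof.
move=> d_even N f g g'.
have := partition_ratio_flow d_even n; cbv zeta.
have J m : jet3 (partition_ratio d m) 1 (gue_raw d m 1) (2^-1 * gue_raw d m 2) (6^-1 * gue_raw d m 3).
  split; first exact: partition_ratio0.
  - by rewrite coef_partition_ratio // invr1 mul1r.
  - by rewrite coef_partition_ratio.
  - by rewrite coef_partition_ratio.
rewrite natr1 -natrM natr1 !exprS !expr0 !mulr1.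
move: (J n) (J n.+1) (J n.+2) (J n.+3).
move: (partition_ratio d n) (partition_ratio d n.+1) (partition_ratio d n.+2) (partition_ratio d n.+3).
rewrite /g /g' /cdiff2 /f /gue_cumulant.
move: (gue_raw d n) (gue_raw d n.+1) (gue_raw d n.+2) (gue_raw d n.+3) => A B C E.
move=> a b c e ja jb jc je fl.
have [_ l1 l2 l3] := jet3M (jet3M jb jc) (jet3B (jet3M (jet3_euler d jc) jb) (jet3M jc (jet3_euler d jb))).
have jb3 := jet3M jb (jet3M jb jb); have jc3 := jet3M jc (jet3M jc jc).
have [_ r1 r2 r3] := jet3B (jet3D (jet3M (jet3n n.+2 je) jb3)
  (jet3M (jet3n n.+1 jc3) ja)) (jet3M (jet3n (2 * n.+1).+1 (jet3M jc jc)) (jet3M jb jb)).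
rewrite fl in l1 l2 l3.
have e1 := etrans (esym l1) r1; have e2 := etrans (esym l2) r2; have e3 := etrans (esym l3) r3.
have nE : n.+2%:R = N + 1 :> rat by rewrite natr1.
have nE2 : (2 * n.+1).+1%:R = 2 * N + 1 :> rat by rewrite -natr1 natrM.
rewrite nE nE2 -/N in e1 e2 e3; clear l1 l2 l3 r1 r2 r3 fl ja jb jc je jb3 jc3 J nE nE2.
move: (d%:R : rat) (N) e1 e2 e3 => D M.
move: (A 1%N) (A 2%N) (A 3%N) (B 1%N) (B 2%N) (B 3%N) (C 1%N) (C 2%N) (C 3%N) (E 1%N) (E 2%N) (E 3%N).
move=> a1 a2 a3 b1 b2 b3 c1 c2 c3 e1 e2 e3 q1 q2 q3.
match type of q1 with ?l = ?r => pose P1 : rat := l - r end.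
match type of q2 with ?l = ?r => pose P2 : rat := l - r end.
match type of q3 with ?l = ?r => pose P3 : rat := l - r end.
have p1 : P1 = 0 by rewrite /P1 q1 subrr.
have p2 : P2 = 0 by rewrite /P2 q2 subrr.
have p3 : P3 = 0 by rewrite /P3 q3 subrr.
clear q1 q2 q3.
(* [s1] and [s2] are the coefficients of t and t^2 in b^2 c^2. The combinations below are the
   coefficients of the flow divided by b^2 c^2, times j!. *)
pose s1 := 2 * (b1 + c1); pose s2 := b2 + b1 ^+ 2 + c2 + c1 ^+ 2 + 4 * b1 * c1.
split; apply/eqP; rewrite -subr_eq0; apply/eqP.
- transitivity P1; last exact: p1. by rewrite /P1; ring.
- transitivity (2 * (P2 - s1 * P1)); last by rewrite p1 p2; ring.
  by rewrite /P1 /P2 /s1; field.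
- transitivity (6 * (P3 - s1 * P2 + (s1 ^+ 2 - s2) * P1)); last by rewrite p1 p2 p3; ring.
  by rewrite /P1 /P2 /P3 /s1 /s2; field.
Qed.

(** * Graph sums *)

Section InvariantColourings.
Variables (T : finType) (phi : T -> T) (N : nat).
Hypothesis phi_inj : injective phi.

(** An invariant colouring is a free choice of one colour per orbit. *)
Lemma card_invariant_ffun :
  #|[set c : {ffun T -> 'I_N} | [forall h, c (phi h) == c h]]| = (N ^ fcard phi predT)%N.
Proof.
pose U := {x : T | roots (frel phi) x}.
pose ext (g : {ffun U -> 'I_N}) : {ffun T -> 'I_N} :=
  [ffun h => g (exist _ (froot phi h) (roots_root (fconnect_sym phi_inj) h))].
have root_phi h : froot phi (phi h) = froot phi h.
  apply/esym/eqP; rewrite root_connect; last exact: fconnect_sym.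
  exact: fconnect1.
have -> : [set c : {ffun T -> 'I_N} | [forall h, c (phi h) == c h]] = ext @: setT.
  apply/setP => c; rewrite inE; apply/forallP/imsetP => [cP|[g _ ->] h]; last first.
    by rewrite !ffunE; apply/eqP; congr (g _); apply: val_inj; exact: root_phi.
  exists [ffun u : U => c (val u)] => //; apply/ffunP => h; rewrite !ffunE /=.
  have /iter_findex <- : fconnect phi h (froot phi h) by exact: connect_root.
  by elim: findex => //= k ->; rewrite (eqP (cP _)).
rewrite card_imset => [|g1 g2 /ffunP e].
  rewrite cardsT card_ffun card_ord card_sig; congr (_ ^ _)%N.
  by apply: eq_card => x; rewrite !inE andbT.
apply/ffunP => -[x rx]; have := e x; rewrite !ffunE.
suff -> : exist _ (froot phi x) (roots_root (fconnect_sym phi_inj) x) = exist _ x rx :> U by [].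
by apply: val_inj => /=; exact/eqP.
Qed.
End InvariantColourings.

Section InsertFfun.
Variables (U : finType) (n : nat) (v : 'I_n.+1).

Definition ffun_insert (x : U) (c : {ffun 'I_n -> U}) : {ffun 'I_n.+1 -> U} :=
  [ffun i => oapp c x (unlift v i)].

Lemma ffun_insert_hd x c : ffun_insert x c v = x.
Proof. by rewrite ffunE unlift_none. Qed.

Lemma ffun_insert_lift x c i : ffun_insert x c (lift v i) = c i.
Proof. by rewrite ffunE liftK. Qed.

Lemma sum_ffun_insert (R : nmodType) (F : {ffun 'I_n.+1 -> U} -> R) :
  \sum_c F c = \sum_x \sum_c F (ffun_insert x c).
Proof.
rewrite pair_big /= (reindex (fun p : U * {ffun 'I_n -> U} => ffun_insert p.1 p.2)) //=.
exists (fun c => (c v, [ffun i => c (lift v i)])) => [[x c] _|c _] /=.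
  rewrite ffun_insert_hd; congr (_, _); apply/ffunP => i.
  by rewrite ffunE ffun_insert_lift.
apply/ffunP => i; case: (unliftP v i) => [k|] ->.
  by rewrite ffun_insert_lift ffunE.
by rewrite ffun_insert_hd.
Qed.

Lemma big_ord_insert (R : Type) (idx : R) (op : Monoid.com_law idx) (F : 'I_n.+1 -> R) :
  \big[op/idx]_i F i = op (F v) (\big[op/idx]_(i < n) F (lift v i)).
Proof.
rewrite (bigD1 v) //=; congr (op _ _).
rewrite (reindex_omap (lift v) (unlift v)) /=.
  by apply: eq_bigl => i; rewrite liftK eqxx eq_sym neq_lift.
by move=> i; case: (unliftP v i) => [k ->|->]; rewrite ?eqxx // => _; rewrite ?liftK ?unlift_none.
Qed.
End InsertFfun.

Lemma trace_expS (R : comNzRingType) n (A : 'M[R]_n.+1) d :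
  \tr (A ^+ d.+1) = \sum_(c : {ffun 'I_d.+1 -> 'I_n.+1}) \prod_i A (c i) (c (ordS i)).
Proof.
(* Open walks, weighted by G at their end points so that induction can peel off the first step;
   taking G to be one more matrix entry closes the walk. *)
have walk k (G : 'I_n.+1 -> 'I_n.+1 -> R) :
    \sum_(c : {ffun 'I_k.+1 -> 'I_n.+1})
      (\prod_(i < k) A (c (widen_ord (leqnSn k) i)) (c (lift ord0 i))) * G (c ord0) (c ord_max) =
    \sum_p \sum_q (A ^+ k) p q * G p q.
  elim: k G => [|k IH] G.
    rewrite (sum_ffun_insert ord0); apply: eq_bigr => p _.
    have f0 (c : {ffun 'I_0 -> 'I_n.+1}) : c = finfun (fun i => ord0) by apply/ffunP => -[].
    rewrite (bigD1 p) //= expr0 [X in _ = _ + X]big1 ?addr0 => [|q /negbTE qp]; last first.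
      by rewrite mxE eq_sym qp mul0r.
    rewrite (eq_bigr (fun=> G p p)) => [|c _]; last first.
      rewrite big_ord0 mul1r (_ : ord_max = ord0); last exact: val_inj.
      by rewrite ffun_insert_hd.
    by rewrite sumr_const card_ffun !card_ord expn0 mulr1n mxE eqxx mul1r.
  rewrite (sum_ffun_insert ord0) exchange_big /=.
  transitivity (\sum_(c : {ffun 'I_k.+1 -> 'I_n.+1})
     (\prod_(i < k) A (c (widen_ord (leqnSn k) i)) (c (lift ord0 i))) *
     (\sum_x A x (c ord0) * G x (c ord_max))).
    apply: eq_bigr => c _; rewrite mulr_sumr; apply: eq_bigr => x _.
    rewrite big_ord_recl.
    have -> : widen_ord (leqnSn k.+1) ord0 = ord0 by apply: val_inj.
    have -> : @ord_max k.+1 = lift ord0 ord_max by apply: val_inj.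
    rewrite !ffun_insert_hd !ffun_insert_lift -mulrA mulrCA; congr (_ * _).
    apply: eq_bigr => i _.
    have -> : widen_ord (leqnSn k.+1) (lift ord0 i) = lift ord0 (widen_ord (leqnSn k) i) by apply: val_inj.
    by rewrite !ffun_insert_lift.
  rewrite (IH (fun p q => \sum_x A x p * G x q)) /=.
  under eq_bigr => p _ do under eq_bigr => q _ do rewrite mulr_sumr.
  under eq_bigr => p _ do rewrite exchange_big /=.
  rewrite exchange_big /=; apply: eq_bigr => x _; rewrite exchange_big /=.
  apply: eq_bigr => q _; rewrite exprS mxE mulr_suml; apply: eq_bigr => p _.
  by rewrite mulrCA mulrA.
transitivity (\sum_p \sum_q (A ^+ d) p q * A q p).
  by rewrite exprSr /mxtrace; apply: eq_bigr => p _; rewrite mxE.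
rewrite -(walk d (fun p q => A q p)); apply: eq_bigr => c _.
rewrite big_ord_recr /=; congr (_ * A _ (c _)); last first.
  by apply: val_inj => /=; rewrite modnn.
apply: eq_bigr => i _; congr (A _ (c _)).
by apply: val_inj => /=; rewrite modn_small // ltnS.
Qed.

Section Matchings.
Variables d j : nat.
Notation H := (halfedge d j).
Implicit Types (M : {set {set H}}) (s r : rel H).

Lemma perfect_matchingE M : perfect_matching M = (M \in pairings (fun _ _ => true) [set: H]).
Proof.
rewrite mem_pairings /perfect_matching; congr (_ && _); apply: eq_forallb => e; congr (_ ==> _).
apply/cards2P/existsP => [[x [y [nxy ->]]]|[x /existsP[y /and3P[nxy _ /eqP ->]]]].
  by exists x; apply/existsP; exists y; rewrite nxy eqxx.
by exists x, y.
Qed.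

Lemma mate_neq M h : perfect_matching M -> mate M h != h.
Proof.
case/andP=> pM /forall_inP cM; rewrite /mate; case: pickP => [h' /andP[_]|n0] //=.
have hc : h \in cover M by rewrite (cover_partition pM).
have hb : h \in pblock M h by rewrite mem_pblock.
have /cards2P[x [y [nxy e]]] := cM _ (pblock_mem hc).
have := n0 x; have := n0 y; rewrite e !inE !eqxx orbT /= => /negbFE/eqP yh /negbFE/eqP xh.
by rewrite xh yh eqxx in nxy.
Qed.

Lemma mem_mate M h : perfect_matching M -> [set h; mate M h] \in M.
Proof.
move=> pmM; have nm := mate_neq h pmM; case/andP: (pmM) => pM /forall_inP cM.
have hc : h \in cover M by rewrite (cover_partition pM).
have hb : h \in pblock M h by rewrite mem_pblock.
have mb : mate M h \in pblock M h.
  by rewrite /mate; case: pickP => [h' /andP[]|].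
suff <- : pblock M h = [set h; mate M h] by exact: pblock_mem.
apply/esym/eqP; rewrite eqEcard subUset !sub1set hb mb /=.
by rewrite (eqP (cM _ (pblock_mem hc))) cards2 eq_sym nm.
Qed.

Lemma mate_unique M x y : perfect_matching M -> x != y -> [set x; y] \in M -> mate M x = y.
Proof.
move=> pmM nxy xyM; have pM := andP pmM => {pM}; have [pM _] := andP pmM.
have tM := partition_trivIset pM.
have e1 := def_pblock tM xyM (set21 x y); have e2 := def_pblock tM (mem_mate x pmM) (set21 _ _).
have : mate M x \in [set x; y] by rewrite -e1 e2 set22.
by rewrite !inE (negbTE (mate_neq _ pmM)) => /eqP.
Qed.

Lemma mateK M : perfect_matching M -> involutive (mate M).
Proof.
move=> pM h; apply: mate_unique => //; first exact: mate_neq.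
by rewrite setUC mem_mate.
Qed.

Lemma edge_mate M e : perfect_matching M -> e \in M -> exists h, e = [set h; mate M h].
Proof.
move=> pM eM; case/andP: (pM) => _ /forall_inP /(_ e eM) /cards2P[x [y [nxy exy]]].
by exists x; rewrite (mate_unique (y := y)) -?exy.
Qed.

Lemma pairings_mateP M r : ssrbool.symmetric r -> perfect_matching M ->
  reflect (forall h, r h (mate M h)) (M \in pairings r [set: H]).
Proof.
move=> sr pM; have [paM _] := andP pM; rewrite mem_pairings paM; apply: (iffP forall_inP) => rM.
  by move=> h; have := rM _ (mem_mate h pM); rewrite pair_edgeP // eq_sym mate_neq.
move=> e /(edge_mate pM)[h ->]; rewrite pair_edgeP // ?rM //.
by rewrite eq_sym mate_neq.
Qed.

Lemma pairings_perfect M r : M \in pairings r [set: H] -> perfect_matching M.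
Proof.
rewrite mem_pairings.
move=> /andP[pM].
move=> /forall_inP rM.
rewrite perfect_matchingE.
rewrite mem_pairings; apply/andP; split=> //; apply/forall_inP => e /rM.
case/existsP=> x /existsP[y /and3P[nxy _ e2]].
by apply/existsP; exists x; apply/existsP; exists y; rewrite nxy e2.
Qed.

Lemma rotate_inj : injective (@rotate d j).
Proof.
move=> x y e; have := congr1 fst e; have := congr1 snd e; rewrite /rotate /=.
by case: x {e} => v i; case: y => w k /= /(bij_inj (ordS_bij _)) -> ->.
Qed.

Lemma face_step_inj M : perfect_matching M -> injective (face_step M).
Proof. by move=> pM; apply: inj_comp; [exact: rotate_inj | exact: inv_inj (mateK pM)]. Qed.

Variable N : nat.
Notation colouring := {ffun 'I_j -> {ffun 'I_d -> 'I_N}}.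
Implicit Type c : colouring.

Definition colour c (h : H) : 'I_N := c h.1 h.2.
(** A half-edge x carries the matrix entry with row [colour c x] and column [colour c (rotate x)];
    two half-edges may be paired when their entries are transposed to each other. *)
Definition wick_compat c : rel H := fun x y =>
  (colour c y == colour c (rotate x)) && (colour c (rotate y) == colour c x).

Lemma wick_compat_sym c : ssrbool.symmetric (wick_compat c).
Proof. by move=> x y; rewrite /wick_compat andbC ![colour c y == _]eq_sym ![colour c (rotate y) == _]eq_sym. Qed.

(** A colouring is compatible with M exactly when it is constant along [face_step], hence on each
    face. *)
Lemma expn_nb_faces M : perfect_matching M ->
  (N ^ nb_faces M)%N = #|[set c : colouring | M \in pairings (wick_compat c) [set: H]]|.
Proof.
move=> pM; rewrite /nb_faces -(card_invariant_ffun N (face_step_inj pM)).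
pose unc (c : colouring) : {ffun H -> 'I_N} := [ffun h => colour c h].
have unc_inj : injective unc.
  move=> c1 c2 /ffunP e; apply/ffunP => v; apply/ffunP => i.
  by have := e (v, i); rewrite !ffunE.
rewrite -(card_imset _ unc_inj); apply: eq_card => f; rewrite inE.
apply/forallP/imsetP => [fP|[c cP ->] h].
  exists [ffun v => [ffun i => f (v, i)]]; last first.
    by apply/ffunP => -[v i]; rewrite !ffunE /colour !ffunE.
  rewrite inE; apply/(pairings_mateP (@wick_compat_sym _) pM) => h.
  have cE x : colour [ffun v => [ffun i => f (v, i)]] x = f x.
    by rewrite /colour !ffunE; case: x.
  rewrite /wick_compat !cE -(eqP (fP h)) eqxx /= -(eqP (fP (mate M h))).
  (* The second equation of [wick_compat] is invariance at the mate, as [mate] is an involution. *)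
  by rewrite /face_step mateK // eqxx.
rewrite !ffunE; move: cP; rewrite inE => /(pairings_mateP (@wick_compat_sym _) pM) /(_ h).
by case/andP.
Qed.

Lemma sum_pairings_expn s : ssrbool.symmetric s ->
  (\sum_(M in pairings s [set: H]) N ^ nb_faces M =
   \sum_(c : colouring) #|pairings (fun x y => s x y && wick_compat c x y) [set: H]|)%N.
Proof.
move=> ss.
rewrite (eq_bigr (fun M => \sum_(c : colouring) (M \in pairings (wick_compat c) [set: H])))%N; last first.
  by move=> M /pairings_perfect pM; rewrite expn_nb_faces // -sum1dep_card big_mkcond;
    apply: eq_bigr => c _; case: (_ \in _).
rewrite exchange_big /=; apply: eq_bigr => c _.
rewrite -sum1_card big_mkcond [RHS]big_mkcond /=; apply: eq_bigr => M _.
have sr : ssrbool.symmetric (fun x y => s x y && wick_compat c x y).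
  by move=> x y; rewrite ss wick_compat_sym.
have if_natE (a b c' : bool) : (b -> a) -> (a -> b = c') ->
    (if a then nat_of_bool c' else 0%N) = (if b then 1%N else 0%N).
  by case: a => ba ab; [rewrite ab //; case: (c') | case: b ba ab => // /(_ isT)].
apply: if_natE => [Msr|Ms].
  have pM := pairings_perfect Msr.
  by apply/(pairings_mateP ss pM) => h; have /andP[] := pairings_mateP sr pM Msr h.
have pM := pairings_perfect Ms.
apply/(pairings_mateP sr pM)/(pairings_mateP (@wick_compat_sym _) pM) => h r.
  by case/andP: (h r).
by rewrite h andbT; exact: (pairings_mateP ss pM Ms).
Qed.
End Matchings.

Lemma eq_in_pairings (T : finType) (r r' : rel T) (A : {set T}) :
  (forall x y, x \in A -> y \in A -> r x y = r' x y) -> pairings r A = pairings r' A.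
Proof.
move=> rr'; apply/setP => M; rewrite !mem_pairings; case pM: (partition M A) => //=.
apply: eq_forallb => e; case eM: (e \in M) => //=.
apply: eq_existsb => x; apply: eq_existsb => y.
case: (e =P [set x; y]) => [ee|]; rewrite ?andbF ?andbT //.
have /subsetP eA := partitionS pM eM.
by rewrite rr' // eA // ee ?set21 ?set22.
Qed.

Section GraphSums.
Variables d n : nat.
Notation N := n.+1.
Notation P := {mpoly rat[(N * N)%N]}.
Notation H j := (halfedge d.+1 j).
Notation colouring j := {ffun 'I_j -> {ffun 'I_d.+1 -> 'I_N}}.

Definition loop_mono (x : {ffun 'I_d.+1 -> 'I_N}) : P := \prod_i Xmx n (x i) (x (ordS i)).

Lemma sum_loop_mono : \sum_x loop_mono x = \tr (Xmx n ^+ d.+1).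
Proof. by rewrite trace_expS. Qed.

Definition cell j (S : {set 'I_j}) : {set H j} := [set h | h.1 \in S].

Lemma card_pairings_cell j (c : colouring j) (S : {set 'I_j}) :
  #|pairings (wick_compat c) (cell S)|%:R = gauss (@transp n) (\prod_(v in S) loop_mono (c v)).
Proof.
pose f (h : H j) : 'I_(N * N) := mxvec_index (colour c h) (colour c (rotate h)).
rewrite (@eq_in_pairings _ _ (fun x y => f y == transp (f x))); last first.
  by move=> x y _ _; rewrite /f transpE mxvec_index_inj.
rewrite -(wick (@transpK n)); congr gauss.
rewrite (eq_bigl (fun h : H j => (h.1 \in S) && true)); last by move=> h; rewrite inE andbT.
rewrite -(pair_big_dep (fun v => v \in S) (fun _ _ => true) (fun v i => 'X_(f (v, i)))) /=.
by apply: eq_bigr => v _; apply: eq_bigr => i _; rewrite mxE.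
Qed.

Lemma cellT j : cell [set: 'I_j] = setT.
Proof. by apply/setP => h; rewrite !inE. Qed.

Lemma sum_expn_faces j :
  (\sum_(M : {set {set H j}} | perfect_matching M) N ^ nb_faces M)%N%:R =
  gue_moment n (nseq j d.+1).
Proof.
have -> : (\sum_(M : {set {set H j}} | perfect_matching M) N ^ nb_faces M =
   \sum_(M in pairings (fun _ _ => true) [set: H j]) N ^ nb_faces M)%N.
  by apply: eq_bigl => M; rewrite perfect_matchingE.
rewrite sum_pairings_expn // natr_sum.
under eq_bigr => c _ do rewrite -cellT card_pairings_cell.
rewrite -raddf_sum /= /gue_moment big_nseq iter_mulr_1; congr gauss.
rewrite -sum_loop_mono -[j in _ ^+ j]card_ord -prodr_const bigA_distr_bigA.
by apply: eq_bigr => c _; apply: eq_bigl => v; rewrite inE.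
Qed.

Definition isolates j (v : 'I_j) : rel (H j) := fun x y => (x.1 == v) == (y.1 == v).

Lemma isolates_sym j (v : 'I_j) : ssrbool.symmetric (isolates v).
Proof. by move=> x y; rewrite /isolates eq_sym. Qed.

(** For a fixed colouring no allowed pair joins v to another vertex, so the Wick sum factors;
    summing over colourings gives a product of moments. *)
Lemma sum_expn_faces_isolated j (v : 'I_j.+1) :
  (\sum_(M in pairings (isolates v) [set: H j.+1]) N ^ nb_faces M)%N%:R =
  gue_moment n (nseq 1 d.+1) * gue_moment n (nseq j d.+1).
Proof.
rewrite sum_pairings_expn; last exact: isolates_sym.
rewrite natr_sum.
transitivity (\sum_(c : colouring j.+1)
    gauss (@transp n) (loop_mono (c v)) * gauss (@transp n) (\prod_(w < j) loop_mono (c (lift v w)))).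
  apply: eq_bigr => c _.
  set r := (fun x y => _); have sr : ssrbool.symmetric r.
    by move=> x y; rewrite /r isolates_sym wick_compat_sym.
  have e : [set: H j.+1] = cell [set v] :|: cell (~: [set v]).
    by apply/setP => h; rewrite !inE orbN.
  rewrite e pairings_disjointU //; last 2 first.
  - by rewrite disjoints_subset; apply/subsetP => h; rewrite !inE negbK.
  - by move=> x y; rewrite !inE /r /isolates => -> /negbTE ->.
  rewrite natrM; congr (_ * _).
    rewrite (@eq_in_pairings _ _ (wick_compat c)) ?card_pairings_cell ?big_set1 //.
    by move=> x y; rewrite !inE /r /isolates => -> ->.
  rewrite (@eq_in_pairings _ _ (wick_compat c)) ?card_pairings_cell.
    congr gauss; rewrite big_mkcond (big_ord_insert v) /= !inE eqxx mul1r.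
    by apply: eq_bigr => w _; rewrite !inE eq_sym neq_lift.
  by move=> x y; rewrite !inE /r /isolates => /negbTE -> /negbTE ->.
rewrite (sum_ffun_insert v) /gue_moment !big_nseq !iter_mulr_1 expr1.
rewrite -[j in X in _ = _ * X]card_ord -prodr_const -sum_loop_mono bigA_distr_bigA !raddf_sum /=.
rewrite mulr_suml; apply: eq_bigr => x _; rewrite mulr_sumr; apply: eq_bigr => c _.
rewrite ffun_insert_hd; congr (_ * gauss _ _); apply: eq_big => // w _.
by rewrite ffun_insert_lift.
Qed.

Definition same_vertex j : rel (H j) := fun x y => x.1 == y.1.

Lemma sum_expn_faces_loops j :
  (\sum_(M in pairings (@same_vertex j) [set: H j]) N ^ nb_faces M)%N%:R =
  gue_moment n (nseq 1 d.+1) ^+ j.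
Proof.
rewrite sum_pairings_expn; last by move=> x y; exact: eq_sym.
rewrite natr_sum.
transitivity (\sum_(c : colouring j) \prod_v gauss (@transp n) (loop_mono (c v))).
  apply: eq_bigr => c _.
  set r := (fun x y => _); have sr : ssrbool.symmetric r.
    by move=> x y; rewrite /r wick_compat_sym /same_vertex eq_sym.
  rewrite -cellT.
  suff h (S : {set 'I_j}) : #|pairings r (cell S)|%:R =
      \prod_(v in S) gauss (@transp n) (loop_mono (c v)).
    by rewrite h; apply: eq_bigl => v; rewrite inE.
  have [k] := ubnP #|S|; elim: k S => // k IH S Sk.
  have [->|/set0Pn[v vS]] := eqVneq S set0.
    rewrite big_set0 (_ : cell set0 = set0) ?pairings_set0 ?cards1 //.
    by apply/setP => h; rewrite !inE.
  have -> : cell S = cell [set v] :|: cell (S :\ v).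
    by apply/setP => h; rewrite !inE; case: eqP => // ->.
  rewrite pairings_disjointU //; last 2 first.
  - by rewrite disjoints_subset; apply/subsetP => h; rewrite !inE => ->.
  - move=> x y; rewrite !inE /r /same_vertex => /eqP -> /andP[].
    by rewrite eq_sym => /negbTE ->.
  rewrite natrM (IH (S :\ v)); last by rewrite (leq_trans (proper_card (properD1 vS))).
  rewrite [RHS](big_setD1 v) //=; congr (_ * _).
  rewrite (@eq_in_pairings _ _ (wick_compat c)) ?card_pairings_cell ?big_set1 //.
  by move=> x y; rewrite !inE /r /same_vertex => /eqP -> /eqP ->; rewrite eqxx.
rewrite -(bigA_distr_bigA (fun (v : 'I_j) x => gauss (@transp n) (loop_mono x))) /= prodr_const card_ord.
by rewrite -raddf_sum /= sum_loop_mono /gue_moment big_seq1.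
Qed.
End GraphSums.

(** * Connectivity for at most three vertices *)

Section Connectivity.
Variables d j : nat.
Notation H := (halfedge d.+1 j).
Implicit Types M : {set {set H}}.

Lemma isolates_mateP M v : perfect_matching M ->
  reflect (forall h, (h.1 == v) = ((mate M h).1 == v)) (M \in pairings (isolates v) [set: H]).
Proof.
move=> pM; apply: (iffP (pairings_mateP (isolates_sym v) pM)) => h x; have := h x.
  by rewrite /isolates => /eqP.
by rewrite /isolates => ->.
Qed.

Lemma connected_not_isolated M v : perfect_matching M -> (1 < j)%N ->
  connected_graph M -> M \notin pairings (isolates v) [set: H].
Proof.
move=> pM j1 cM; apply/(isolates_mateP v pM) => iso.
have [w wv] : exists w : 'I_j, w != v.
  have h0 : (0 < j)%N by exact: ltnW.
  case: (eqVneq (val v) 0%N) => v0.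
    by exists (Ordinal j1); rewrite -val_eqE /= v0.
  by exists (Ordinal h0); rewrite -val_eqE /= eq_sym.
have cl : closed (adjacent M) (pred1 v).
  by move=> x y /existsP[h /andP[/eqP <- /eqP <-]]; rewrite !inE iso.
have := closed_connect cl (forallP (forallP cM v) w).
by rewrite !inE eqxx (negbTE wv).
Qed.

(** If v and w were not connected, each would still have a neighbour other than itself, which could
    only be the single remaining vertex. *)
Lemma not_isolated_connected M : perfect_matching M -> (j <= 3)%N ->
  (forall v, M \notin pairings (isolates v) [set: H]) -> connected_graph M.
Proof.
move=> pM j3 niso.
have adj_sym : ssrbool.symmetric (adjacent M).
  move=> x y; apply/existsP/existsP => -[h /andP[hx hy]];
    by exists (mate M h); rewrite mateK // hx hy.
have nbr v : exists2 a, a != v & adjacent M v a.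
  have /existsP[h] : [exists h, (h.1 == v) != ((mate M h).1 == v)].
    apply: contraR (niso v) => /existsPn nh; apply/(isolates_mateP v pM) => h.
    by have := nh h; rewrite negbK => /eqP.
  case: (eqVneq h.1 v) => [hv|hv] nm.
    exists (mate M h).1; first by move: nm; case: eqVneq.
    by apply/existsP; exists h; rewrite hv !eqxx.
  exists h.1 => //; rewrite adj_sym; apply/existsP; exists h; rewrite eqxx /=.
  by move: nm; case: (_ == v).
apply/forallP => v; apply/forallP => w; apply/negPn/negP => nc.
have cs : connect_sym (adjacent M) by apply: sym_connect_sym.
have vw : v != w by apply: contraNneq nc => ->; exact: connect0.
have [a av va] := nbr v; have [b bw wb] := nbr w.
have aw : a != w by apply: contraNneq nc => <-; exact: connect1.
have bv : b != v by apply: contraNneq nc => <-; rewrite cs; exact: connect1.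
have ab : a = b.
  apply/val_inj; move: (ltn_ord a) (ltn_ord b) (ltn_ord v) (ltn_ord w) av bw aw bv vw.
  by rewrite -!val_eqE /=; lia.
case/negP: nc; apply: connect_trans (connect1 va) _.
by rewrite ab cs connect1.
Qed.

Lemma two_isolated M v w : perfect_matching M -> (j <= 3)%N -> v != w ->
  M \in pairings (isolates v) [set: H] -> M \in pairings (isolates w) [set: H] ->
  M \in pairings (@same_vertex d j) [set: H].
Proof.
move=> pM j3 vw /(isolates_mateP v pM) iv /(isolates_mateP w pM) iw.
apply/pairings_mateP => // [x y|h]; first exact: eq_sym.
have := iv h; have := iw h; rewrite /same_vertex -!val_eqE /=.
move: (ltn_ord h.1) (ltn_ord (mate M h).1) (ltn_ord v) (ltn_ord w) vw; rewrite -val_eqE /=; lia.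
Qed.

Lemma same_vertex_isolated M v : M \in pairings (@same_vertex d j) [set: H] ->
  M \in pairings (isolates v) [set: H].
Proof.
move=> Ms; have pM := pairings_perfect Ms.
have sv : ssrbool.symmetric (@same_vertex d j) by move=> x y; exact: eq_sym.
by apply/(isolates_mateP v pM) => h; rewrite (eqP (pairings_mateP sv pM Ms h)).
Qed.
End Connectivity.

Lemma third_cumulant (C T L : nat) (I : 'I_3 -> nat) (e1 e2 e3 : rat) :
  (C + \sum_(v < 3) I v = T + 2 * L)%N -> T%:R = e3 -> L%:R = e1 ^+ 3 ->
  (forall v, (I v)%:R = e1 * e2) -> C%:R = e3 - 3 * e1 * e2 + 2 * e1 ^+ 3.
Proof.
move=> e <- <- eI; have /eqP := congr1 (fun x : nat => x%:R : rat) e.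
rewrite natrD [in X in _ == X]natrD natrM natr_sum (eq_bigr (fun=> e1 * e2)) //.
by rewrite sumr_const card_ord -subr_eq => /eqP <-; rewrite -mulr_natl; ring.
Qed.

Section ConnectedSums.
Variables d n : nat.
Notation N := n.+1.
Notation E b := (gue_moment n (nseq b d.+1)).
Notation connected_sum j := (\sum_(M : {set {set halfedge d.+1 j}} |
  perfect_matching M && connected_graph M) N ^ nb_faces M)%N.

Lemma connected_sum1 : (connected_sum 1)%:R = E 1.
Proof.
rewrite -sum_expn_faces; congr (_%:R); apply: eq_bigl => M; case: perfect_matching => //=.
by apply/forallP => v; apply/forallP => w; rewrite (ord1 v) (ord1 w) connect0.
Qed.

Lemma big_pairings j (r : rel (halfedge d.+1 j)) (f : {set {set halfedge d.+1 j}} -> nat) :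
  (\sum_(M in pairings r [set: halfedge d.+1 j]) f M =
   \sum_(M : {set {set halfedge d.+1 j}} | perfect_matching M)
     (M \in pairings r [set: halfedge d.+1 j]) * f M)%N.
Proof.
rewrite big_mkcond [RHS]big_mkcond /=; apply: eq_bigr => M _.
have imp := @pairings_perfect d.+1 j M r.
by move: imp; case: (M \in _) => [/(_ isT) ->|_]; rewrite ?mul1n // mul0n; case: ifP.
Qed.

Lemma big_connected j : connected_sum j =
  (\sum_(M : {set {set halfedge d.+1 j}} | perfect_matching M) connected_graph M * N ^ nb_faces M)%N.
Proof. by rewrite big_mkcondr; apply: eq_bigr => M _; case: connected_graph; rewrite ?mul1n. Qed.

Lemma connected_sum2 : (connected_sum 2)%:R = E 2 - E 1 ^+ 2.
Proof.
rewrite -(sum_expn_faces d n 2) expr2 -(sum_expn_faces_isolated d n (ord0 : 'I_2)).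
apply/eqP; rewrite eq_sym subr_eq -natrD eqr_nat; apply/eqP.
rewrite big_pairings big_connected -big_split /=; apply: eq_bigr => M pM.
case cM: (connected_graph M).
  by rewrite (negbTE (connected_not_isolated ord0 pM isT cM)) mul0n addn0 mul1n.
rewrite mul0n add0n.
suff -> : M \in pairings (isolates (ord0 : 'I_2)) [set: halfedge d.+1 2] by rewrite mul1n.
apply/negPn/negP => n0; suff : connected_graph M by rewrite cM.
apply: (not_isolated_connected pM isT) => v; apply/negP => /(isolates_mateP v pM) iv.
move/negP: n0 => n0; apply: n0; apply/(isolates_mateP ord0 pM) => h.
(* With two vertices, isolating either one isolates both. *)
have ord2 (a b c : 'I_2) : (a == c) = (b == c) -> (a == ord0) = (b == ord0).
  by case: a b c => [[|[|//]] ?] [[|[|//]] ?] [[|[|//]] ?].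
exact: ord2 (iv h).
Qed.

Lemma connected_sum3 : (connected_sum 3)%:R = E 3 - 3 * E 1 * E 2 + 2 * E 1 ^+ 3.
Proof.
pose iso M (v : 'I_3) := M \in pairings (isolates v) [set: halfedge d.+1 3].
pose loops M := M \in pairings (@same_vertex d 3) [set: halfedge d.+1 3].
(* The three cases are connected (1 + 0 = 1 + 0), exactly one isolated vertex (0 + 1 = 1 + 0) and no
   edge between vertices (0 + 3 = 1 + 2); two isolated vertices force the third. *)
have count M : perfect_matching M ->
    (connected_graph M + \sum_(v < 3) iso M v = 1 + 2 * loops M)%N.
  move=> pM; have nl v : ~~ iso M v -> loops M = false.
    by move=> niv; apply/negbTE; apply: contra niv; exact: same_vertex_isolated.
  have [cM|cM] := boolP (connected_graph M).
    have nv v : iso M v = false by apply/negbTE/connected_not_isolated.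
    by rewrite (nl ord0) ?nv // big1 // => v _; rewrite nv.
  have [v iv] : exists v, iso M v.
    apply/existsP; apply: contraR cM => /existsPn nv; exact: not_isolated_connected.
  rewrite (bigD1 v) //= iv.
  have [lM|lM] := boolP (loops M).
    rewrite (eq_bigr (fun=> 1%N)) => [|w _]; last by rewrite /iso same_vertex_isolated.
    by rewrite sum1_card cardC1 card_ord.
  rewrite big1 // => w wv; apply/eqP; rewrite eqb0; apply: contra lM => iw.
  exact: (two_isolated pM isT wv iw iv).
have e : (connected_sum 3 + \sum_(v < 3) \sum_(M in pairings (isolates v) [set: halfedge d.+1 3]) N ^ nb_faces M =
   \sum_(M : {set {set halfedge d.+1 3}} | perfect_matching M) N ^ nb_faces M +
   2 * \sum_(M in pairings (@same_vertex d 3) [set: halfedge d.+1 3]) N ^ nb_faces M)%N.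
  under [X in (_ + X)%N]eq_bigr => v _ do rewrite big_pairings.
  rewrite [X in (_ + 2 * X)%N]big_pairings big_connected exchange_big /= big_distrr -!big_split /=.
  by apply: eq_bigr => M pM; rewrite -big_distrl /= -mulnDl (count M pM) mulnDl mul1n mulnA.
apply: (third_cumulant e).
- exact: (sum_expn_faces d n 3).
- exact: (sum_expn_faces_loops d n 3).
- by move=> v; exact: (sum_expn_faces_isolated d n v).
Qed.
End ConnectedSums.

(** * Euler characteristic *)

Lemma fcard_porbits (T : finType) (s : {perm T}) : fcard s predT = #|porbits s|.
Proof.
have fcE x y : fconnect s x y = (y \in porbit s x).
  apply/idP/porbitP => [/iter_findex <-|[i ->]]; first by exists (findex s x y); rewrite permX.
  by rewrite permX fconnect_iter.
have cs := fconnect_sym (@perm_inj _ s).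
have -> : porbits s = porbit s @: [set x | froots s x].
  apply/setP => O; apply/imsetP/imsetP => [[x _ ->]|[x _ ->]]; last by exists x.
  exists (froot s x); first by rewrite inE roots_root.
  by apply/eqP; rewrite eq_porbit_mem -fcE cs connect_root.
rewrite card_in_imset => [|x y].
  by apply: eq_card => x; rewrite !inE andbT.
rewrite !inE => /eqP rx /eqP ry /eqP; rewrite eq_porbit_mem -fcE.
by rewrite -(root_connect cs) => /eqP; rewrite rx ry.
Qed.

Section EulerCharacteristic.
Variables d j : nat.
Notation H := (halfedge d.+1 j).

Definition rotate_perm : {perm H} := perm (@rotate_inj d.+1 j).

Lemma card_porbits_rotate : #|porbits rotate_perm| = j.
Proof.
have orb v (i : 'I_d.+1) : (v, i) \in porbit rotate_perm (v, ord0).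
  case: i => i; elim: i => [|i IH] hi.
    by rewrite (_ : Ordinal hi = ord0) ?porbit_id //; exact: val_inj.
  have /porbitP[k e] := IH (ltnW hi); apply/porbitP; exists k.+1.
  rewrite expgSr permM -e permE /rotate; congr (_, _).
  by apply: val_inj; rewrite /= modn_small.
have fst_porbit x y : y \in porbit rotate_perm x -> y.1 = x.1.
  by case/porbitP=> k ->; elim: k => [|k IH]; rewrite ?expg0 ?perm1 // expgSr permM permE.
have -> : porbits rotate_perm = (fun v : 'I_j => porbit rotate_perm (v, ord0)) @: setT.
  apply/setP => O; apply/imsetP/imsetP => [[[v i] _ ->]|[v _ ->]]; last by exists (v, ord0).
  by exists v => //; apply/eqP; rewrite eq_porbit_mem.
rewrite card_imset ?cardsT ?card_ord // => v w /eqP.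
by rewrite eq_porbit_mem => /fst_porbit.
Qed.

Variable m : H -> H.
Hypothesis m_neq : forall h, m h != h.

(** Face permutation of the graph with only the edges of s glued in; with no edge it is the
    rotation, with one cycle per vertex. *)
Definition glue (s : seq H) : {perm H} :=
  foldr (fun h p => (tperm h (m h) * p)%g) rotate_perm s.

(** V - E + F is at most twice the number of components, and even, by induction on the edges. The
    labels, constant along edges and faces, stand in for components. *)
Lemma glue_euler s : exists lab : {ffun 'I_j -> 'I_j},
  [/\ forall x, lab (glue s x).1 = lab x.1,
      forall h, h \in s -> lab h.1 = lab (m h).1,
      (#|porbits (glue s)| + 2 * j <= j + size s + 2 * #|codom lab|)%N &
      odd (#|porbits (glue s)| + j + size s) = false].
Proof.
elim: s => [|a s [lab [labP lab_s le par]]].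
  exists [ffun v => v]; split=> // [x||].
  - by rewrite /= permE !ffunE.
  - rewrite card_porbits_rotate /= addn0 leq_add2l leq_mul2l /=.
    rewrite card_codom ?card_ord // => x y; by rewrite !ffunE.
  - by rewrite card_porbits_rotate /= addn0 oddD addbb.
have := porbits_mul_tperm (glue s) a (m a); rewrite /= eq_sym m_neq.
have lab_orb x y : y \in porbit (glue s) x -> lab y.1 = lab x.1.
  by case/porbitP=> k ->; elim: k => [|k IH]; rewrite ?expg0 ?perm1 // expgSr permM labP.
set p' := #|porbits _|; set p := #|porbits (glue s)| in le par *.
set b := a \notin _; rewrite addn1 => pe.
have par' : odd (p' + j + (size s).+1) = false.
  move: par (congr1 odd pe); rewrite !oddD odd_double /=;
    case: (odd p); case: (odd p'); case: (odd j); case: (odd (size s)); done.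
(* With equal labels, the transposition adds at most one cycle. With different labels the two
   half-edges lie in different cycles, which merge, and the labels are merged as well. *)
have [e|ne] := eqVneq (lab a.1) (lab (m a).1).
  exists lab; split=> //.
  - move=> x; rewrite permM labP; case: tpermP => [->|->|//]; by rewrite e.
  - by move=> h; rewrite inE => /orP[/eqP ->|/lab_s].
  - have p'p : (p' <= p.+1)%N by rewrite -pe leq_addr.
    move: (p) (p') (#|codom lab|) (size s) p'p le => x x' y z. lia.
have bT : b by apply/negP => /lab_orb e; rewrite e eqxx in ne.
pose lab' := [ffun v => if lab v == lab a.1 then lab (m a).1 else lab v].
exists lab'; split=> //.
- move=> x; rewrite permM !ffunE labP; case: tpermP => [->|->|//].
    by rewrite eqxx eq_sym (negbTE ne).
  by rewrite eqxx eq_sym (negbTE ne).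
- move=> h; rewrite inE => /orP[/eqP ->|/lab_s e]; rewrite !ffunE; last by rewrite e.
  by rewrite eqxx eq_sym (negbTE ne).
- have cc : (#|codom lab| <= #|codom lab'|.+1)%N.
    rewrite (cardD1 (lab a.1)) -[#|codom lab'|.+1]add1n; apply: leq_add; first exact: leq_b1.
    apply: subset_leq_card; apply/subsetP => y; rewrite !inE => /andP[ny /codomP[v ev]].
    by apply/codomP; exists v; rewrite ffunE -ev (negbTE ny).
  have {}pe : (p' + 2)%N = p.+1 by rewrite -pe bT.
  by move: (p) (p') (#|codom lab|) (#|codom lab'|) (size s) pe le cc => x x' y y' z; lia.
Qed.
End EulerCharacteristic.

Section GenusBound.
Variables d j : nat.
Notation H := (halfedge d.+1 j).
Implicit Type M : {set {set H}}.

(** Selects one end of each edge, so that every transposition is glued in once. *)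
Definition low_ends M : {set H} := [set h | enum_rank h < enum_rank (mate M h)]%N.

Lemma mem_low_ends M h : perfect_matching M -> (mate M h \in low_ends M) = (h \notin low_ends M).
Proof.
move=> pM; rewrite !inE mateK // -leqNgt [in RHS]leq_eqVlt.
by rewrite (inj_eq (@ord_inj _)) (inj_eq enum_rank_inj) (negbTE (mate_neq h pM)).
Qed.

Lemma card_matching M : perfect_matching M -> (2 * #|M| = j * d.+1)%N.
Proof.
case/andP=> pM /forall_inP cM; have := card_uniform_partition (fun e eM => eqP (cM e eM)) pM.
by rewrite cardsT card_prod !card_ord => ->; rewrite mulnC.
Qed.

Lemma card_low_ends M : perfect_matching M -> #|low_ends M| = #|M|.
Proof.
move=> pM; apply: (@double_inj); rewrite -!mul2n card_matching // mul2n -addnn.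
have -> : (j * d.+1)%N = #|H| by rewrite card_prod !card_ord.
rewrite -(cardsC (low_ends M)); congr (_ + _)%N.
rewrite -(card_imset _ (inv_inj (mateK pM))); apply: eq_card => h.
apply/imsetP/idP => [[x xl ->]|]; first by rewrite inE mem_low_ends // negbK.
rewrite inE -mem_low_ends // => hl; exists (mate M h) => //.
by rewrite mateK.
Qed.

Lemma glue_face_step M : perfect_matching M -> glue (mate M) (enum (low_ends M)) =1 face_step M.
Proof.
move=> pM.
suff h (s : seq H) x : uniq s -> {subset s <= low_ends M} ->
    glue (mate M) s x = rotate (if (x \in s) || (mate M x \in s) then mate M x else x).
  move=> x; rewrite h ?enum_uniq => [|//|y]; last by rewrite mem_enum.
  by rewrite !mem_enum mem_low_ends // orbN.
elim: s x => [|a s IH] x; first by rewrite /= permE.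
case/andP=> na us sub; have al : a \in low_ends M by apply: sub; rewrite mem_head.
have subs : {subset s <= low_ends M} by move=> y ys; apply: sub; rewrite inE ys orbT.
have mas : mate M a \notin s.
  by apply/negP => /subs; rewrite mem_low_ends // al.
rewrite /= permM IH //; case: tpermP => [->|->|/eqP xa /eqP xm].
- by rewrite mateK // (negbTE mas) (negbTE na) mem_head.
- by rewrite mateK // (negbTE mas) (negbTE na) !inE eqxx orbT.
have xm' : mate M x != a by apply: contraNneq xm => <-; rewrite mateK.
by rewrite !inE (negbTE xa) (negbTE xm').
Qed.

Theorem euler_bound M : perfect_matching M -> connected_graph M ->
  (nb_faces M + j <= #|M| + 2)%N /\ odd (nb_faces M + j + #|M|) = false.
Proof.
move=> pM cM; have [lab [_ lab_s le par]] := glue_euler (fun h => mate_neq h pM) (enum (low_ends M)).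
have nf : nb_faces M = #|porbits (glue (mate M) (enum (low_ends M)))|.
  by rewrite -fcard_porbits; apply: eq_fcard => x; rewrite glue_face_step.
rewrite -cardE card_low_ends // -nf in le par; split=> //.
(* Connectivity leaves a single label. *)
suff : (#|codom lab| <= 1)%N by lia.
have lab_adj v w : adjacent M v w -> lab v = lab w.
  case/existsP=> h /andP[/eqP <- /eqP <-].
  have [hl|hl] := boolP (h \in low_ends M); first by apply: lab_s; rewrite mem_enum.
  rewrite -[h in LHS](mateK pM); apply/esym/lab_s.
  by rewrite mem_enum mem_low_ends.
have lab_conn v w : lab v = lab w.
  have /connectP[p pp ->] := forallP (forallP cM v) w.
  by elim: p v pp => //= u p IH v /andP[/lab_adj -> /IH].
apply/card_le1_eqP => x y /codomP[v ->] /codomP[w ->]; exact: lab_conn.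
Qed.
End GenusBound.

(** * Face polynomials *)

Lemma coulomb_moment_neq0 N : coulomb_moment N [::] != 0.
Proof.
have := partition_poly0_neq0 0 N; rewrite coef_partition_poly //.
by rewrite fact0 invr1 mul1r.
Qed.

Lemma gue_raw_moment d n b : gue_raw d n.+1 b = gue_moment n (nseq b d).
Proof. by rewrite /gue_raw gue_coulomb mulrC mulKf // coulomb_moment_neq0. Qed.

Section FacePolynomial.
Variables d j : nat.
Notation H := (halfedge d.+1 j).
Implicit Type M : {set {set H}}.

Definition face_poly : {poly rat} :=
  \sum_(M : {set {set H}} | perfect_matching M && connected_graph M) 'X^(nb_faces M).

Lemma face_poly_gue n : (1 <= j <= 3)%N -> face_poly.[n.+1%:R] = gue_cumulant d.+1 j n.+1.
Proof.
move=> j13; have -> : face_poly.[n.+1%:R] =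
    (\sum_(M : {set {set H}} | perfect_matching M && connected_graph M) n.+1 ^ nb_faces M)%N%:R.
  rewrite horner_sum natr_sum; apply: eq_bigr => M _.
  by rewrite hornerXn natrX.
rewrite /gue_cumulant.
by move: j13; rewrite /face_poly; case: j => [|[|[|[|]]]] // _;
  rewrite ?connected_sum1 ?connected_sum2 ?connected_sum3 !gue_raw_moment.
Qed.

Lemma nb_faces_gt0 M : (0 < j)%N -> perfect_matching M -> (0 < nb_faces M)%N.
Proof.
move=> j0 pM; apply/card_gt0P; pose h : H := (Ordinal j0, ord0).
exists (froot (face_step M) h).
by rewrite !inE roots_root //; apply: fconnect_sym; exact: face_step_inj.
Qed.

Variable nu : nat.
Hypotheses (j_gt0 : (0 < j)%N) (d_nu : d.+1 = (2 * nu)%N).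
(** The number of faces of a planar connected graph, which has j nu edges; each unit of genus
    removes two faces. *)
Definition top_degree : nat := (j * nu + 2 - j)%N.

Definition genus_poly : {poly rat} :=
  \sum_(M : {set {set H}} | perfect_matching M && connected_graph M)
    'X^((top_degree - nb_faces M)./2).

Lemma genus_spec M : perfect_matching M -> connected_graph M ->
  exists2 t, (nb_faces M + 2 * t = top_degree)%N & forall g, has_genus M g = (g == t).
Proof.
move=> pM cM; have [le par] := euler_bound pM cM.
have cardM : #|M| = (j * nu)%N.
  by apply/eqP; rewrite -(eqn_pmul2l (isT : 0 < 2)%N) card_matching // d_nu mulnCA.
rewrite cardM in le par; set t := ((top_degree - nb_faces M)./2)%N.
have e : (nb_faces M + 2 * t = top_degree)%N.
  have ev : odd (top_degree - nb_faces M) = false.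
    rewrite /top_degree; have -> : (j * nu + 2 - j - nb_faces M = j * nu + 2 - (nb_faces M + j))%N by lia.
    rewrite oddB // oddD /= addbF; move: par; rewrite !oddD.
    by case: (odd (nb_faces M)); case: (odd j); case: (odd (j * nu)).
  have := odd_double_half (top_degree - nb_faces M); rewrite ev add0n -mul2n -/t => ->.
  by rewrite subnKC // /top_degree; lia.
exists t => // g; rewrite /has_genus cardM.
have -> : (j%:Z - (j * nu)%N%:Z + (nb_faces M)%:Z = 2 - 2 * t%:Z)%R.
  by move: e le; rewrite /top_degree; move: (j * nu)%N (nb_faces M) => x y; lia.
by apply/eqP/eqP; lia.
Qed.

Lemma coef_genus_poly g : genus_poly`_g = (nb_graphs g d.+1 j)%:R.
Proof.
rewrite /genus_poly coef_sum /nb_graphs -sum1_card natr_sum big_mkcond [RHS]big_mkcond /=.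
apply: eq_bigr => M _; rewrite inE andbA; case: ifP => //= /andP[pM cM].
have [t e hg] := genus_spec pM cM; rewrite hg coefXn.
have -> : ((top_degree - nb_faces M)./2 = t)%N by rewrite -e addKn mul2n doubleK.
by case: eqP.
Qed.

Lemma face_genus_poly x : x != 0 -> face_poly.[x] = x ^+ top_degree * genus_poly.[x ^- 2].
Proof.
move=> x0; rewrite /face_poly /genus_poly !horner_sum mulr_sumr; apply: eq_bigr => M /andP[pM cM].
have [t e _] := genus_spec pM cM; rewrite !hornerXn.
have -> : ((top_degree - nb_faces M)./2 = t)%N by rewrite -e addKn mul2n doubleK.
by rewrite -e exprD exprM -mulrA -exprMn mulfV ?expr1n ?mulr1 // expf_neq0.
Qed.

Lemma genus_poly_support g : genus_poly`_g != 0 -> (2 * g < top_degree)%N.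
Proof.
rewrite coef_genus_poly pnatr_eq0 -lt0n card_gt0 => /set0Pn[M].
rewrite inE => /and3P[pM cM]; have [t e hg] := genus_spec pM cM.
by rewrite hg => /eqP ->; rewrite -e -{1}[(2 * t)%N]add0n ltn_add2r nb_faces_gt0.
Qed.

Lemma face_poly0 : face_poly.[0] = 0.
Proof.
rewrite /face_poly horner_sum big1 // => M /andP[pM _].
by rewrite hornerXn expr0n eqn0Ngt nb_faces_gt0.
Qed.
End FacePolynomial.

(** The integers start at 2 because the flow at x involves x - 1, which must be the size of a
    nonempty matrix. *)
Lemma poly_eq_natr (p q : {poly rat}) :
  (forall n, p.[n.+2%:R] = q.[n.+2%:R]) -> p = q.
Proof.
move=> e; apply/eqP; rewrite -subr_eq0; apply/negPn/negP => nz.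
pose s := [seq (k.+2%:R : rat) | k <- iota 0 (size (p - q))].
have us : uniq s.
  by rewrite map_inj_uniq ?iota_uniq // => a b /eqP; rewrite eqr_nat => /eqP [].
have rs : all (root (p - q)) s.
  by apply/allP => _ /mapP[k _ ->]; rewrite /root hornerD hornerN e subrr.
by have := max_poly_roots nz rs us; rewrite size_map size_iota ltnn.
Qed.

(** * The flow as a polynomial identity *)

Section FlowPolynomial.
Variable nu : nat.
Hypothesis nu_gt0 : (0 < nu)%N.
Notation d := (2 * nu).-1.
Notation f j := (fun x => (face_poly d j).[x]).

Definition central2 (h : rat -> rat) (x : rat) := h (x + 1) - 2 * h x + h (x - 1).
Definition flow_term (h : nat -> rat -> rat) j x : rat :=
  let g i := central2 (h i) x in
  match j with
  | 1%N => g 1%N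
  | 2%N => g 2%N + g 1%N * g 1%N
  | _ => g 3%N + 3 * (g 1%N * g 2%N) + g 1%N * (g 1%N * g 1%N)
  end.

Lemma dE : d.+1 = (2 * nu)%N. Proof. by lia. Qed.

Lemma face_poly_flow j x : (1 <= j <= 3)%N ->
  j%:R * (2 * nu%:R) * ((face_poly d j).[x + 1] - (face_poly d j).[x]) =
  (x + 1) * flow_term (fun i => f i) j (x + 1) + x * flow_term (fun i => f i) j x.
Proof.
move=> j13.
have [sh shE] : exists sh : {poly rat} -> {poly rat}, forall p y, (sh p).[y] = p.[y + 1].
  by exists (fun p => p \Po ('X + 1)) => p y; rewrite horner_comp !hornerE.
have [G GE] : exists G : nat -> {poly rat}, forall i y, (G i).[y] = central2 (fun x => (face_poly d i).[x]) y.
  exists (fun i => sh (face_poly d i) - 2 * face_poly d i + (face_poly d i \Po ('X - 1))) => i y.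
  by rewrite /central2 /= !(hornerD, hornerN, hornerM) horner_comp shE !hornerE.
have [K KE] : exists K : {poly rat}, forall y, K.[y] = flow_term (fun i => f i) j y.
  exists (match j with
  | 1%N => G 1%N
  | 2%N => G 2%N + G 1%N * G 1%N
  | _ => G 3%N + 3%:P * (G 1%N * G 2%N) + G 1%N * (G 1%N * G 1%N)
  end) => y.
  by rewrite /flow_term; case: (j) => [|[|[|?]]]; rewrite ?(hornerD, hornerM, hornerC) !GE.
suff e : (j%:R * (2 * nu%:R))%:P * (sh (face_poly d j) - face_poly d j) =
    ('X + 1) * sh K + 'X * K.
  have := congr1 (horner^~ x) e.
  by rewrite !(hornerD, hornerN, hornerM, hornerC, hornerX) !shE !KE ?hornerC.
apply: poly_eq_natr => n.
rewrite !(hornerD, hornerN, hornerM, hornerC, hornerX) !shE !KE ?hornerC.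
have ev : ~~ odd (2 * nu) by rewrite oddM.
have [r1 r2 r3] := gue_cumulant_flow n.+1 ev.
have fE i k : (1 <= i <= 3)%N -> (face_poly d i).[k.+1%:R] = gue_cumulant (2 * nu) i k.+1.
  by move=> i13; rewrite face_poly_gue // dE.
have cE i k : (1 <= i <= 3)%N -> central2 (fun x => (face_poly d i).[x]) k.+2%:R =
    cdiff2 (gue_cumulant (2 * nu) i) k.+1.
  move=> i13; rewrite /central2 /cdiff2 natr1 (_ : k.+2%:R - 1 = k.+1%:R) ?fE //.
  by rewrite -natr1 addrK.
rewrite /flow_term natr1; clear K KE; case: j j13 => [|[|[|[|]]]] // _; rewrite !cE // !fE //.
- by rewrite -(natr1 n.+2) mul1r -natrM r1.
- by rewrite -(natr1 n.+2) -!expr2 -natrM r2.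
- rewrite -(natr1 n.+2) -natrM r3 !mulrA -!expr2 -!exprSr.
  by [].
Qed.

(** Centring at y makes the left side a pure difference and the right side a pure sum of shifts by
    1/2, so that each keeps only one parity of powers. *)
Lemma face_poly_flow_sym j y : (1 <= j <= 3)%N ->
  j%:R * (2 * nu%:R) * ((face_poly d j).[y + 2^-1] - (face_poly d j).[y - 2^-1]) =
  (y + 2^-1) * flow_term (fun i => f i) j (y + 2^-1) +
  (y - 2^-1) * flow_term (fun i => f i) j (y - 2^-1).
Proof.
move=> /(face_poly_flow (y - 2^-1)).
by have -> : y - 2^-1 + 1 = y + 2^-1 by field.
Qed.
End FlowPolynomial.

Lemma coef_comp_XD1 (p : {poly rat}) n : (size p <= n.+2)%N ->
  (p \Po ('X + 1))`_n = n.+1%:R * p`_n.+1 + p`_n.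
Proof.
move=> szp; rewrite comp_polyE coef_sum; set F := fun i => p`_i * 'C(i, n)%:R.
rewrite (eq_bigr (fun i : 'I_(size p) => F i)) => [|i _]; last first.
  rewrite coefZ exprDn coef_sum (eq_bigr (fun k : 'I_i.+1 =>
      'C(i, k)%:R * (n == (i - k)%N)%:R)) => [|k _]; last first.
    by rewrite expr1n mulr1 coefMn coefXn mulr_natl.
  rewrite /F; congr (_ * _).
  have [ni|ni] := leqP n i; last first.
    rewrite bin_small // big1 // => k _; case: eqP => [e2|]; rewrite ?mulr0 //.
    by move: ni; rewrite e2 ltnNge leq_subr.
  have hk : (i - n < i.+1)%N by rewrite ltnS leq_subr.
  rewrite (bigD1 (Ordinal hk)) //= subKn // eqxx mulr1 big1 ?addr0 ?bin_sub // => k.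
  rewrite -val_eqE /= => nk; case: eqP => [e2|]; rewrite ?mulr0 //.
  by move: nk; rewrite e2 subKn ?eqxx // -ltnS.
rewrite (big_ord_widen _ F szp) big_mkcond /=.
rewrite (eq_bigr (fun i : 'I_n.+2 => F i)) => [|i _]; last first.
  by case: ltnP => // /(nth_default 0); rewrite /F => ->; rewrite mul0r.
rewrite !big_ord_recr /= big1 ?add0r => [|i _]; last by rewrite /F bin_small ?mulr0.
by rewrite /F binn mulr1 binSn addrC mulrC.
Qed.

(** * The Harer-Zagier formula and the planar one-vertex count *)

Section LeadingCoefficient.
Variable nu : nat.

(** Its value at n is the coefficient of z^n in (1+z)^nu / (1-z)^(nu+1). *)
Definition hz_poly : {poly rat} :=
  \sum_(i < nu.+1) ((2 ^ i * 'C(nu, i))%N%:R / i`!%:R) *: \prod_(k < i) ('X - k%:R%:P).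

Lemma hz_poly_natr n : hz_poly.[n%:R] = (\sum_(i < nu.+1) 2 ^ i * 'C(nu, i) * 'C(n, i))%N%:R.
Proof.
rewrite /hz_poly horner_sum natr_sum; apply: eq_bigr => i _.
rewrite hornerZ horner_prod [RHS]natrM -mulrA; congr (_ * _).
have -> : \prod_(k < i) ('X - k%:R%:P).[n%:R] = (n ^_ i)%:R :> rat.
  elim: {i}(i : nat) => [|i IH]; first by rewrite big_ord0.
  rewrite big_ord_recr /= IH ffactnSr natrM hornerXsubC.
  have [ni|ni] := leqP i n; first by rewrite natrB.
  by rewrite ffact_small // !mul0r.
by rewrite -bin_ffact natrM mulrC mulfK // pnatr_eq0 -lt0n fact_gt0.
Qed.

Lemma hz_rec n : let w n := (\sum_(i < nu.+1) 2 ^ i * 'C(nu, i) * 'C(n, i))%N%:R : rat in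
  n.+2%:R * w n.+2 = (2 * nu + 1)%:R * w n.+1 + n.+1%:R * w n.
Proof.
move=> w.
have wE m : w m = \sum_(i < nu.+1) (2 ^ i * 'C(nu, i))%:R * 'C(m, i)%:R.
  by rewrite /w natr_sum; apply: eq_bigr => i _; rewrite natrM.
pose b i : rat := (2 ^ i * 'C(nu, i))%:R.
have bS i : i.+1%:R * b i.+1 = 2 * (nu%:R - i%:R) * b i.
  rewrite /b -natrM.
  have -> : (i.+1 * (2 ^ i.+1 * 'C(nu, i.+1)) = 2 * (nu - i) * (2 ^ i * 'C(nu, i)))%N.
    by have := mul_bin_left nu i; rewrite expnS; move: (2 ^ i)%N 'C(nu, i.+1) 'C(nu, i) => x y z; nia.
  have [ni|ni] := leqP i nu; first by rewrite !natrM natrB.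
  by rewrite bin_small // !muln0 mulr0.
(* Both binomials on the right have upper index n+1, so by [bS] the second piece for i+1 cancels the
   first piece for i. *)
have term i : n.+2%:R * 'C(n.+2, i)%:R - (2 * nu + 1)%:R * 'C(n.+1, i)%:R - n.+1%:R * 'C(n, i)%:R =
    - 2 * (nu%:R - i%:R) * 'C(n.+1, i)%:R + i%:R * 'C(n.+1, i.-1)%:R :> rat.
  have e1 : n.+1%:R * 'C(n, i)%:R = (n.+1%:R - i%:R) * 'C(n.+1, i)%:R :> rat.
    have := mul_bin_down n.+1 i; rewrite /= => /(congr1 (fun x : nat => x%:R : rat)).
    rewrite !natrM => ->; have [ni|ni] := leqP i n.+1; first by rewrite natrB.
    by rewrite (bin_small ni) !mulr0.
  have e2 : n.+2%:R * 'C(n.+2, i)%:R = (n.+2%:R + i%:R) * 'C(n.+1, i)%:R + i%:R * 'C(n.+1, i.-1)%:R :> rat.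
    case: i {e1} => [|i] /=; first by rewrite !bin0; ring.
    have := mul_bin_diag n.+2 i; rewrite /= => /(congr1 (fun x : nat => x%:R : rat)).
    rewrite !natrM binS !natrD => e; rewrite mulrDr e; ring.
  by rewrite e1 e2 natrD natrM -!(natr1 n.+1); ring.
apply/eqP; rewrite -subr_eq0 opprD addrA !wE !mulr_sumr -!sumrB; apply/eqP.
rewrite (eq_bigr (fun i : 'I_nu.+1 => - 2 * (nu%:R - i%:R) * b i * 'C(n.+1, i)%:R +
    i%:R * b i * 'C(n.+1, i.-1)%:R)); last first.
  by move=> i _; rewrite -/(b i) !(mulrCA _ (b i)) -!mulrBr term; ring.
rewrite big_split /= big_ord_recr /= subrr mulr0 !mul0r addr0.
rewrite [X in _ + X]big_ord_recl /= !mul0r add0r -big_split big1 //= => i _.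
by rewrite /bump /= add1n bS; ring.
Qed.

Lemma coef_hz_poly : hz_poly`_nu = 2 ^+ nu / nu`!%:R.
Proof.
have szp i : size (\prod_(k < i) ('X - k%:R%:P : {poly rat})) = i.+1.
  by rewrite -(big_mkord xpredT (fun k => 'X - k%:R%:P)) size_prod_XsubC size_iota subn0.
rewrite coef_sum big_ord_recr /= big1 ?add0r => [|i _].
  rewrite coefZ binn muln1 natrX -[X in _ * X]/((\prod_(k < nu) ('X - k%:R%:P : {poly rat}))`_nu).
  have /monicP := monic_prod_XsubC (index_enum 'I_nu) predT (fun k => k%:R : rat).
  by rewrite lead_coefE szp /= => ->; rewrite mulr1.
by rewrite coefZ nth_default ?mulr0 // szp.
Qed.

Hypothesis nu_gt0 : (0 < nu)%N.
Notation p := (face_poly (2 * nu).-1 1).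

Lemma gauss_mom_double k : gauss_mom (2 * k) = (2 * k)`!%:R / (2 ^+ k * k`!%:R).
Proof.
elim: k => [|k IH]; first by [].
rewrite mulnS [gauss_mom _]/= IH !factS !natrM exprS.
have f0 : k`!%:R != 0 :> rat by rewrite pnatr_eq0 -lt0n fact_gt0.
have k0 : k.+1%:R != 0 :> rat by rewrite pnatr_eq0.
have p0 : (2 ^+ k : rat) != 0 by rewrite expf_neq0.
have -> : (2 * k).+2%:R = 2 * k.+1%:R :> rat by rewrite -natrM mulnS.
move: (k.+1%:R : rat) (k`!%:R : rat) (2 ^+ k : rat) k0 f0 p0 => x y z x0 y0 z0.
by field; rewrite x0 y0 z0.
Qed.

(** A matrix of size 1 is a Gaussian number, so all one-vertex matchings are counted with weight
    1. *)
Lemma face_poly1_at1 : p.[1] = gauss_mom (2 * nu).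
Proof.
rewrite (face_poly_gue _ 0) // dE // /gue_cumulant /gue_raw /coulomb_moment !big_cons big_nil.
have -> : vandermonde 1 = 1.
  rewrite /vandermonde big1 // => i _; rewrite big1 // => k.
  by rewrite (ord1 i) (ord1 k).
rewrite expr1n !mulr1 mul1r gauss1 divr1 -[RHS]mulr1.
have := gauss_prodX (fun _ : 'I_1 => (2 * nu)%N); rewrite !big_ord1 mulr1 => <-.
by rewrite /psum big_ord1.
Qed.

(** For one vertex the flow is a linear recursion for first differences, the same as [hz_rec]; the
    value at size 1 fixes the scale. *)
Lemma face_poly1_diff n : p.[n.+1%:R] - p.[n%:R] = gauss_mom (2 * nu) * hz_poly.[n%:R].
Proof.
have flow m : (m.+1%:R : rat) * (p.[m.+2%:R] - p.[m.+1%:R]) =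
   (2 * nu + 1)%:R * (p.[m.+1%:R] - p.[m%:R]) + m%:R * (p.[m%:R] - p.[m%:R - 1]).
  have := @face_poly_flow nu nu_gt0 1 m%:R isT.
  rewrite /flow_term /central2 !natr1 natrD natrM -[m.+2%:R]natr1 => e.
  apply/eqP; rewrite -subr_eq0; move/eqP: e; rewrite -subr_eq0 => /eqP e; apply/eqP.
  rewrite -[RHS]oppr0 -[in RHS]e -[m.+1%:R]natr1; have -> : m%:R + 1 - 1 = m%:R :> rat by rewrite addrK.
  ring.
have h0 : hz_poly.[0] = 1.
  rewrite -[0]/(0%:R) hz_poly_natr big_ord_recl big1 ?addn0 ?bin0 // => i _.
  by rewrite ['C(0, _)]bin_small ?muln0.
have h1 : hz_poly.[1] = (2 * nu + 1)%:R.
  rewrite (_ : hz_poly.[1] = hz_poly.[1%:R]) // hz_poly_natr; congr (_%:R).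
  rewrite big_ord_recl /= addnC; congr (_ + _)%N; last by rewrite !bin0.
  case: nu nu_gt0 => // k _; rewrite big_ord_recl /= big1 ?addn0 => [|i _].
    by rewrite bin1 muln1 mulnC.
  by rewrite ['C(1, _)]bin_small ?muln0.
have [m] := ubnP n; elim: m n => // m IH [|[|n]] nm.
- by rewrite mulr0n mulr1n h0 mulr1 face_poly0 // subr0 face_poly1_at1.
- have := flow 0%N; rewrite (IH 0%N) // mulr0n mulr1n h0 mul0r addr0 mul1r mulr1 => ->.
  by rewrite h1 mulrC.
apply: (@mulfI _ n.+2%:R); first by rewrite pnatr_eq0.
have e : n.+2%:R * hz_poly.[n.+2%:R] =
    (2 * nu + 1)%:R * hz_poly.[n.+1%:R] + n.+1%:R * hz_poly.[n%:R].
  by rewrite !hz_poly_natr hz_rec.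
rewrite flow [RHS]mulrCA e (IH n.+1) // (_ : n.+1%:R - 1 = n%:R); last by rewrite -natr1 addrK.
by rewrite (IH n (ltnW nm)) mulrDr; congr (_ + _); rewrite mulrCA.
Qed.

(** The leading coefficient of the first difference is nu+1 times that of the polynomial. *)
Lemma catalan_lead : p`_nu.+1 = catalan nu.
Proof.
have szp : (size p <= nu.+2)%N.
  apply/leq_sizeP => e he; apply/eqP; apply: contraTT he => ne; rewrite -ltnNge ltnS.
  move: ne; rewrite /face_poly coef_sum => ne.
  have [M /andP[pM cM] nM] : exists2 M : {set {set halfedge (2 * nu).-1.+1 1}},
      perfect_matching M && connected_graph M & ('X^(nb_faces M) : {poly rat})`_e != 0.
    apply/exists_inP; apply: contraR ne => /exists_inPn ne; rewrite big1 // => M /ne.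
    by rewrite negbK => /eqP.
  move: nM; rewrite coefXn; case: (e =P nb_faces M) => [-> _|_]; last by rewrite eqxx.
  have [t e1 _] := genus_spec (ltn0Sn 0) (dE nu_gt0) pM cM; move: e1; rewrite /top_degree; lia.
have e : p \Po ('X + 1) - p = gauss_mom (2 * nu) *: hz_poly.
  apply: poly_eq_natr => n; rewrite hornerD hornerN horner_comp hornerZ -face_poly1_diff.
  by rewrite !hornerE natr1.
have := congr1 (fun q : {poly rat} => q`_nu) e.
rewrite coefB coefZ coef_hz_poly.
rewrite coef_comp_XD1 //.
rewrite addrK gauss_mom_double => {}e.
apply: (@mulfI _ nu.+1%:R); first by rewrite pnatr_eq0.
rewrite e /catalan [RHS]mulrC divfK ?pnatr_eq0 //.
have hb : (2 * nu)`!%:R = 'C(2 * nu, nu)%:R * (nu`!%:R * nu`!%:R) :> rat.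
  have /bin_fact <- : (nu <= 2 * nu)%N by exact: leq_pmull.
  by rewrite mul2n -addnn addnK !natrM.
have f0 : nu`!%:R != 0 :> rat by rewrite pnatr_eq0 -lt0n fact_gt0.
have p0 : (2 ^+ nu : rat) != 0 by rewrite expf_neq0.
rewrite hb; move: ('C(2 * nu, nu)%:R : rat) (nu`!%:R : rat) (2 ^+ nu : rat) f0 p0 => x y z y0 z0.
by field; rewrite y0 z0.
Qed.
End LeadingCoefficient.

(** * Expansions at infinity *)

Definition binq (alpha : rat) k : rat := (\prod_(i < k) (alpha - i%:R)) / k`!%:R.

Lemma binq_natr n k : binq n%:R k = 'C(n, k)%:R.
Proof.
have -> : binq n%:R k = (n ^_ k)%:R / k`!%:R.
  congr (_ / _); elim: k => [|k IH]; first by rewrite big_ord0.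
  rewrite big_ord_recr /= IH ffactnSr natrM.
  have [kn|kn] := leqP k n; first by rewrite natrB.
  by rewrite ffact_small // !mul0r.
by rewrite -bin_ffact natrM mulfK // pnatr_eq0 -lt0n fact_gt0.
Qed.

(* Expansion at infinity: f x = x^a C(1/x^2) for large x, where C only involves
   nonnegative powers of x. *)
Definition even_expansion (a : nat) (C : {poly rat}) (f : rat -> rat) :=
  (forall t, C`_t != 0 -> (2 * t <= a)%N) /\
  (exists2 B : rat, 0 <= B & forall x, B < x -> f x = x ^+ a * C.[x ^- 2]).

Section Expansions.
Implicit Types (a b : nat) (C E : {poly rat}) (f g : rat -> rat).

Lemma expansion_ext a C f g : (forall x, f x = g x) -> even_expansion a C f -> even_expansion a C g.
Proof. by move=> e [s [B B0 h]]; split=> //; exists B => // x Bx; rewrite -e h. Qed.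

Lemma expansionD a C E f g : even_expansion a C f -> even_expansion a E g ->
  even_expansion a (C + E) (fun x => f x + g x).
Proof.
move=> [sC [B B0 h]] [sE [B' B0' h']]; split=> [t|].
  rewrite coefD; have [->|/sC //] := eqVneq C`_t 0.
  by rewrite add0r => /sE.
exists (Num.max B B') => [|x]; first by rewrite le_max B0.
by rewrite gt_max => /andP[Bx Bx']; rewrite h // h' // hornerD mulrDr.
Qed.

Lemma expansionZ a C f (c : rat) : even_expansion a C f -> even_expansion a (c *: C) (fun x => c * f x).
Proof.
move=> [sC [B B0 h]]; split=> [t|]; first by rewrite coefZ mulf_eq0 negb_or => /andP[_ /sC].
by exists B => // x Bx; rewrite h // hornerZ mulrCA.
Qed.

Lemma expansionM a b C E f g : even_expansion a C f -> even_expansion b E g ->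
  even_expansion (a + b) (C * E) (fun x => f x * g x).
Proof.
move=> [sC [B B0 h]] [sE [B' B0' h']]; split=> [t|].
  rewrite coefM; apply: contraNT; rewrite -ltnNge => lt; rewrite big1 // => -[k /= kt] _.
  have [->|/sC k1] := eqVneq C`_k 0; first by rewrite mul0r.
  have [->|/sE k2] := eqVneq E`_(t - k) 0; first by rewrite mulr0.
  by move: lt k1 k2 kt; lia.
exists (Num.max B B') => [|x]; first by rewrite le_max B0.
by rewrite gt_max => /andP[Bx Bx']; rewrite h // h' // hornerM exprD mulrACA.
Qed.

Lemma expansion_mulx a C f : even_expansion a C f -> even_expansion a.+1 C (fun x => x * f x).
Proof.
move=> [sC [B B0 h]]; split=> [t /sC|]; first exact: leqW.
by exists B => // x Bx; rewrite h // [x ^+ a.+1]exprS mulrA.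
Qed.

(** When the top term cancels, the expansion restarts two degrees lower. *)
Lemma expansion_lower a C f : C`_0 = 0 -> even_expansion a.+2 C f ->
  exists2 E : {poly rat}, (forall n, E`_n = C`_n.+1) & even_expansion a E f.
Proof.
move=> C0 [sC [B B0 h]]; have [E EC] : exists E : {poly rat}, forall n, E`_n = C`_n.+1.
  exists (\poly_(i < (size C).-1) C`_i.+1) => n; rewrite coef_poly; case: ltnP => // hn.
  by rewrite nth_default //; case: (size C) hn.
exists E => //; split=> [t|]; first by rewrite EC => /sC; lia.
exists B => // x Bx; rewrite h //.
have -> : C = 'X * E.
  by apply/polyP => -[|i]; rewrite coefXM /= ?EC.
have x0 : x != 0 by rewrite gt_eqF // (le_lt_trans B0).
by rewrite hornerM hornerX -[a.+2]addn2 exprD -mulrA mulVKf ?expf_neq0.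
Qed.

Lemma expansion_unique a C E f : even_expansion a C f -> even_expansion a E f -> C = E.
Proof.
move=> [_ [B B0 h]] [_ [B' B0' h']].
apply/eqP; rewrite -subr_eq0; apply/negPn/negP => nz.
pose M := Num.max B B'; have M0 : 0 <= M by rewrite le_max B0.
pose s := [seq (M + k.+1%:R) ^- 2 | k <- iota 0 (size (C - E))].
have pos k : 0 < M + k.+1%:R by rewrite ltr_wpDl // ltr0n.
have us : uniq s.
  rewrite map_inj_in_uniq ?iota_uniq // => k l _ _ /invr_inj /eqP.
  by rewrite eqrXn2 ?ltW // (inj_eq (addrI _)) eqr_nat => /eqP [].
have rs : all (root (C - E)) s.
  apply/allP => _ /mapP[k _ ->]; rewrite /root hornerD hornerN.
  have lt : M < M + k.+1%:R by rewrite ltrDl ltr0n.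
  have x0 : (M + k.+1%:R) ^+ a != 0 by rewrite expf_neq0 // gt_eqF.
  rewrite subr_eq0; apply/eqP/(mulfI x0); rewrite -h -?h' //.
    by rewrite (le_lt_trans _ lt) // le_max lexx orbT.
  by rewrite (le_lt_trans _ lt) // le_max lexx.
by have := max_poly_roots nz rs us; rewrite size_map size_iota ltnn.
Qed.

Lemma expr_shift_parity (e : bool) m T (z : rat) : (m < 2 * T)%N ->
  (1 + z) ^+ m + (-1) ^+ e * (1 - z) ^+ m =
  \sum_(s < T) 2 * 'C(m, 2 * s + e)%:R * z ^+ (2 * s + e).
Proof.
move=> mT.
have widen (w : rat) : (1 + w) ^+ m = \sum_(k < 2 * T) 'C(m, k)%:R * w ^+ k.
  rewrite exprDn (eq_bigr (fun k : 'I_m.+1 => 'C(m, k)%:R * w ^+ k)) => [|k _]; last first.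
    by rewrite expr1n mul1r mulr_natl.
  rewrite (big_ord_widen _ (fun k => 'C(m, k)%:R * w ^+ k) mT) big_mkcond.
  apply: eq_bigr => k _; case: ifP => // /negbT; rewrite -leqNgt => mk.
  by rewrite bin_small // mul0r.
rewrite !widen mulr_sumr -big_split /=.
transitivity (\sum_(k < 2 * T) (1 + (-1) ^+ (e + k)) * ('C(m, k)%:R * z ^+ k)).
  by apply: eq_bigr => k _; rewrite (exprNn z) exprD; ring.
elim: {mT widen} T => [|T IH]; first by rewrite muln0 !big_ord0.
rewrite (_ : (2 * T.+1 = (2 * T).+2)%N); last by rewrite mulnS.
rewrite !big_ord_recr /= IH /= -addrA; congr (_ + _).
have s1 : (-1) ^+ (e + 2 * T) = (-1) ^+ e :> rat.
  by rewrite exprD exprM sqrrN !expr1n mulr1.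
rewrite addnS exprS s1 [(2 * T + e)%N]addnC; clear IH s1.
case: e; rewrite ?add0n ?add1n ?expr1 ?expr0.
  by move: (z ^+ (2 * T).+1) (z ^+ (2 * T)) => u w; ring.
by move: (z ^+ (2 * T).+1) (z ^+ (2 * T)) => u w; ring.
Qed.

(** Binomial expansion of each power of x + r and x - r: [e = false] adds the shifts and keeps even
    powers of r, [e = true] subtracts and keeps odd ones. The support condition keeps the exponents
    a - 2t nonnegative, so [binq] is an ordinary binomial where it matters. *)
Lemma expansion_shift (e : bool) (r : rat) a C f : 0 <= r -> (e <= a)%N ->
  even_expansion a C f ->
  exists2 E : {poly rat},
    (forall n, E`_n = \sum_(t < n.+1)
       2 * binq (a%:R - 2 * t%:R) (2 * (n - t) + e) * r ^+ (2 * (n - t) + e) * C`_t) &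
    even_expansion (a - e) E (fun x => f (x + r) + (-1) ^+ e * f (x - r)).
Proof.
move=> r0 ea [sC [B B0 h]].
pose v t s := 2 * 'C(a - 2 * t, 2 * s + e)%:R * r ^+ (2 * s + e) * C`_t.
pose E := \sum_(t < size C) \sum_(s < a.+1) v t s *: 'X^(t + s) : {poly rat}.
have EE n : E`_n = \sum_(t < n.+1) v t (n - t)%N.
  pose g t := if (t <= n)%N then v t (n - t)%N else 0.
  have -> : E`_n = \sum_(t < size C) g t.
    rewrite coef_sum; apply: eq_bigr => t _; rewrite coef_sum /g.
    have [tn|tn] := leqP t n; last first.
      rewrite big1 // => s _; rewrite coefZ coefXn [n == _]ltn_eqF ?mulr0 //.
      by rewrite (leq_trans tn) // leq_addr.
    have [na|na] := ltnP (n - t) a.+1.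
      rewrite (bigD1 (Ordinal na)) //= coefZ coefXn subnKC // eqxx mulr1 big1 ?addr0 // => s.
      rewrite -val_eqE /= coefZ coefXn => ns; case: eqP => [en|]; rewrite ?mulr0 //.
      by move: ns; rewrite en addKn eqxx.
    rewrite big1 => [|s _].
      by rewrite /v bin_small ?(mulr0, mul0r) // (leq_ltn_trans (leq_subr _ _)) //; lia.
    rewrite coefZ coefXn; case: eqP => [en|]; rewrite ?mulr0 //.
    by move: na (ltn_ord s); rewrite en addKn; lia.
  have v0 t s : (size C <= t)%N -> v t s = 0 by move=> ht; rewrite /v nth_default ?mulr0.
  have gbig K : (size C <= K)%N -> \sum_(t < size C) g t = \sum_(t < K) g t.
    move=> hK; rewrite (big_ord_widen _ g hK) big_mkcond; apply: eq_bigr => t _.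
    by case: ltnP => // ht; rewrite /g v0 ?if_same.
  have nbig K : (n < K)%N -> \sum_(t < n.+1) v t (n - t)%N = \sum_(t < K) g t.
    move=> hK; rewrite (eq_bigr (fun t : 'I_n.+1 => g t)) => [|t _]; last first.
      by rewrite /g -ltnS ltn_ord.
    rewrite (big_ord_widen _ g hK) big_mkcond; apply: eq_bigr => t _.
    by rewrite ltnS /g; case: leqP.
  by rewrite (gbig (maxn (size C) n.+1)) ?leq_maxl // (nbig (maxn (size C) n.+1)) // leq_maxr.
exists E => [n|].
  rewrite EE; apply: eq_bigr => t _; rewrite /v.
  have [->|/sC ta] := eqVneq C`_t 0; first by rewrite !mulr0.
  by rewrite -binq_natr natrB // natrM.
split=> [n|].
  rewrite EE; apply: contraNT; rewrite -ltnNge => lt; rewrite big1 // => -[t /= tn] _.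
  rewrite /v; have [->|/sC ta] := eqVneq C`_t 0; first by rewrite !mulr0.
  by rewrite bin_small ?(mulr0, mul0r) //; move: lt ta tn; lia.
exists (B + r) => [|x Bx]; first exact: addr_ge0.
have Bx1 : B < x - r by rewrite ltrBrDr.
have Bx2 : B < x + r by rewrite (lt_le_trans Bx1) // lerD2l (le_trans _ r0) // oppr_le0.
have x0 : x != 0 by rewrite gt_eqF // (le_lt_trans _ Bx) // addr_ge0.
have y1 : x - r != 0 by rewrite gt_eqF // (le_lt_trans B0).
have y2 : x + r != 0 by rewrite gt_eqF // (le_lt_trans B0).
rewrite h // h // ![C.[_]]horner_coef !mulr_sumr -big_split /=.
rewrite horner_sum mulr_sumr; apply: eq_bigr => t _.
have [e0|/sC ta] := eqVneq C`_t 0.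
  rewrite e0 !mul0r !mulr0 addr0 horner_sum big1 ?mulr0 // => s _.
  by rewrite /v e0 mulr0 scale0r horner0.
have pw y : y != 0 -> y ^+ a * (C`_t * y ^- 2 ^+ t) = C`_t * y ^+ (a - 2 * t).
  move=> y0; rewrite mulrCA; congr (_ * _); rewrite -{1}(subnK ta) exprD exprM -mulrA.
  by rewrite -exprMn mulfV ?expr1n ?mulr1 // expf_neq0.
rewrite !pw //.
have f1 (w : rat) : (x + w) ^+ (a - 2 * t) = x ^+ (a - 2 * t) * (1 + w / x) ^+ (a - 2 * t).
  by rewrite -exprMn mulrDr mulr1 mulrCA mulfV ?mulr1.
rewrite !f1 mulNr.
transitivity (C`_t * x ^+ (a - 2 * t) *
   ((1 + r / x) ^+ (a - 2 * t) + (-1) ^+ e * (1 - r / x) ^+ (a - 2 * t))); first by ring.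
rewrite (@expr_shift_parity e _ a.+1); last by lia.
rewrite horner_sum !mulr_sumr; apply: eq_bigr => s _.
have [lt|ge] := ltnP (a - 2 * t) (2 * s + e).
  by rewrite /v bin_small // !(mulr0, mul0r) scale0r horner0 mulr0.
rewrite hornerZ hornerXn /v expr_div_n.
have key : x ^+ (a - 2 * t) / x ^+ (2 * s + e) = x ^+ (a - e) * (x ^- 2) ^+ (t + s).
  have -> : (a - 2 * t = (a - 2 * t - (2 * s + e)) + (2 * s + e))%N by rewrite subnK.
  rewrite exprD mulfK ?expf_neq0 //.
  have -> : (a - e = (a - 2 * t - (2 * s + e)) + 2 * (t + s))%N by move: ge; lia.
  by rewrite exprD exprM -mulrA -exprMn mulfV ?expr1n ?mulr1 // expf_neq0.
move: key; move: (x ^+ (a - 2 * t)) (x ^+ (2 * s + e))^-1 (x ^+ (a - e)) (x ^- 2 ^+ (t + s)).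
move: (r ^+ _) ('C(_, _)%:R : rat) C`_t => U V c X Y Z W key.
transitivity (2 * V * U * c * (X * Y)); first by ring.
by rewrite key; ring.
Qed.
End Expansions.

(** * The genus recursion *)

(* The face polynomial of j vertices of degree 2x has degree 2 + excess j x. *)
Definition excess j (x : rat) : rat := j%:R * (x - 1).

Section Recursion.
Variables (x : rat) (c : nat -> nat -> rat).

Definition conv (u v : nat -> rat) n : rat := \sum_(i < n.+1) u i * v (n - i)%N.

(** Coefficients of the second central difference; the binomials of lower index 0 have cancelled,
    whence the shift by 2. *)
Definition diff2_coef j n : rat :=
  \sum_(t < n.+1) 2 * binq (excess j x + 2 - 2 * t%:R) (2 * (n - t) + 2) * c j t.

Definition lower_coef j n : rat :=
  let g := diff2_coef in
  match j with
  | 1%N => 0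
  | 2%N => conv (g 1%N) (g 1%N) n
  | _ => 3 * conv (g 1%N) (g 2%N) n + conv (g 1%N) (conv (g 1%N) (g 1%N)) n
  end.

(** Left minus right side of [face_poly_flow_sym] at the power [excess j x + 1 - 2 n], with c i t in
    place of the genus t count on i vertices. For an indeterminate x it is a polynomial condition on
    the table. *)
Definition residual j n : rat :=
  j%:R * (2 * x) *
    (\sum_(t < n.+1) 2 * binq (excess j x + 2 - 2 * t%:R) (2 * (n - t) + 1) *
       2^-1 ^+ (2 * (n - t) + 1) * c j t) -
  \sum_(t < n.+1) 2 * binq (excess j x + 1 - 2 * t%:R) (2 * (n - t)) *
     2^-1 ^+ (2 * (n - t)) * (diff2_coef j t + lower_coef j t).
End Recursion.

Lemma eq_conv u u' v v' n : (forall i, (i <= n)%N -> u i = u' i) ->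
  (forall i, (i <= n)%N -> v i = v' i) -> conv u v n = conv u' v' n.
Proof.
move=> hu hv; apply: eq_bigr => i _; rewrite hu; last by rewrite -ltnS.
by rewrite hv // leq_subr.
Qed.

Lemma eq_lower_coef x c c' j n : (0 < j)%N ->
  (forall i t, (0 < i < j)%N -> (t <= n)%N -> c i t = c' i t) ->
  lower_coef x c j n = lower_coef x c' j n.
Proof.
move=> j0 e.
have eg i k : (0 < i < j)%N -> (k <= n)%N -> diff2_coef x c i k = diff2_coef x c' i k.
  move=> ij kn; apply: eq_bigr => t _; rewrite e //.
  by rewrite (leq_trans _ kn) // -ltnS.
case: j j0 e eg => [|[|[|j]]] // _ e eg; rewrite /lower_coef.
  by apply: eq_conv => i hi; apply: eg.
congr (_ * _ + _); first by apply: eq_conv => i hi; apply: eg.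
apply: eq_conv => i hi; first by apply: eg.
by apply: eq_conv => k hk; apply: eg; rewrite // (leq_trans hk).
Qed.

(** The recursion is triangular: c j n enters only through the terms t = n. With A the number of
    faces, they contribute 2jxA on the left and 2A(A-1) on the right. *)
Lemma residual_diff x c c' j n : (0 < j)%N ->
  (forall i t, (0 < i < j)%N -> (t <= n)%N -> c i t = c' i t) ->
  (forall t, (t < n)%N -> c j t = c' j t) ->
  residual x c j n - residual x c' j n =
  2 * (excess j x + 2 - 2 * n%:R) * (j%:R - 1 + 2 * n%:R) * (c j n - c' j n).
Proof.
move=> j0 ei ej.
have el t : (t <= n)%N -> lower_coef x c j t = lower_coef x c' j t.
  by move=> tn; apply: eq_lower_coef => // i s hi hs; rewrite ei // (leq_trans hs).
have eg t : (t < n)%N -> diff2_coef x c j t = diff2_coef x c' j t.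
  move=> tn; apply: eq_bigr => s _; rewrite ej //.
  by rewrite (leq_ltn_trans _ tn) // -ltnS.
have e1 : \sum_(t < n) 2 * binq (excess j x + 2 - 2 * t%:R) (2 * (n - t) + 1) *
     2^-1 ^+ (2 * (n - t) + 1) * c j t = \sum_(t < n) 2 * binq (excess j x + 2 - 2 * t%:R)
     (2 * (n - t) + 1) * 2^-1 ^+ (2 * (n - t) + 1) * c' j t.
  by apply: eq_bigr => t _; rewrite ej.
have e2 : \sum_(t < n) 2 * binq (excess j x + 1 - 2 * t%:R) (2 * (n - t)) *
     2^-1 ^+ (2 * (n - t)) * (diff2_coef x c j t + lower_coef x c j t) =
   \sum_(t < n) 2 * binq (excess j x + 1 - 2 * t%:R) (2 * (n - t)) *
     2^-1 ^+ (2 * (n - t)) * (diff2_coef x c' j t + lower_coef x c' j t).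
  by apply: eq_bigr => t _; rewrite eg // el // ltnW.
have e3 : \sum_(t < n) 2 * binq (excess j x + 2 - 2 * t%:R) (2 * (n - t) + 2) * c j t =
    \sum_(t < n) 2 * binq (excess j x + 2 - 2 * t%:R) (2 * (n - t) + 2) * c' j t.
  by apply: eq_bigr => t _; rewrite ej.
rewrite /residual !(big_ord_recr n) /= el // e1 e2 {e1 e2}.
rewrite [diff2_coef x c j n]/diff2_coef [diff2_coef x c' j n]/diff2_coef !(big_ord_recr n) /= e3 {e3}.
rewrite subnn muln0 !add0n.
set S1 := \sum_(t < n) _; set S2 := \sum_(t < n) _; set S3 := \sum_(t < n) _.
set A := excess j x + 2 - 2 * n%:R.
have b0 a : binq a 0 = 1 by rewrite /binq big_ord0 divr1.
have b1 a : binq a 1 = a by rewrite /binq big_ord1 subr0 divr1.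
have b2 a : binq a 2 = a * (a - 1) / 2 by rewrite /binq big_ord_recr big_ord1 /= subr0.
rewrite b0 b1 b2 expr1 expr0.
have jx : j%:R * x = A - 2 + 2 * n%:R + j%:R by rewrite /A /excess; ring.
rewrite [j%:R * (2 * x)]mulrCA jx {jx}.

move: S1 S2 S3 (lower_coef _ _ _ _) (c j n) (c' j n) A => S1 S2 S3 L u v A.
by field.
Qed.

(** Every term of the j-th equation involves j vertices in total, so the equation is homogeneous
    under a weight C per vertex; this removes the Catalan powers. *)
Lemma residual_scale x c C j n : (0 < j <= 3)%N ->
  residual x (fun i t => C ^+ i * c i t) j n = C ^+ j * residual x c j n.
Proof.
move=> j13.
have eg i k : diff2_coef x (fun i t => C ^+ i * c i t) i k = C ^+ i * diff2_coef x c i k.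
  by rewrite /diff2_coef mulr_sumr; apply: eq_bigr => t _; ring.
have cv u v u' v' a b k : (forall i, u i = C ^+ a * u' i) -> (forall i, v i = C ^+ b * v' i) ->
    conv u v k = C ^+ (a + b) * conv u' v' k.
  move=> hu hv; rewrite /conv mulr_sumr; apply: eq_bigr => i _.
  by rewrite hu hv exprD; ring.
have el k : lower_coef x (fun i t => C ^+ i * c i t) j k = C ^+ j * lower_coef x c j k.
  rewrite /lower_coef; case: j j13 => [|[|[|[|]]]] // _; first by rewrite mulr0.
    by apply: (cv _ _ _ _ 1%N 1%N) => i; exact: eg.
  have c11 i := cv _ _ _ _ 1%N 1%N i (eg 1%N) (eg 1%N).
  rewrite (cv _ _ _ _ 1%N 2%N k (eg 1%N) (eg 2%N)) (cv _ _ _ _ 1%N 2%N k (eg 1%N) c11).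
  by ring.
rewrite /residual mulrBr mulrCA !mulr_sumr; congr (_ - _).
  by apply: eq_bigr => t _; ring.
by apply: eq_bigr => t _; rewrite eg el; ring.
Qed.

Section GenusRecursion.
Variable nu : nat.
Hypothesis nu_gt0 : (0 < nu)%N.
Notation d := (2 * nu).-1.
Definition genus_count i t : rat := (nb_graphs t (2 * nu) i)%:R.

Lemma excessE j : (j * nu.-1)%N%:R = excess j nu%:R.
Proof. by rewrite /excess natrM -subn1 natrB. Qed.

Lemma top_degreeE j : (0 < j)%N -> top_degree j nu = (j * nu.-1).+2.
Proof. by move=> j0; rewrite /top_degree; case: nu nu_gt0 => // k _; rewrite mulnS /=; lia. Qed.

Lemma coef_genus i t : (0 < i)%N -> (genus_poly d i nu)`_t = genus_count i t.
Proof. by move=> i0; rewrite coef_genus_poly ?dE // /genus_count dE. Qed.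

Lemma face_expansion j : (0 < j)%N ->
  even_expansion (j * nu.-1).+2 (genus_poly d j nu) (fun x => (face_poly d j).[x]).
Proof.
move=> j0; split=> [t|].
  by move/(genus_poly_support j0 (dE nu_gt0)); rewrite top_degreeE // => /ltnW.
exists 0 => // x x0; rewrite (face_genus_poly j0 (dE nu_gt0)) ?gt_eqF //.
by rewrite top_degreeE.
Qed.

Lemma central2_expansion j : (0 < j)%N ->
  exists2 G : {poly rat}, (forall n, G`_n = diff2_coef nu%:R genus_count j n) &
    even_expansion (j * nu.-1) G (central2 (fun x => (face_poly d j).[x])).
Proof.
move=> j0; have fe := face_expansion j0.
have [E Ec Ee] := @expansion_shift false 1 _ _ _ ler01 isT fe.
rewrite subn0 in Ee.
have := expansionD Ee (expansionZ (-2) fe).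
set C := E + _ => Ce.
have Cc n : C`_n = \sum_(t < n.+1) 2 * binq (excess j nu%:R + 2 - 2 * t%:R) (2 * (n - t)) *
    genus_count j t - 2 * genus_count j n.
  rewrite coefD coefZ Ec coef_genus // mulNr; congr (_ - _); apply: eq_bigr => t _.
  by rewrite addn0 expr1n mulr1 coef_genus // -[(j * nu.-1).+2]addn2 natrD excessE.
have b0 a : binq a 0 = 1 by rewrite /binq big_ord0 divr1.
(* A second difference loses its top term, hence two degrees. *)
have C0 : C`_0 = 0 by rewrite Cc big_ord1 muln0 b0 mulr1 subrr.
have [G Gc Ge] := expansion_lower C0 Ce.
exists G => [n|].
  rewrite Gc Cc big_ord_recr /= subnn muln0 b0 mulr1 addrK; apply: eq_bigr => t _.
  by rewrite subSn ?mulnS 1?addnC // -ltnS.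
apply: expansion_ext Ge => x.
by rewrite /central2 expr0 mul1r; ring.
Qed.

Lemma flow_expansion j : (0 < j <= 3)%N ->
  exists2 K : {poly rat},
    (forall n, K`_n = diff2_coef nu%:R genus_count j n + lower_coef nu%:R genus_count j n) &
    even_expansion (j * nu.-1) K (flow_term (fun i x => (face_poly d i).[x]) j).
Proof.
have [G1 c1 e1] := central2_expansion (ltn0Sn 0); have [G2 c2 e2] := central2_expansion (ltn0Sn 1).
have [G3 c3 e3] := central2_expansion (ltn0Sn 2).
have cM (P Q : {poly rat}) u v n : (forall i, P`_i = u i) -> (forall i, Q`_i = v i) ->
    (P * Q)`_n = conv u v n.
  by move=> hu hv; rewrite coefM; apply: eq_bigr => i _; rewrite hu hv.
have e11 := expansionM e1 e1; rewrite -mulnDl in e11.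
have e12 := expansionM e1 e2; rewrite -mulnDl in e12.
have e111 := expansionM e1 e11; rewrite -mulnDl in e111.
case: j => [|[|[|[|]]]] // _.
- by exists G1 => // n; rewrite c1 addr0.
- exists (G2 + G1 * G1) => [n|]; last exact: expansionD.
  by rewrite coefD c2 (cM _ _ _ _ n c1 c1).
exists (G3 + 3 *: (G1 * G2) + G1 * (G1 * G1)) => [n|].
  rewrite !coefD coefZ c3 (cM _ _ _ _ n c1 c2) -addrA; congr (_ + (_ + _)).
  exact: (cM _ _ _ _ n c1 (fun i => cM _ _ _ _ i c1 c1)).
by apply: expansionD e111; apply: expansionD => //; exact: expansionZ.
Qed.

Lemma face_poly_flow_signed j y : (0 < j <= 3)%N ->
  j%:R * (2 * nu%:R) * ((face_poly d j).[y + 2^-1] + (-1) ^+ true * (face_poly d j).[y - 2^-1]) =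
  (y + 2^-1) * flow_term (fun i x => (face_poly d i).[x]) j (y + 2^-1) +
  (-1) ^+ false * ((y - 2^-1) * flow_term (fun i x => (face_poly d i).[x]) j (y - 2^-1)).
Proof. by move=> j13; rewrite expr1 expr0 mulN1r mul1r face_poly_flow_sym. Qed.

Theorem genus_residual j n : (0 < j <= 3)%N -> residual nu%:R genus_count j n = 0.
Proof.
move=> j13; have /andP[j0 _] := j13.
have h0 : 0 <= 2^-1 :> rat by [].
have [E Ec Ee] := @expansion_shift true 2^-1 (j * nu.-1).+2 _ _ h0 isT (face_expansion j0).
have [K Kc Ke] := flow_expansion j13.
have [E' Ec' Ee'] := @expansion_shift false 2^-1 _ _ _ h0 isT (expansion_mulx Ke).
rewrite subn0 in Ee'; rewrite subn1 /= in Ee.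
have := expansionZ (j%:R * (2 * nu%:R)) Ee.
move/(expansion_ext (fun y => face_poly_flow_signed y j13)) => Ee2.
have e := expansion_unique Ee2 Ee'.
have := congr1 (fun p : {poly rat} => p`_n) e; rewrite coefZ Ec Ec' => {}e.
rewrite /residual; apply/eqP; rewrite subr_eq0; apply/eqP.
etransitivity; first etransitivity; last 2 first.
- exact: e.
- by apply: eq_bigr => t _; rewrite Kc addn0 -[(j * nu.-1).+1]addn1 natrD excessE.
congr (_ * _); apply: eq_bigr => t _.
by rewrite coef_genus // -[(j * nu.-1).+2]addn2 natrD excessE.
Qed.
End GenusRecursion.

(** * Computing with rational polynomials *)

Definition rat_of_Z (z : Z) : rat := (int_of_Z z)%:~R.

Lemma rat_of_ZD x y : rat_of_Z (BinInt.Z.add x y) = rat_of_Z x + rat_of_Z y.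
Proof. by rewrite /rat_of_Z (_ : BinInt.Z.add x y = x + y) // (rmorphD int_of_Z) rmorphD. Qed.

Lemma rat_of_ZM x y : rat_of_Z (BinInt.Z.mul x y) = rat_of_Z x * rat_of_Z y.
Proof. by rewrite /rat_of_Z (_ : BinInt.Z.mul x y = x * y) // (rmorphM int_of_Z) rmorphM. Qed.

Lemma rat_of_ZN x : rat_of_Z (BinInt.Z.opp x) = - rat_of_Z x.
Proof. by rewrite /rat_of_Z (_ : BinInt.Z.opp x = - x) // (rmorphN int_of_Z) rmorphN. Qed.

Lemma rat_of_Z_nat n : rat_of_Z (BinInt.Z.of_nat n) = n%:R.
Proof.
elim: n => // n IH; rewrite Znat.Nat2Z.inj_succ -BinInt.Z.add_1_r rat_of_ZD IH.
by rewrite -natr1.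
Qed.

Lemma rat_of_Z_pos_neq0 p : rat_of_Z (Zpos p) != 0.
Proof.
rewrite -Znat.positive_nat_Z rat_of_Z_nat pnatr_eq0.
by have /ssrnat.ltP := Pnat.Pos2Nat.is_pos p; case: (BinPos.Pos.to_nat p).
Qed.

Lemma rat_of_Z_N n : rat_of_Z (BinInt.Z.of_N n) = lit n.
Proof.
rewrite unlock -Znat.N_nat_Z rat_of_Z_nat; congr (_%:R).
case: n => // p; elim: p => //= p IH.
  by rewrite Pnat.Pos2Nat.inj_xI IH NatTrec.doubleE -mul2n.
by rewrite Pnat.Pos2Nat.inj_xO IH NatTrec.doubleE -mul2n.
Qed.

(** Binary fractions serve as the computational representation, so that identities between large
    rational coefficients can be decided by [vm_compute]. *)
Definition rat_of_Q (q : Q) : rat := rat_of_Z (Qnum q) / rat_of_Z (Zpos (Qden q)).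

Lemma rat_of_Q_eq p q : Qeq p q -> rat_of_Q p = rat_of_Q q.
Proof.
rewrite /Qeq /rat_of_Q => /(congr1 rat_of_Z); rewrite !rat_of_ZM => e.
apply: (mulIf (rat_of_Z_pos_neq0 (Qden p))); rewrite divfK ?rat_of_Z_pos_neq0 //.
apply: (mulIf (rat_of_Z_pos_neq0 (Qden q))); rewrite e mulrAC divfK ?rat_of_Z_pos_neq0 //.
Qed.

Lemma rat_of_QD p q : rat_of_Q (Qred (Qplus p q)) = rat_of_Q p + rat_of_Q q.
Proof.
rewrite (rat_of_Q_eq (Qred_correct _)) /rat_of_Q /Qplus /= BinInt.Pos2Z.inj_mul rat_of_ZD !rat_of_ZM.
have := rat_of_Z_pos_neq0 (Qden p); have := rat_of_Z_pos_neq0 (Qden q).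
by move: (rat_of_Z (Zpos (Qden p)) : rat) (rat_of_Z (Zpos (Qden q)) : rat) => x y y0 x0; field; rewrite x0 y0.
Qed.

Lemma rat_of_QM p q : rat_of_Q (Qred (Qmult p q)) = rat_of_Q p * rat_of_Q q.
Proof.
rewrite (rat_of_Q_eq (Qred_correct _)) /rat_of_Q /Qmult /= BinInt.Pos2Z.inj_mul !rat_of_ZM.
by rewrite invfM mulrACA.
Qed.

Lemma rat_of_QN p : rat_of_Q (Qopp p) = - rat_of_Q p.
Proof. by rewrite /rat_of_Q /= rat_of_ZN mulNr. Qed.

Lemma rat_of_Q_int z : rat_of_Q (inject_Z z) = rat_of_Z z.
Proof. by rewrite /rat_of_Q /= divr1. Qed.

(** It also holds at 0, where both inverses are 0 by convention. *)
Lemma rat_of_QV p : rat_of_Q (Qinv p) = (rat_of_Q p)^-1.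
Proof.
have z0 : rat_of_Z Z0 = 0 by [].
case: p => [[|n|n] m]; rewrite /rat_of_Q /Qinv /= ?invf_div //.
  by rewrite z0 ?mul0r ?invr0 ?mulr0.
by rewrite -[Zneg n]/(BinInt.Z.opp (Zpos n)) -[Zneg m]/(BinInt.Z.opp (Zpos m)) !rat_of_ZN invrN mulrN mulNr.
Qed.

(* Coefficients, lowest degree first. *)
Definition qpoly := seq Q.
Implicit Types (p q : qpoly) (x : rat).

Fixpoint qeval p x : rat := if p is c :: p' then rat_of_Q c + x * qeval p' x else 0.

Fixpoint qadd p q : qpoly :=
  match p, q with
  | [::], _ => q
  | _, [::] => p
  | c :: p', e :: q' => Qred (Qplus c e) :: qadd p' q'
  end.
Definition qscale c p : qpoly := [seq Qred (Qmult c e) | e <- p].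
Fixpoint qmul p q : qpoly := if p is c :: p' then qadd (qscale c q) (inject_Z Z0 :: qmul p' q) else [::].
Definition qconst c : qpoly := [:: c].
Definition qnat n : qpoly := qconst (inject_Z (BinInt.Z.of_nat n)).
Definition qiszero p := all (fun c => Qeq_bool c (inject_Z Z0)) p.

Lemma qevalD p q x : qeval (qadd p q) x = qeval p x + qeval q x.
Proof.
elim: p q => [|c p IH] [|e q] //=; rewrite ?add0r ?addr0 //.
by rewrite rat_of_QD IH; ring.
Qed.

Lemma qevalZ c p x : qeval (qscale c p) x = rat_of_Q c * qeval p x.
Proof. by elim: p => [|e p IH] /=; rewrite ?mulr0 // rat_of_QM IH; ring. Qed.

Lemma qevalM p q x : qeval (qmul p q) x = qeval p x * qeval q x.
Proof.
elim: p => [|c p IH] /=; first by rewrite mul0r.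
by rewrite qevalD qevalZ /= rat_of_Q_int IH; ring.
Qed.

Lemma qevalC c x : qeval (qconst c) x = rat_of_Q c.
Proof. by rewrite /= mulr0 addr0. Qed.

Lemma qeval_nat n x : qeval (qnat n) x = n%:R.
Proof. by rewrite qevalC rat_of_Q_int rat_of_Z_nat. Qed.

Lemma qiszero_eval p x : qiszero p -> qeval p x = 0.
Proof.
elim: p => //= c p IH /andP[/Qeq_bool_iff e /IH ->].
by rewrite (rat_of_Q_eq e) mulr0 addr0.
Qed.

Definition qsum n (f : nat -> qpoly) : qpoly := foldr (fun t acc => qadd (f t) acc) [::] (iota 0 n).

Lemma qeval_sum n f x : qeval (qsum n f) x = \sum_(t < n) qeval (f t) x.
Proof.
rewrite -(big_mkord xpredT (fun t => qeval (f t) x)) /index_iota subn0 /qsum.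
by elim: iota => [|t s IH] /=; rewrite ?big_nil // big_cons qevalD IH.
Qed.

Definition qprod n (f : nat -> qpoly) : qpoly :=
  foldr (fun t acc => qmul (f t) acc) (qnat 1) (iota 0 n).

Lemma qeval_prod n f x : qeval (qprod n f) x = \prod_(t < n) qeval (f t) x.
Proof.
rewrite -(big_mkord xpredT (fun t => qeval (f t) x)) /index_iota subn0 /qprod.
by elim: iota => [|t s IH]; rewrite ?big_nil ?qeval_nat // big_cons /= qevalM IH.
Qed.

(* Dividing factor by factor avoids k`!, which would be evaluated in unary. *)
Definition qbin (a : qpoly) k : qpoly :=
  qprod k (fun i => qscale (Qinv (inject_Z (BinInt.Z.of_nat i.+1)))
    (qadd a (qconst (Qopp (inject_Z (BinInt.Z.of_nat i)))))).

Lemma qeval_bin a k x : qeval (qbin a k) x = binq (qeval a x) k.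
Proof.
rewrite /qbin qeval_prod /binq; elim: k => [|k IH]; first by rewrite !big_ord0 divr1.
rewrite !big_ord_recr IH qevalZ qevalD qevalC rat_of_QN rat_of_QV !rat_of_Q_int !rat_of_Z_nat /=.
by rewrite factS natrM invfM [_^-1 * (_ - _)]mulrC mulrACA [k`!%:R^-1 * _]mulrC.
Qed.

Inductive pexp :=
  | PX | POne | PNat of nat | PLit of N | PFall of int & nat
  | PAdd of pexp & pexp | PMul of pexp & pexp | POpp of pexp
  | PPow of pexp & nat | PInv of pexp.

Fixpoint pdenote (e : pexp) x : rat :=
  match e with
  | PX => x | POne => 1 | PNat n => n%:R | PLit n => lit n
  | PFall m n => falling m n x
  | PAdd a b => pdenote a x + pdenote b x
  | PMul a b => pdenote a x * pdenote b x
  | POpp a => - pdenote a x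
  | PPow a n => pdenote a x ^+ n
  | PInv a => (pdenote a x)^-1
  end.

Definition qfall (m : int) n : qpoly :=
  qprod `|(n%:Z + 1 - m)%R|%N
    (fun k => [:: Qopp (inject_Z (BinInt.Z.add (Z_of_int m) (BinInt.Z.of_nat k))); inject_Z (Zpos xH)]).

(** Partial because only constants are inverted; the table divides by nothing else. *)
Fixpoint pnorm (e : pexp) : option qpoly :=
  match e with
  | PX => Some [:: inject_Z Z0; inject_Z (Zpos xH)]
  | POne => Some (qnat 1)
  | PNat n => Some (qnat n)
  | PLit n => Some (qconst (inject_Z (BinInt.Z.of_N n)))
  | PFall m n => Some (qfall m n)
  | PAdd a b => if (pnorm a, pnorm b) is (Some p, Some q) then Some (qadd p q) else None
  | PMul a b => if (pnorm a, pnorm b) is (Some p, Some q) then Some (qmul p q) else None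
  | POpp a => if pnorm a is Some p then Some (qscale (inject_Z (Zneg xH)) p) else None
  | PPow a n => if pnorm a is Some p then Some (iter n (qmul p) (qnat 1)) else None
  | PInv a => if pnorm a is Some [:: c] then Some (qconst (Qinv c)) else None
  end.

Lemma pnormP e p x : pnorm e = Some p -> qeval p x = pdenote e x.
Proof.
elim: e p => [||n|n|m n|a IHa b IHb|a IHa b IHb|a IHa|a IHa n|a IHa] p /=.
- by case=> <- /=; rewrite !rat_of_Q_int mulr0 addr0 add0r mulr1.
- by case=> <-; rewrite qeval_nat.
- by case=> <-; rewrite qeval_nat.
- by case=> <-; rewrite qevalC rat_of_Q_int rat_of_Z_N.
- case=> <-; rewrite qeval_prod /falling big_mkord; apply: eq_bigr => k _.
  rewrite /= rat_of_QN !rat_of_Q_int mulr0 addr0 mulr1 addrC; congr (_ - _).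
  by rewrite rat_of_ZD rat_of_Z_nat /rat_of_Z Z_of_intK rmorphD.
- case: (pnorm a) IHa => // pa IHa; case: (pnorm b) IHb => // pb IHb [<-].
  by rewrite qevalD (IHa _ erefl) (IHb _ erefl).
- case: (pnorm a) IHa => // pa IHa; case: (pnorm b) IHb => // pb IHb [<-].
  by rewrite qevalM (IHa _ erefl) (IHb _ erefl).
- case: (pnorm a) IHa => // pa IHa [<-].
  by rewrite qevalZ (IHa _ erefl) rat_of_Q_int -[rat_of_Z _]/(- 1) mulN1r.
- case: (pnorm a) IHa => // pa IHa [<-]; elim: n => [|n IH]; first by rewrite qeval_nat.
  by rewrite iterS qevalM IH (IHa _ erefl) exprS.
- case: (pnorm a) IHa => // -[|c [|//]] //= IHa [<-].
  by rewrite qevalC rat_of_QV -(IHa _ erefl) qevalC.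
Qed.

(** * Verification of the table *)

Fixpoint qhorner (p : qpoly) (q : Q) : Q :=
  if p is c :: p' then Qred (Qplus c (Qred (Qmult q (qhorner p' q)))) else inject_Z Z0.

Lemma qhornerE p (q : Q) : rat_of_Q (qhorner p q) = qeval p (rat_of_Q q).
Proof. by elim: p => [|c p IH] //=; rewrite rat_of_QD rat_of_QM IH. Qed.

Definition qexcess j r t : qpoly :=
  qadd (qmul (qnat j) [:: inject_Z (Zneg xH); inject_Z (Zpos xH)])
    (qadd (qnat r) (qscale (Qopp (inject_Z (Zpos (xO xH)))) (qnat t))).

Lemma qeval_excess j r t x : qeval (qexcess j r t) x = excess j x + r%:R - 2 * t%:R.
Proof.
rewrite /qexcess qevalD qevalM qevalD qevalZ !qeval_nat rat_of_QN /= !rat_of_Q_int.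
rewrite -[rat_of_Z (Zneg xH)]/(- 1) -[rat_of_Z (Zpos xH)]/1.
rewrite -[rat_of_Z (Zpos (xO xH))]/(2%:R) /excess.
by rewrite mulr0 addr0 mulr1 mulNr addrA [- 1 + x]addrC.
Qed.

Definition qhalf k : qpoly :=
  qconst (iter k (fun q : Q => Qred (Qmult (Qinv (inject_Z (Zpos (xO xH)))) q))
    (inject_Z (Zpos xH))).

Lemma qeval_half k x : qeval (qhalf k) x = 2^-1 ^+ k.
Proof.
rewrite /qhalf qevalC; elim: k => [|k IH]; first by rewrite rat_of_Q_int.
by rewrite iterS rat_of_QM IH rat_of_QV rat_of_Q_int exprS.
Qed.

Definition qtab m (f : nat -> qpoly) : nat -> qpoly := nth [::] [seq f n | n <- iota 0 m].

Lemma qtabE m f n : (n < m)%N -> qtab m f n = f n.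
Proof. by move=> nm; rewrite /qtab (nth_map 0%N) ?size_iota // nth_iota. Qed.

Section Residuals.
Variable m : nat.

Definition qconv (u v : nat -> qpoly) n := qsum n.+1 (fun i => qmul (u i) (v (n - i)%N)).

Definition qdiff2 (s : nat -> qpoly) j n :=
  qsum n.+1 (fun t => qmul (qmul (qnat 2) (qbin (qexcess j 2 t) (2 * (n - t) + 2))) (s t)).

Definition qlower (g1 g2 : nat -> qpoly) j : nat -> qpoly :=
  match j with
  | 1%N => fun _ => [::]
  | 2%N => qconv g1 g1
  | _ => let g11 := qtab m (qconv g1 g1) in
    fun n => qadd (qmul (qnat 3) (qconv g1 g2 n)) (qconv g1 g11 n)
  end.

(* Intermediate sequences are tabulated so that evaluation shares them. *)
Definition qresidual (s : nat -> nat -> qpoly) j : nat -> qpoly :=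
  let sj := s j in
  let g1 := qtab m (qdiff2 (s 1%N) 1) in
  let g2 := qtab m (qdiff2 (s 2%N) 2) in
  let gj := qtab m (qdiff2 sj j) in
  let l := qlower g1 g2 j in
  let k := qtab m (fun n => qadd (gj n) (l n)) in
  fun n =>
   qadd (qmul (qmul (qnat j) [:: inject_Z Z0; inject_Z (Zpos (xO xH))])
     (qsum n.+1 (fun t => qmul (qmul (qmul (qnat 2) (qbin (qexcess j 2 t) (2 * (n - t) + 1)))
        (qhalf (2 * (n - t) + 1))) (sj t))))
   (qscale (inject_Z (Zneg xH))
     (qsum n.+1 (fun t => qmul (qmul (qmul (qnat 2) (qbin (qexcess j 1 t) (2 * (n - t))))
        (qhalf (2 * (n - t)))) (k t)))).

Variables (x : rat) (s : nat -> nat -> qpoly) (c : nat -> nat -> rat).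
Hypothesis sE : forall j t, (0 < j <= 3)%N -> (t < m)%N -> qeval (s j t) x = c j t.

Lemma qeval_conv u v f g n : (n < m)%N -> (forall t, (t < m)%N -> qeval (u t) x = f t) ->
  (forall t, (t < m)%N -> qeval (v t) x = g t) -> qeval (qconv u v n) x = conv f g n.
Proof.
move=> nm hu hv; rewrite qeval_sum; apply: eq_bigr => i _.
by rewrite qevalM hu ?hv // (leq_ltn_trans _ nm) ?leq_subr // -ltnS.
Qed.

Lemma qeval_diff2 j n : (0 < j <= 3)%N -> (n < m)%N ->
  qeval (qtab m (qdiff2 (s j) j) n) x = diff2_coef x c j n.
Proof.
move=> j13 nm; rewrite qtabE // qeval_sum; apply: eq_bigr => t _.
by rewrite !qevalM qeval_bin qeval_excess qeval_nat sE // (leq_ltn_trans _ nm) // -ltnS.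
Qed.

Lemma qeval_lower j n : (0 < j <= 3)%N -> (n < m)%N ->
  qeval (qlower (qtab m (qdiff2 (s 1%N) 1)) (qtab m (qdiff2 (s 2%N) 2)) j n) x =
  lower_coef x c j n.
Proof.
move=> j13 nm; have h1 t := @qeval_diff2 1 t isT; have h2 t := @qeval_diff2 2 t isT.
case: j j13 => [|[|[|[|]]]] // _; rewrite /qlower /lower_coef.
  exact: qeval_conv.
rewrite qevalD qevalM qeval_nat; congr (_ * _ + _); first exact: qeval_conv.
by apply: qeval_conv => // t tm; rewrite qtabE //; exact: qeval_conv.
Qed.

Lemma qeval_residual j n : (0 < j <= 3)%N -> (n < m)%N ->
  qeval (qresidual s j n) x = residual x c j n.
Proof.
move=> j13 nm; have lt (t : 'I_n.+1) : (t < m)%N by rewrite (leq_ltn_trans _ nm) // -ltnS.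
rewrite /qresidual qevalD qevalM qevalM qevalZ !qeval_sum qeval_nat rat_of_Q_int.
rewrite -[rat_of_Z (Zneg xH)]/(- 1) mulN1r /residual; congr (_ * _ * _ - _).
- rewrite /= !rat_of_Q_int -[rat_of_Z (Zpos (xO xH))]/(2%:R) mulr0 addr0 add0r.
  by rewrite mulrC.
- by apply: eq_bigr => t _; rewrite !qevalM qeval_nat qeval_bin qeval_excess qeval_half sE.
apply: eq_bigr => t _; rewrite !qevalM qeval_nat qeval_bin qeval_excess qeval_half qtabE //.
by rewrite qevalD qeval_diff2 ?qeval_lower.
Qed.
End Residuals.

Ltac reify_spoly x t :=
  lazymatch t with
  | x => constr:(PX)
  | 0 => constr:(PNat 0)
  | 1 => constr:(POne)
  | ?n%:R => constr:(PNat n)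
  | lit ?n => constr:(PLit n)
  | falling ?m ?n x => constr:(PFall m n)
  | ?a + ?b => let p := reify_spoly x a in let q := reify_spoly x b in constr:(PAdd p q)
  | ?a * ?b => let p := reify_spoly x a in let q := reify_spoly x b in constr:(PMul p q)
  | - ?a => let p := reify_spoly x a in constr:(POpp p)
  | ?a ^+ ?n => let p := reify_spoly x a in constr:(PPow p n)
  | ?a^-1 => let p := reify_spoly x a in constr:(PInv p)
  end.

Ltac solve_reify :=
  match goal with |- {e | forall x, pdenote e x = @?f x} =>
    let e := constr:(fun x : rat => ltac:(
       let t := eval cbv beta iota delta [Spoly] in (f x) in
       let p := reify_spoly x t in exact p)) in
    match e with fun _ => ?p => exists p; reflexivity end
  end.

(** Reifies each entry of the table from its own text; transparent, so that [vm_compute] can reach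
    the expression. *)
Definition spoly_exp (g j : nat) : {e | forall x, pdenote e x = Spoly g j x}.
Proof. by case: g => [|[|[|[|[|[|g]]]]]]; case: j => [|[|[|[|j]]]]; solve_reify. Defined.

Definition qspoly : seq (seq qpoly) :=
  [seq [seq odflt [::] (pnorm (sval (spoly_exp g j))) | g <- iota 0 6] | j <- iota 0 4].
Definition qS j : nat -> qpoly := nth [::] (nth [::] qspoly j).

Lemma qspolyE j g x : (j < 4)%N -> (g < 6)%N -> qeval (qS j g) x = Spoly g j x.
Proof.
move=> j4 g6; rewrite /qS (nth_map 0%N) ?size_iota // (nth_map 0%N) ?size_iota // !nth_iota //.
rewrite !add0n.
have : all (fun j => all (fun g => pnorm (sval (spoly_exp g j))) (iota 0 6)) (iota 0 4).
  by vm_compute.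
move=> /allP /(_ j); rewrite mem_iota => /(_ j4) /allP /(_ g); rewrite mem_iota => /(_ g6).
case: (spoly_exp g j) => e he /=; case pe: (pnorm e) => [p|] // _.
by rewrite (pnormP x pe).
Qed.

Lemma residual_spoly x j n : (0 < j <= 3)%N -> (n < 6)%N ->
  residual x (fun i t => Spoly t i x) j n = 0.
Proof.
move=> j13 n6; rewrite -(@qeval_residual 6 x qS) // => [|i t /andP[_ i3] t6]; last exact: qspolyE.
apply: qiszero_eval.
(* All 18 residuals are computed as polynomials in x and have zero coefficients. *)
have : all (fun j => let r := qresidual 6 qS j in all (fun n => qiszero (r n)) (iota 0 6)) (iota 1 3).
  by vm_compute.
by move=> /allP /(_ j); rewrite mem_iota => /(_ j13) /allP /(_ n); rewrite mem_iota => /(_ n6).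
Qed.

Lemma spoly_vanish nu j n : (0 < nu)%N -> (0 < j <= 3)%N -> (n < 6)%N ->
  (j * nu.-1 + 2 = 2 * n)%N -> Spoly n j nu%:R = 0.
Proof.
(* As n is at most 5, j (nu - 1) is at most 8, which leaves finitely many triples to evaluate. *)
move=> nu0 j13 n6 e; have nu9 : (nu <= 9)%N.
  by case/andP: j13 => j0 _; have : (nu.-1 <= j * nu.-1)%N by [exact: leq_pmull]; lia.
rewrite -qspolyE //; last by case/andP: j13.
rewrite -rat_of_Z_nat -rat_of_Q_int -qhornerE.
have : all (fun j => all (fun n => all (fun nu => (j * nu.-1 + 2 == 2 * n)%N ==>
    Qeq_bool (qhorner (qS j n) (inject_Z (BinInt.Z.of_nat nu))) (inject_Z Z0))
    (iota 1 9)) (iota 0 6)) (iota 1 3).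
  by vm_compute.
move=> /allP /(_ j); rewrite mem_iota => /(_ j13) /allP /(_ n); rewrite mem_iota => /(_ n6).
move=> /allP /(_ nu); rewrite mem_iota nu0 => /(_ nu9); rewrite e eqxx => /Qeq_bool_iff h.
by rewrite (rat_of_Q_eq h).
Qed.

Section Evaluation.
Variable nu : nat.
Hypothesis nu_gt0 : (0 < nu)%N.
Notation d := (2 * nu).-1.

(** One-vertex graphs are planar exactly when they have nu + 1 faces, the top degree of the face
    polynomial. *)
Lemma genus_count10 : genus_count nu 1 0 = catalan nu.
Proof.
rewrite -coef_genus // -catalan_lead // /genus_poly /face_poly !coef_sum.
apply: eq_bigr => M /andP[pM cM]; rewrite !coefXn.
have [t e _] := genus_spec (ltn0Sn 0) (dE nu_gt0) pM cM.
have td : top_degree 1 nu = nu.+1 by rewrite /top_degree; lia.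
by congr (nat_of_bool _)%:R; move: e; rewrite td; lia.
Qed.

Lemma genus_countE j n : (0 < j <= 3)%N -> (n < 6)%N ->
  genus_count nu j n = catalan nu ^+ j * Spoly n j nu%:R.
Proof.
elim/ltn_ind: j n => j IHj n; elim/ltn_ind: n => n IHn j13 n6; have /andP[j0 _] := j13.
pose c' i t := catalan nu ^+ i * Spoly t i nu%:R.
have r' : residual nu%:R c' j n = 0 by rewrite residual_scale // residual_spoly // mulr0.
have := @residual_diff nu%:R (genus_count nu) c' j n j0.
rewrite genus_residual // r' subrr => h.
have {h} h : 0 = 2 * (excess j nu%:R + 2 - 2 * n%:R) * (j%:R - 1 + 2 * n%:R) *
    (genus_count nu j n - c' j n).
  apply: h => [i t /andP[i0 ij] tn|t tn].
    by apply: IHj => //; [rewrite i0 (leq_trans (ltnW ij)) //; case/andP: j13 | exact: leq_ltn_trans n6].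
  by apply: IHn => //; exact: ltn_trans n6.
(* The one case where the factor j - 1 + 2n of [residual_diff] vanishes. *)
have [/andP[/eqP j1 /eqP n0]|nz] := boolP ((j == 1) && (n == 0))%N.
  by rewrite j1 n0 genus_count10 mulr1.
(* Here the number of faces would be 0: the table vanishes by computation, and the count by
   [genus_poly_support]. *)
have [e|ne] := eqVneq (j * nu.-1 + 2)%N (2 * n)%N.
  rewrite (spoly_vanish nu_gt0 j13 n6 e) mulr0; apply/eqP; apply: contraT => nc.
  have : (genus_poly d j nu)`_n != 0 by rewrite coef_genus.
  by move/(genus_poly_support j0 (dE nu_gt0)); rewrite top_degreeE //; move: e; lia.
move/esym/eqP: h; rewrite !mulf_eq0.
have /negbTE -> : excess j nu%:R + 2 - 2 * n%:R != 0.
  by rewrite -excessE // -natrD -natrM subr_eq0 eqr_nat.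
have /negbTE -> : j%:R - 1 + 2 * n%:R != 0 :> rat.
  case: (j) j0 nz => // k _ nz; rewrite -natr1 addrK -natrM -natrD pnatr_eq0.
  by move: nz; lia.
by rewrite !orbF subr_eq0 => /eqP.
Qed.
End Evaluation.

Theorem theorem2p4 (nu g j : nat) (nu_ge1 : (1 <= nu)%N) (g_le5 : (g <= 5)%N)
    (j_bounds : (1 <= j <= 3)%N) :
  (nb_graphs g (2 * nu) j)%:R = catalan nu ^+ j * Spoly g j nu%:R :> rat.
Proof. exact: genus_countE. Qed.
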